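(* Let $n\in\mathbb N_0$, $\lambda\in\mathbb C\setminus(-\infty,-\frac14)$ and let $\nu$ be a (finite, complex) Borel measure on $\partial\mathbb D$. Then the normalised $\lambda$-polyharmonic function $$ \frac{\boldsymbol\Pi_{n,\lambda}\nu(z)}{\Phi_n(z\,|\,\lambda)}\qquad(|z|\ge r_{n,\lambda}) $$ converges admissibly at $\mathsf m$-almost every point of $\partial\mathbb D$. The limit is the Radon--Nikodym derivative $d\nu^{\mathrm{ac}}/d\mathsf m$, where $\nu^{\mathrm{ac}}$ is the absolutely continuous part of $\nu$ with respect to $\mathsf m$. If $\lambda=-\frac14$, convergence is even enlarged-admissible.
   Context: $\mathbb D$ is the open unit disk in $\mathbb C$, $\partial\mathbb D$ the unit circle, $\mathsf m$ the normalised Lebesgue (arc length) measure on $\partial\mathbb D$, also written $d\xi$. $\rho$ is the hyperbolic metric $\rho(z,w)=\log\frac{|1-z\bar w|+|z-w|}{|1-z\bar w|-|z-w|}$. The Poisson kernel is $P(z,\xi)=\frac{1-|z|^2}{|\xi-z|^2}$, and $\mathfrak h(z,\xi)=-\log P(z,\xi)$. For $\lambda\in\mathbb C$, $s(\lambda)=\sqrt{\lambda+\frac14}$, where the square root of $re^{i\phi}$ ($r\ge0$, $\phi\in(-\pi,\pi]$) is $\sqrt r\,e^{i\phi/2}$. Define $P_n(z,\xi\,|\,\lambda)=\frac{1}{n!(2s(\lambda))^n}(-\mathfrak h(z,\xi))^nP(z,\xi)^{s(\lambda)+1/2}$ if $\lambda\ne-\frac14$, and $P_n(z,\xi\,|-\frac14)=\frac1{(2n)!}\mathfrak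 h(z,\xi)^{2n}P(z,\xi)^{1/2}$; $\Phi_n(z\,|\,\lambda)=\int_{\partial\mathbb D}P_n(z,\xi\,|\,\lambda)\,d\xi$; $\boldsymbol\Pi_{n,\lambda}\nu(z)=\int_{\partial\mathbb D}P_n(z,\xi\,|\,\lambda)\,d\nu(\xi)$. For $n\ge1$, $r_{n,\lambda}\in(0,1)$ is a fixed number such that $\Phi_n(z\,|\,\lambda)\ne0$ for $|z|\ge r_{n,\lambda}$ (it exists for $\lambda\in\mathbb C\setminus(-\infty,-\frac14)$), and $r_{0,\lambda}=0$ ($\Phi_0$ has no zeroes in $\mathbb D$ for such $\lambda$). For $\zeta\in\partial\mathbb D$ and $a\ge0$, with $[0,\zeta]$ the line segment from $0$ to $\zeta$, the admissible region is $\Gamma_a(\zeta)=\{z\in\mathbb D:\rho(z,[0,\zeta])\le a\}$ and the enlarged-admissible region is $\Gamma_{(a)}(\zeta)=\{z\in\mathbb D:\rho(z,[0,\zeta])\le a+\log\rho(z,0)\}$. A function $f$ converges admissibly (respectively enlarged-admissibly) at $\xi\in\partial\mathbb D$ if for every $a\ge0$ the limit of $f(z)$ as $z\to\xi$ with $z\in\Gamma_a(\xi)$ (respectively $z\in\Gamma_{(a)}(\xi)$) exists and is finite. *)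

(* Defs.v *)
From HB Require Import structures.
From mathcomp Require Import all_boot all_order all_algebra.
From mathcomp Require Import complex.
From mathcomp Require Import all_classical all_reals all_analysis.
From mathcomp Require Import measurable_realfun.

Set Implicit Arguments.
Unset Strict Implicit.
Unset Printing Implicit Defensive.

Import Order.TTheory GRing.Theory Num.Theory.
Import numFieldNormedType.Exports.
Import Normc.

Local Open Scope classical_set_scope.
Local Open Scope ring_scope.
Local Open Scope complex_scope.

Local Notation Re := complex.Re.
Local Notation Im := complex.Im.

(* The usual topology of the complex plane. *)
HB.instance Definition _ (R : realType) := NormedModule.copy R[i] R[i]^o.

Definition disk (R : realType) : set R[i] := [set z | normc z < 1].

(* The unit circle as a type, with the topology induced by R[i] and its Borel
   sigma-algebra. *)
Definition circle (R : realType) : Type :=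
  set_type [set z : R[i] | normc z = 1].

Section circle_structure.
Variable R : realType.

Definition circle_val (xi : circle R) : R[i] := \val xi.

HB.instance Definition _ := Topological.on (circle R).

Lemma normc_cis (t : R) : normc (cos t +i* sin t) = 1.
Proof. by rewrite /= cos2Dsin2 sqrtr1. Qed.

Definition cis (t : R) : circle R :=
  exist _ (cos t +i* sin t) (mem_set (normc_cis t)).

HB.instance Definition _ := isPointed.Build (circle R) (cis 0).

HB.instance Definition _ :=
  Measurable.copy (circle R) (g_sigma_algebraType (@open (circle R))).

Lemma real_complex_continuous : continuous (fun x : R => x%:C : R[i]).
Proof.
move=> x; apply/cvgrPdist_lt => -[e f] /=.
rewrite ltcE /= => /andP[/eqP -> e0].
near=> y; rewrite -rmorphB normc_def /= expr0n /= addr0 sqrtr_sqr ltcR.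
by near: y; apply: cvgr_dist_lt.
Unshelve. all: by end_near. Qed.

Lemma cis_continuous : continuous (cis : R -> circle R).
Proof.
apply/continuousP => _ [A oA <-].
have cc : continuous (fun t : R => (cos t)%:C + 'i * (sin t)%:C : R[i]).
  move=> t; apply: cvgD; last apply: cvgMr.
    exact: (continuous_comp (@continuous_cos R t) (@real_complex_continuous _)).
  exact: (continuous_comp (@continuous_sin R t) (@real_complex_continuous _)).
have -> : cis @^-1` (set_val @^-1` A) =
    (fun t : R => (cos t)%:C + 'i * (sin t)%:C) @^-1` A.
  by apply/seteqP; split => t /=; rewrite /preimage /= set_valE /=; simpc.
by move/continuousP : cc; exact.
Qed.

Lemma measurable_cis :
  measurable_fun setT (cis : measurableTypeR R -> circle R).
Proof.
have H : @measurable _ (circle R) = <<s @open (circle R) >> by [].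
refine (@measurability _ _ (measurableTypeR R) (circle R) setT cis _ H _).
move=> _ [A oA <-]; rewrite setTI; apply: open_measurable.
by move/continuousP : cis_continuous; exact.
Qed.

Lemma pi2_gt0 : 0 < 2 * pi :> R.
Proof. by rewrite mulr_gt0// pi_gt0. Qed.

(* Normalised arc length: the law of e^{it} for t uniform in [0, 2 pi]. *)
Definition arc_measure : set (circle R) -> \bar R :=
  pushforward (uniform_prob pi2_gt0) (cis : measurableTypeR R -> circle R).

Let cis_mfun : {mfun measurableTypeR R >-> circle R} :=
  HB.pack (cis : measurableTypeR R -> circle R)
    (@isMeasurableFun.Build _ _ _ _ _ measurable_cis).

Let arc_measure0 : arc_measure set0 = 0%E.
Proof.
exact: (@measure0 _ _ _ (distribution (uniform_prob pi2_gt0) cis_mfun)).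
Qed.

Let arc_measure_ge0 A : (0 <= arc_measure A)%E.
Proof.
exact: (@measure_ge0 _ _ _ (distribution (uniform_prob pi2_gt0) cis_mfun)).
Qed.

Let arc_measure_sigma_additive : semi_sigma_additive arc_measure.
Proof.
exact: (@measure_semi_sigma_additive _ _ _
  (distribution (uniform_prob pi2_gt0) cis_mfun)).
Qed.

HB.instance Definition _ := isMeasure.Build _ _ _ arc_measure
  arc_measure0 arc_measure_ge0 arc_measure_sigma_additive.

Let arc_measure_setT : arc_measure setT = 1%:E.
Proof. by rewrite /arc_measure /pushforward preimage_setT probability_setT. Qed.

HB.instance Definition _ := Measure_isProbability.Build _ _ _
  arc_measure arc_measure_setT.

End circle_structure.

(* A finite complex measure, given by its real and imaginary parts, which are
   finite signed measures (a charge only takes finite values). *)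
Record complex_measure d (T : measurableType d) (R : realType) :=
  ComplexMeasure {
    cm_re : {charge set T -> \bar R};
    cm_im : {charge set T -> \bar R} }.

Section complex_integration.
Context d (T : measurableType d) (R : realType).
Implicit Types (nu : {charge set T -> \bar R}) (mu : complex_measure T R).

Definition hahn nu :
  {PN : set T * set T | hahn_decomposition nu PN.1 PN.2} :=
  let: exist P exN := cid (Hahn_decomposition nu) in
  let: exist N nuPN := cid exN in
  exist _ (P, N) nuPN.

(* The Jordan decomposition, hence this integral, does not depend on the choice
   of a Hahn decomposition. *)
Definition charge_integral nu (f : T -> R) : R :=
  \int[jordan_pos (svalP (hahn nu))]_x f x -
  \int[jordan_neg (svalP (hahn nu))]_x f x.

Definition complex_integral mu (f : T -> R[i]) : R[i] :=
  (charge_integral (cm_re mu) (fun x => Re (f x)) -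
   charge_integral (cm_im mu) (fun x => Im (f x))) +i*
  (charge_integral (cm_re mu) (fun x => Im (f x)) +
   charge_integral (cm_im mu) (fun x => Re (f x))).

(* [mu_ac] and [mu_s] are the absolutely continuous and the singular part of
   [mu] with respect to [m]; they are uniquely determined on measurable sets. *)
Definition lebesgue_decomposition (m : {measure set T -> \bar R})
    (mu mu_ac mu_s : complex_measure T R) : Prop :=
  [/\ forall A, measurable A ->
        cm_re mu A = (cm_re mu_ac A + cm_re mu_s A)%E /\
        cm_im mu A = (cm_im mu_ac A + cm_im mu_s A)%E,
      cm_re mu_ac `<< m /\ cm_im mu_ac `<< m &
      exists N : set T, [/\ measurable N, m N = 0%E,
        (cm_re mu_s).-null_set (~` N) & (cm_im mu_s).-null_set (~` N)]].

Definition complex_Radon_Nikodym (mu : complex_measure T R)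
    (m : {sigma_finite_measure set T -> \bar R}) (x : T) : R[i] :=
  fine (Radon_Nikodym (cm_re mu) m x) +i* fine (Radon_Nikodym (cm_im mu) m x).

End complex_integration.

Section polyharmonic.
Variable R : realType.
Implicit Types (z w lambda : R[i]) (xi : circle R) (n : nat).

Definition cexp w : R[i] := (expR (Re w))%:C * (cos (Im w) +i* sin (Im w)).

(* x^w for a real base x > 0. *)
Definition cpow (x : R) w : R[i] := cexp (w * (ln x)%:C).

Definition poisson z xi : R :=
  (1 - normc z ^+ 2) / normc (circle_val xi - z) ^+ 2.

Definition horo z xi : R := - ln (poisson z xi).

(* [sqrtc] is the principal branch: it has nonnegative real part, and maps a
   negative real [- t] to [i sqrt t]. *)
Definition spar lambda : R[i] := sqrtc (lambda + 4^-1).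

Definition poly_kernel n lambda z xi : R[i] :=
  if lambda == - 4^-1 then
    (((2 * n)`!)%:R^-1 * horo z xi ^+ (2 * n) * poisson z xi `^ 2^-1)%:C
  else
    ((n`!)%:R * (2 * spar lambda) ^+ n)^-1 * ((- horo z xi) ^+ n)%:C *
    cpow (poisson z xi) (spar lambda + 2^-1).

Definition poly_spherical n lambda z : R[i] :=
  (\int[@arc_measure R]_xi Re (poly_kernel n lambda z xi)) +i*
  (\int[@arc_measure R]_xi Im (poly_kernel n lambda z xi)).

Definition poly_transform n lambda (nu : complex_measure (circle R) R) z :
    R[i] :=
  complex_integral nu (poly_kernel n lambda z).

Definition normalised_transform n lambda nu z : R[i] :=
  poly_transform n lambda nu z / poly_spherical n lambda z.

(* [poly_spherical 0 lambda] has no zero in the disk when [lambda] is not in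
   ]-oo, -1/4[, whence [r = 0] for [n = 0]. *)
Definition normalising_radius n lambda (r : R) : Prop :=
  if n is 0 then r = 0
  else 0 < r < 1 /\
       forall z, disk z -> r <= normc z -> poly_spherical n lambda z != 0.

Definition rho z w : R :=
  ln ((normc (1 - z * conjc w) + normc (z - w)) /
      (normc (1 - z * conjc w) - normc (z - w))).

Definition radius xi : set R[i] :=
  [set t%:C * circle_val xi | t in `[0, 1]].

(* The end point of the segment lies on the circle, at infinite hyperbolic
   distance of z; there the formula for [rho] would divide by 0, so it is
   excluded from the infimum. *)
Definition rho_radius z xi : R :=
  inf [set rho z w | w in radius xi `&` @disk R].

Definition admissible_region (a : R) xi : set R[i] :=
  [set z | disk z /\ rho_radius z xi <= a].

(* The origin is excluded because log 0 is -oo, whereas [ln 0 = 0]. *)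
Definition enlarged_region (a : R) xi : set R[i] :=
  [set z | [/\ disk z, z != 0 & rho_radius z xi <= a + ln (rho z 0)]].

(* [f] is only considered on the domain [D]. *)
Definition converges_in (region : R -> circle R -> set R[i]) (D : set R[i])
    (f : R[i] -> R[i]) xi (l : R[i]) : Prop :=
  forall a : R, 0 <= a ->
    f z @[z --> within (region a xi `&` D) (nbhs (circle_val xi))] --> l.

Definition converges_admissibly := converges_in admissible_region.

Definition converges_enlarged_admissibly := converges_in enlarged_region.

End polyharmonic.

(* Main.v *)
Require Import Defs.
From HB Require Import structures.
From mathcomp Require Import all_boot all_order all_algebra.
From mathcomp Require Import complex ring lra.
From mathcomp Require Import all_classical all_reals all_analysis.
From mathcomp Require Import measurable_realfun.

Set Implicit Arguments.
Unset Strict Implicit.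
Unset Printing Implicit Defensive.

Import Order.TTheory GRing.Theory Num.Theory.
Import numFieldNormedType.Exports.
Import Normc.

Local Open Scope classical_set_scope.
Local Open Scope ring_scope.
Local Open Scope complex_scope.

Local Notation Re := complex.Re.
Local Notation Im := complex.Im.

(* The normalised kernel is an approximate identity. Write [d = 1 - |z|], [L = - ln d] and
   [sigma = Re (spar lambda)]. The modulus of the kernel is a constant times
   [|ln P|^p P^(sigma + 1/2)], whose integral is of order [L^p d^(1/2 - sigma)] if [sigma > 0], and
   [L^(p + 1) d^(1/2)] if [lambda = -1/4]. The spherical function has a lower bound of the same
   order: at angle [d u] from [z] the Poisson kernel is about [2 / (d (1 + u^2))], so for
   [sigma > 0] dominated convergence leaves the integral of
   [(1 + u^2)^-(sigma + 1/2 + i tau)], and integrating by parts its imaginary part shows that it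
   does not vanish.
   The approach regions lie within [K d], respectively [K L d], of the boundary point, so a dyadic
   decomposition of the circle around that point bounds the integral of the kernel against a
   measure of vanishing density there by an arbitrarily small multiple of the spherical function.
   By Vitali's covering argument, at almost every point this applies to the singular part of [nu]
   and to [|g - g zeta| dm], where [g] is the density of the absolutely continuous part. *)

(** * Arcs of the circle *)

(** The kernel is complex-valued, so its integral might be far smaller than the integral of its
    modulus; the argument needs both to have the same order. Moreover, for [tau != 0] the phase of
    the spherical function keeps turning with [ln d], so a limit exists only after turning it back.
    In the critical case the kernel is real and nonnegative, and a minorant on part of the circle is
    enough.

    The gain at [lambda = -1/4] is a logarithm. For [sigma > 0] the contributions of scales larger
    than [d] decay geometrically; for [sigma = 0] all dyadic scales between [d] and 1 contribute
    equally, and there are about [L] of them. The maximum of the kernel times the radius [K L d] is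
    then still of the order of the full mass, so an arc of this radius can serve as a single near
    zone.

    All estimates concern real test functions dominated by the modulus of the kernel, integrated
    against positive measures. The real and imaginary parts of the kernel and the four Jordan parts
    of [nu] are instances of one statement, and the two cases of [lambda] differ only in [p],
    [sigma] and constants. *)

Section circle_metric.
Variable R : realType.
Implicit Types (x y : R[i]) (z w xi : circle R).

Lemma normc_ge0 x : 0 <= normc x.
Proof. by case: x => a b; exact: sqrtr_ge0. Qed.

Lemma normrcE x : `|x| = (normc x)%:C.
Proof. by []. Qed.

Lemma normcBC x y : normc (x - y) = normc (y - x).
Proof. by rewrite -opprB normcN. Qed.

Lemma normc_triangle (y x v : R[i]) : normc (x - v) <= normc (x - y) + normc (y - v).
Proof. by rewrite (le_trans _ (le_normcD _ _))// subrKA. Qed.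

Lemma normcR (a : R) : normc a%:C = `|a|.
Proof. by rewrite /= expr0n /= addr0 sqrtr_sqr. Qed.

Lemma normc_circle z : normc (circle_val z) = 1.
Proof. by case: z => x Hx; exact: (set_mem Hx). Qed.

Lemma circle_val_inj : injective (@circle_val R).
Proof. exact: val_inj. Qed.

Lemma open_normc (x : R[i]) (h : R) : open [set y | normc (y - x) < h].
Proof.
have -> : [set y | normc (y - x) < h] = ball x h%:C.
  by apply/seteqP; split => y; rewrite -ball_normE /= normcBC ltcR.
have [h0|h0] := ltP 0 h; first by apply: ball_open; rewrite ltcR.
suff -> : ball x h%:C = set0 by exact: open0.
apply/seteqP; split => // y; rewrite -ball_normE /= ltcR => /(le_lt_trans (normc_ge0 _)).
by rewrite ltNge h0.
Qed.

(** Radii are chordal: an arc is the trace of a Euclidean disc, so distances to points of the open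
    disk enter by the plain triangle inequality. *)
Definition arc z (h : R) : set (circle R) :=
  [set xi | normc (circle_val xi - circle_val z) < h].

Lemma arc_center z (h : R) : 0 < h -> arc z h z.
Proof. by rewrite /arc /= subrr normc0. Qed.

Lemma arc_sub z (h h' : R) : h <= h' -> arc z h `<=` arc z h'.
Proof. by move=> hh' xi /= /lt_le_trans; exact. Qed.

Lemma open_arc z (h : R) : open (arc z h).
Proof. by exists [set y | normc (y - circle_val z) < h] => //; exact: open_normc. Qed.

Lemma open_circle_measurable (A : set (circle R)) : open A -> measurable A.
Proof. by move=> oA; exact: sub_gen_smallest. Qed.

Lemma measurable_arc z (h : R) : measurable (arc z h).
Proof. by apply: open_circle_measurable; exact: open_arc. Qed.

Lemma open_arc_sub (A : set (circle R)) z : open A -> A z ->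
  exists2 h : R, 0 < h & arc z h `<=` A.
Proof.
move=> [B oB <-] Bz.
have : nbhs (circle_val z) B by exact: (open_nbhs_nbhs (conj oB Bz)).
rewrite -nbhs_ballE => -[[e f] /=].
move=> + eB.
rewrite ltcE /= => /andP[/eqP f0 e0]; rewrite {}f0 in eB; exists e => // xi xiz.
by apply: eB; rewrite -ball_normE /ball_/= normrcE ltcR normcBC.
Qed.

Lemma continuous_circle_measurable (f : circle R -> R) :
  continuous f -> measurable_fun setT f.
Proof.
move=> /continuousP cf.
apply: (measurability _ (RGenOpens.measurableE R)) => _ [_ [a [b ->] <-]].
rewrite setTI; apply: open_circle_measurable; apply: cf; exact: interval_open.
Qed.

Lemma continuous_circle_val : continuous (@circle_val R).
Proof. exact: initial_continuous. Qed.

Lemma dist_normcB x y (v : R[i]) :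
  `|normc (v - x) - normc (y - x)| <= normc (y - v).
Proof.
have h1 := normc_triangle v y x; have h2 := normc_triangle y v x.
by rewrite ler_norml; rewrite (normcBC v y) in h2; lra.
Qed.

Lemma continuous_normcB x : continuous (fun y => normc (y - x)).
Proof.
move=> z; apply/(@cvgrPdist_lt _ _ _ (nbhs z) _) => e e0.
apply: (@filterS _ (nbhs z) _ [set y | normc (y - z) < e]); last first.
  by apply: open_nbhs_nbhs; split; [exact: open_normc|rewrite /= subrr normc0].
by move=> xi /= xiz; exact: le_lt_trans (dist_normcB _ _ _) xiz.
Qed.

Lemma continuous_circle_dist x : continuous (fun xi => normc (circle_val xi - x)).
Proof.
move=> z; apply: (@continuous_comp _ _ _ (@circle_val R) (fun y => normc (y - x))).
  exact: continuous_circle_val.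
exact: continuous_normcB.
Qed.

Lemma cis_surj z : exists2 t : R, 0 <= t <= pi *+ 2 & cis t = z.
Proof.
case: z => -[a b] ab1; have /= := set_mem ab1 => /(congr1 (fun x : R => x ^+ 2)).
rewrite expr1n sqr_sqrtr ?addr_ge0 ?sqr_ge0// => ab.
have a1 : -1 <= a <= 1.
  rewrite -ler_norml -(@ler_pXn2r _ 2)// ?nnegrE// real_normK ?num_real//.
  by rewrite expr1n -ab lerDl sqr_ge0.
have pi0 := pi_gt0 R; have b2 : b ^+ 2 = 1 - a ^+ 2 by lra.
have aitv : a \in `[(-1), 1] by rewrite in_itv.
have acos0 := acos_ge0 a1; have acospi := acos_lepi a1.
have [b0|b0] := leP 0 b.
- exists (acos a); first by rewrite mulr2n; apply/andP; split; lra.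
  apply: circle_val_inj; rewrite /circle_val/= acosK// sin_acos//.
  by rewrite -b2 sqrtr_sqr ger0_norm.
- exists (pi *+ 2 - acos a); first by rewrite mulr2n; apply/andP; split; lra.
  apply: circle_val_inj; rewrite /circle_val/= addrC cosD2pi sinD2pi cosN sinN.
  by rewrite acosK// sin_acos// -b2 sqrtr_sqr ltr0_norm// opprK.
Qed.

Lemma circle_compact : compact [set: circle R].
Proof.
suff -> : [set: circle R] = @cis R @` `[0, pi *+ 2]%classic.
  apply: continuous_compact; last exact: segment_compact.
  by apply/continuous_subspaceT => ?; exact: cis_continuous.
apply/seteqP; split => // z _; have [t t02 <-] := cis_surj z.
by exists t => //=; rewrite in_itv.
Qed.

End circle_metric.

(** * Arc length is at most linear in the chordal radius *)

Section arc_measure_bound.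
Variable R : realType.

Lemma mulcos_le_sin (y : R) : 0 <= y <= pi -> y * cos y <= sin y.
Proof.
move=> /andP[y0 ypi].
have [c] : exists2 c : R, c \in `[0, y] & sin y - sin 0 = cos c * (y - 0).
  apply: MVT_segment => //.
  by apply: continuous_subspaceT => x; exact: continuous_sin.
rewrite in_itv/= sin0 !subr0 => /andP[c0 cy] ->.
rewrite mulrC ler_wpM2r// leNgt ltr_cos ?in_itv/= -?leNgt ?y0 ?c0//.
exact: le_trans ypi.
Qed.

(** By [mulcos_le_sin], [sin y = 2 sin (y / 2) cos (y / 2)] is at least
    [y cos^2 (y / 2) = y (1 + cos y) / 2]. This weak form of Jordan's inequality makes a chord at
    least half as long as its angle. *)
Lemma sin_ge_half (y : R) : 0 <= y <= pi / 2 -> y / 2 <= sin y.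
Proof.
move=> /andP[y0 ypi]; have pi0 := pi_gt0 R.
have h0 : 0 <= y / 2 by rewrite divr_ge0.
have := @mulcos_le_sin (y / 2); rewrite h0 => /(_ ltac:(lra)) sE.
have cy0 : 0 <= cos y by apply: cos_ge0_pihalf; lra.
have y2 : y = (y / 2) *+ 2 by rewrite mulr2n; field.
have e1 : sin y = 2 * (cos (y / 2) * sin (y / 2)).
  by rewrite [in LHS]y2 sin_mulr2n mulr2n; ring.
have e2 : cos y = 2 * cos (y / 2) ^+ 2 - 1.
  by rewrite [in LHS]y2 cos_mulr2n mulr2n; ring.
have ch : 0 <= cos (y / 2) by apply: cos_ge0_pihalf; lra.
have : cos (y / 2) ^+ 2 * y <= sin y.
  have := ler_wpM2l ch sE; rewrite e1 expr2 -(ler_pM2l (ltr0n R 2)).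
  by apply: le_trans; rewrite le_eqVlt; apply/orP; left; apply/eqP; field.
suff : y * (1 / 2) <= y * cos (y / 2) ^+ 2 by lra.
by rewrite ler_wpM2l//; lra.
Qed.

Lemma normc_cisB (s t : R) :
  normc (circle_val (cis t) - circle_val (cis s)) = 2 * `|sin ((t - s) / 2)|.
Proof.
rewrite /circle_val/=.
have e : cos (t - s) = 1 - 2 * sin ((t - s) / 2) ^+ 2.
  rewrite [in LHS](_ : t - s = ((t - s) / 2) *+ 2); last by rewrite mulr2n; field.
  by rewrite cos_mulr2n cos2sin2 mulr2n; ring.
have -> : (cos t - cos s) ^+ 2 + (sin t - sin s) ^+ 2 = (2 * sin ((t - s) / 2)) ^+ 2.
  have := cos2Dsin2 t; have := cos2Dsin2 s; move: e; rewrite cosB.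
  by move: (cos t) (cos s) (sin t) (sin s) (sin _) => a b c d f; lra.
by rewrite sqrtr_sqr normrM ger0_norm.
Qed.

Lemma norm_sin (x : R) : `|x| <= pi -> `|sin x| = sin `|x|.
Proof.
have [x0|x0] := ler0P x => xpi; last by rewrite ger0_norm ?sin_ge0_pi ?(ltW x0).
by rewrite -normrN -sinN ger0_norm ?sin_ge0_pi ?oppr_ge0 ?x0.
Qed.

Lemma normc_cisB_ge (s t : R) : `|t - s| <= pi ->
  `|t - s| / 2 <= normc (circle_val (cis t) - circle_val (cis s)).
Proof.
move=> tspi; have pi0 := pi_gt0 R.
have n2 : `|(t - s) / 2| = `|t - s| / 2 by rewrite normrM (@ger0_norm _ 2^-1).
rewrite normc_cisB norm_sin ?n2; last by lra.
have := @sin_ge_half (`|t - s| / 2); rewrite divr_ge0//=.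
by have := normr_ge0 (t - s); lra.
Qed.

Lemma cisD2pi (t : R) : cis (t + pi *+ 2) = cis t.
Proof. by apply: circle_val_inj; rewrite /circle_val/= cosD2pi sinD2pi. Qed.

Lemma cisB2pi (t : R) : cis (t - pi *+ 2) = cis t.
Proof. by rewrite -[in RHS](subrK (pi *+ 2) t) cisD2pi. Qed.

(** An arc may wrap around the ends of the parameter interval, hence the two translated balls; the
    radius doubles because a chord is at least half its angle. *)
Lemma cis_arc_cover (s h : R) : 0 <= s <= pi *+ 2 ->
  @cis R @^-1` arc (cis s) h `&` `[0, pi *+ 2] `<=`
  ball s (2 * h) `|` (ball (s + pi *+ 2) (2 * h) `|` ball (s - pi *+ 2) (2 * h)).
Proof.
rewrite mulr2n => /andP[s0 s2] t [/= ]; rewrite /arc /= in_itv/= => tsh /andP[t0 t2].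
have pi0 := pi_gt0 R.
have key (s' : R) : cis s' = cis s -> `|t - s'| <= pi -> ball s' (2 * h) t.
  move=> s's /normc_cisB_ge; rewrite s's => /le_lt_trans/(_ tsh).
  by rewrite -ball_normE /ball_/= distrC; lra.
have [tspi|tspi] := leP `|t - s| pi; first by left; exact: key.
have [st|st] := leP s t.
- right; left; apply: key; first by rewrite -mulr2n cisD2pi.
  by move: tspi; rewrite ger0_norm ?subr_ge0// ler_norml; lra.
- right; right; apply: key; first by rewrite -mulr2n cisB2pi.
  by move: tspi; rewrite ltr0_norm ?subr_lt0// ler_norml; lra.
Qed.

Lemma arc_measureE (A : set (circle R)) : measurable A ->
  arc_measure A =
  ((2 * pi)^-1%:E * lebesgue_measure ((@cis R) @^-1` A `&` `[0%R, (pi *+ 2)%R]))%E.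
Proof.
move=> mA; have mcA : measurable ((@cis R) @^-1` A).
  by rewrite -[X in measurable X]setTI; exact: measurable_cis.
rewrite /arc_measure /pushforward /uniform_prob integral_uniform_pdf.
have -> : 2 * pi = pi *+ 2 :> R by rewrite mulr_natl.
under eq_integral => x.
  rewrite inE => -[_]; rewrite /= in_itv/= /uniform_pdf => ->.
  over.
rewrite integral_cst ?subr0//; exact: measurableI.
Qed.

(** 12 stands for three intervals of length [4 * h]; the normalisation [1 / (2 pi)] is merely
    bounded by 1, as only linearity in [h] matters. *)
Lemma arc_measure_arc (z : circle R) (h : R) : 0 <= h ->
  (arc_measure (arc z h) <= (12 * h)%:E)%E.
Proof.
move=> h0; have [s s02 <-] := cis_surj z; have pi2 := pi_ge2 R.
rewrite arc_measureE; last exact: measurable_arc.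
have h20 : 0 <= 2 * h by rewrite mulr_ge0.
have : (lebesgue_measure (@cis R @^-1` arc (cis s) h `&` `[0%R, (pi *+ 2)%R]) <=
    (12 * h)%:E)%E.
  apply: (@le_trans _ _ (lebesgue_measure (ball s (2 * h) `|`
      (ball (s + pi *+ 2) (2 * h) `|` ball (s - pi *+ 2) (2 * h))))).
    apply: le_measure; last exact: cis_arc_cover.
    - rewrite inE; apply: measurableI => //.
      by rewrite -[X in measurable X]setTI; apply: measurable_cis => //; exact: measurable_arc.
    - by rewrite inE; repeat apply: measurableU; exact: measurable_ball.
  apply: le_trans (measureU2 _ _ _) _; [exact: measurable_ball|
    by apply: measurableU; exact: measurable_ball|].
  rewrite (_ : 12 * h = 2 * h *+ 2 + (2 * h *+ 2 + 2 * h *+ 2)); last by rewrite !mulr2n; ring.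
  have Hb (x : R) : (lebesgue_measure (ball x (2 * h)) <= (2 * h *+ 2)%:E)%E.
    by rewrite lebesgue_measure_ball.
  rewrite (EFinD (2 * h *+ 2) (_ + _)); apply: leeD; first exact: Hb.
  apply: le_trans (measureU2 _ _ _) _; try exact: measurable_ball.
  by rewrite EFinD; apply: leeD; exact: Hb.
move=> H; apply: (le_trans _ H); rewrite gee_pMl//.
  by rewrite lee_fin invf_le1; lra.
Qed.

End arc_measure_bound.

(** * Differentiation of measures on the circle *)

Section regularity.
Variable R : realType.
Implicit Types (beta : {finite_measure set (circle R) -> \bar R}).

(** The inner closed set is given by its complement [V], so that passing to the complement of [A]
    just swaps [U] and [V]. *)
Definition circle_regular beta (A : set (circle R)) := forall e : R, 0 < e ->
  exists U V, [/\ open U, open V, A `<=` U, ~` V `<=` A & (beta (U `&` V) < e%:E)%E].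

Lemma finite_measure_lty beta (A : set (circle R)) :
  measurable A -> (beta A < +oo)%E.
Proof. by move=> mA; rewrite ltey_eq fin_num_measure. Qed.

Lemma nonincreasing_measure_small beta (F : (set (circle R))^nat) (e : R) :
  0 < e -> (forall i, measurable (F i)) -> nonincreasing_seq F ->
  \bigcap_n F n = set0 -> exists n, (beta (F n) < e%:E)%E.
Proof.
move=> e0 mF niF F0.
have := @nonincreasing_cvg_mu _ _ _ beta F (finite_measure_lty beta (mF 0%N)) mF.
rewrite F0 measure0 => /(_ measurable0 niF) /fine_cvgP[_].
move=> /cvgrPdist_lt /(_ _ e0)[n _ /(_ n (leqnn n))]; rewrite sub0r normrN.
move=> /= /(le_lt_trans (ler_norm _)) H; exists n.
by rewrite -[beta _]fineK ?lte_fin// fin_num_measure.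
Qed.

(** [V n] is the [1/(n+1)]-neighbourhood of the complement of [A]. Every point of the open set [A]
    eventually leaves it, and continuity from above applies. *)
Lemma open_circle_regular beta A : open A -> circle_regular beta A.
Proof.
move=> oA e e0.
pose V n := \bigcup_(y in ~` A) arc y (n.+1%:R^-1).
have oV n : open (V n) by apply: bigcup_open => y _; exact: open_arc.
have VA0 : \bigcap_n (A `&` V n) = set0.
  apply/seteqP; split => // x /= AV.
  have Ax := (AV 0%N I).1; have [h h0 hA] := open_arc_sub oA Ax.
  have [n nh] : exists n : nat, n.+1%:R^-1 < h.
    exists (Num.truncn h^-1); rewrite invf_plt ?posrE//.
    by have /andP[] := truncn_itv (ltW (eqbRL (invr_gt0 h) h0)).
  have [y yA] := (AV n I).2; rewrite /arc /= normcBC => yx.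
  by apply: yA; apply: hA; exact: lt_trans yx nh.
have [|||n Hn] := @nonincreasing_measure_small beta (fun n => A `&` V n) e e0.
- by move=> i; apply: measurableI; exact: open_circle_measurable.
- move=> i j ij; apply/subsetPset => x [Ax [y yA yx]]; split => //; exists y => //.
  by apply: arc_sub yx; rewrite lef_pV2 ?posrE// ler_nat.
- exact: VA0.
exists A, (V n); split => //.
move=> x; apply: contra_notP => xA; exists x => //.
by apply: arc_center; rewrite invr_gt0.
Qed.

Lemma measurable_circle_regular beta A : measurable A -> circle_regular beta A.
Proof.
suff sA : sigma_algebra setT [set A | measurable A /\ circle_regular beta A].
  move=> mA; suff : [set A | measurable A /\ circle_regular beta A] A by case.
  apply: (smallest_sub sA _ mA) => B oB.
  by split; [exact: open_circle_measurable|exact: open_circle_regular].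
split.
- by split => //; apply: open_circle_regular; exact: open0.
- move=> B [mB rB]; rewrite setTD; split; first exact: measurableC.
  move=> e /rB [U [V [oU oV BU VB UV]]]; exists V, U; split => //.
  + by move=> x; apply: contra_notP => Vx; apply: VB.
  + exact: subsetC.
  + by rewrite setIC.
move=> B mrB; have mB i : measurable (B i) by case: (mrB i).
split; first exact: bigcup_measurable.
move=> e e0; have e4 : 0 < e / 2 by rewrite divr_gt0.
have H i : {UV : set (circle R) * set (circle R) |
    [/\ open UV.1, open UV.2, B i `<=` UV.1, ~` UV.2 `<=` B i &
     (beta (UV.1 `&` UV.2) < (e / 2 / (2 ^ i.+1)%:R)%:E)%E]}.
  apply: cid; have [_ /(_ (e / 2 / (2 ^ i.+1)%:R))] := mrB i.
  case; first by rewrite divr_gt0// ltr0n expn_gt0.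
  by move=> U [V HUV]; exists (U, V).
pose U i := (sval (H i)).1; pose V i := (sval (H i)).2.
have oU i : open (U i) by rewrite /U; case: (H i) => -[? ?] [].
have oV i : open (V i) by rewrite /V; case: (H i) => -[? ?] [].
have BU i : B i `<=` U i by rewrite /U; case: (H i) => -[? ?] [].
have VB i : ~` V i `<=` B i by rewrite /V; case: (H i) => -[? ?] [].
have UV i : (beta (U i `&` V i) < (e / 2 / (2 ^ i.+1)%:R)%:E)%E.
  by rewrite /U /V; case: (H i) => -[? ?] [].
have mU i : measurable (U i) by exact: open_circle_measurable.
have mV i : measurable (V i) by exact: open_circle_measurable.
(* A countable union of closed sets need not be closed, so the inner set is a finite union; [W n] is
   what this truncation loses, and it gets the other half of [e]. *)
pose W n := \bigcup_i U i `\` \big[setU/set0]_(i < n) U i.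
have mbU n : measurable (\big[setU/set0]_(i < n) U i) by exact: bigsetU_measurable.
have mW n : measurable (W n) by apply: measurableD => //; exact: bigcup_measurable.
have [||n Wn] := @nonincreasing_measure_small beta W (e / 2) e4 mW.
- move=> i j ij; apply/subsetPset; apply: setDS.
  exact: subset_bigsetU.
- apply/seteqP; split => // x xW; have [[i _ Uix] _] := xW 0%N I.
  have [_] := xW i.+1 I; apply; rewrite big_ord_recr/=; by right.
exists (\bigcup_i U i), (\bigcap_(i in `I_n) V i); split.
- exact: bigcup_open.
- rewrite bigcap_mkord; elim/big_ind : _ => //; first exact: openT.
  by move=> *; exact: openI.
- by apply: subset_bigcup => i _; exact: BU.
- rewrite setC_bigcap => x [i _ Vx]; exists i => //; exact: VB.
have sub : \bigcup_i U i `&` \bigcap_(i in `I_n) V i `<=`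
    W n `|` \bigcup_i (U i `&` V i).
  move=> x [[i _ Uix] Vx].
  have [Un|Un] := pselect ((\big[setU/set0]_(i < n) U i) x); last by left; split=> //; exists i.
  right; move: Un; rewrite -bigcup_mkord => -[j jn Ujx]; exists j => //; split => //.
  exact: Vx.
have mUV : measurable (\bigcup_i (U i `&` V i)).
  by apply: bigcup_measurable => i _; exact: measurableI.
apply: (@le_lt_trans _ _ (beta (W n) + beta (\bigcup_i (U i `&` V i)))%E).
  apply: le_trans (measureU2 _ _ _) => //.
  apply: le_measure => //; rewrite inE; last exact: measurableU.
  apply: measurableI; first exact: bigcup_measurable.
  by apply: bigcap_measurableType => i _; exact: mV.
rewrite (splitr e) EFinD; apply: lte_leD => //.
  by rewrite fin_num_measure.
apply: le_trans (epsilon_trick0 xpredT (ltW e4)).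
apply: (@le_trans _ _ (\sum_(0 <= i <oo) beta (U i `&` V i))%E).
  apply: measure_sigma_subadditive => // i; exact: measurableI.
by apply: lee_nneseries => // i _; exact: ltW (UV i).
Qed.

End regularity.

Section derivative_of_measures.
Variable R : realType.
Implicit Types (beta : {finite_measure set (circle R) -> \bar R}).
Local Notation m := (@arc_measure R).

Definition arcs (s : seq (circle R * R)) : set (circle R) :=
  \big[setU/set0]_(a <- s) arc a.1 a.2.

Lemma arcsP s xi : arcs s xi <-> exists2 a, a \in s & arc a.1 a.2 xi.
Proof.
rewrite /arcs -bigcup_seq; split => [[a /= As axi]|[a As axi]]; by exists a.
Qed.

Lemma measurable_arcs s : measurable (arcs s).
Proof. by apply: bigsetU_measurable => a _; exact: measurable_arc. Qed.

Lemma largest_arc (s : seq (circle R * R)) : s != [::] ->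
  exists2 b, b \in s & forall a, a \in s -> a.2 <= b.2.
Proof.
elim: s => // a [|a' s] IH _.
  by exists a; rewrite ?mem_head// => b; rewrite inE => /eqP ->.
have [//|b bs bmax] := IH; have [ab|ba] := leP a.2 b.2.
  exists b; first by rewrite inE bs orbT.
  by move=> c; rewrite inE => /predU1P[->//|]; exact: bmax.
exists a; first exact: mem_head.
move=> c; rewrite inE => /predU1P[->//|/bmax/le_trans]; apply; exact: ltW.
Qed.

(* Vitali's covering argument: the largest arc, tripled, swallows all the arcs that it meets. *)
Lemma arc_measure_arcs beta (c : R) (s : seq (circle R * R)) : 0 < c ->
  (forall a, a \in s -> 0 < a.2 /\ ((c * a.2)%:E <= beta (arc a.1 a.2))%E) ->
  (m (arcs s) <= (36 / c)%:E * beta (arcs s))%E.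
Proof.
move=> c0; have [k] := ubnP (size s); elim: k s => // k IH s; rewrite ltnS => sk Hs.
have [->|sn0] := eqVneq s [::].
  by rewrite /arcs big_nil !measure0 mule0.
have [b bs bmax] := largest_arc sn0; have [b0 cb] := Hs _ bs.
pose s' := [seq a <- s | `[< arc a.1 a.2 `&` arc b.1 b.2 = set0 >]].
have s's : {subset s' <= s} by move=> a; rewrite mem_filter => /andP[].
have sk' : (size s' < k)%N.
  apply: leq_trans sk; rewrite size_filter ltn_neqAle count_size andbT -all_count.
  apply/negP => /allP /(_ _ bs) /asboolP; rewrite setIid => b00.
  by have := arc_center b.1 b0; rewrite b00.
have {IH} IH := IH s' sk' (fun a as' => Hs _ (s's _ as')).
have sub : arcs s `<=` arc b.1 (3 * b.2) `|` arcs s'.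
  move=> xi /arcsP[a As axi].
  have [ab0|/eqP/set0P[x [ax bx]]] := pselect (arc a.1 a.2 `&` arc b.1 b.2 = set0).
    by right; apply/arcsP; exists a => //; rewrite mem_filter As andbT; apply/asboolP.
  left; rewrite /arc/= in ax bx axi *; have ab := bmax _ As.
  have h1 := normc_triangle (circle_val a.1) (circle_val xi) (circle_val b.1).
  have h2 := normc_triangle (circle_val x) (circle_val a.1) (circle_val b.1).
  by rewrite (normcBC (circle_val a.1) (circle_val x)) in h2; lra.
have disj : arc b.1 b.2 `&` arcs s' = set0.
  apply/seteqP; split => // x [bx /arcsP[a]]; rewrite mem_filter => /andP[/asboolP + _] ax.
  by move=> ab0; have : (arc a.1 a.2 `&` arc b.1 b.2) x by []; rewrite ab0.
apply: (@le_trans _ _ (m (arc b.1 (3 * b.2)) + m (arcs s'))%E).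
  apply: le_trans (measureU2 _ _ _) => //; [|exact: measurable_arc|exact: measurable_arcs].
  apply: le_measure => //; rewrite inE; first exact: measurable_arcs.
  by apply: measurableU; [exact: measurable_arc|exact: measurable_arcs].
apply: (@le_trans _ _ ((36 / c)%:E * (beta (arc b.1 b.2) + beta (arcs s')))%E).
  rewrite ge0_muleDr//; apply: leeD; last exact: IH.
  apply: le_trans (arc_measure_arc _ _) _; first by rewrite mulr_ge0// ltW.
  (* 36 is the constant 12 of [arc_measure_arc] at the tripled radius. *)
  rewrite (_ : 12 * _ = 36 / c * (c * b.2)); last by field; rewrite gt_eqF.
  by rewrite EFinM lee_pmul2l ?lte_fin ?divr_gt0.
rewrite lee_pmul2l ?lte_fin ?divr_gt0// -measureU//; last 2 first.
  - exact: measurable_arc.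
  - exact: measurable_arcs.
apply: le_measure; rewrite ?inE; [|exact: measurable_arcs|].
  by apply: measurableU; [exact: measurable_arc|exact: measurable_arcs].
move=> x [bx|/arcsP[a /s's As ax]]; apply/arcsP; first by exists b.
by exists a.
Qed.

(** A superlevel set of the uncentred maximal function of [beta], with the radius of an arc in place
    of its length. *)
Definition heavy_arcs beta (c : R) : set (circle R) :=
  \bigcup_(a in [set a : circle R * R | 0 < a.2 /\ ((c * a.2)%:E < beta (arc a.1 a.2))%E])
    arc a.1 a.2.

Lemma open_heavy_arcs beta c : open (heavy_arcs beta c).
Proof. by apply: bigcup_open => a _; exact: open_arc. Qed.

(** The weak-type inequality for the maximal function. Regularity of [m] replaces the open set by a
    compact subset, and a finite subcover is within reach of [arc_measure_arcs]. *)
Lemma arc_measure_heavy_arcs beta (c : R) : 0 < c ->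
  (m (heavy_arcs beta c) <= (36 / c)%:E * beta setT)%E.
Proof.
move=> c0; have mO := open_circle_measurable (open_heavy_arcs beta c).
apply/lee_addgt0Pr => e e0.
have [U [V [oU oV OU VO UV]]] := measurable_circle_regular m mO e0.
have cV : compact (~` V).
  apply: (subclosed_compact _ (@circle_compact R)) => //.
  by rewrite -[closed _]/(closed _); apply: open_closedC.
rewrite compact_cover in cV.
have [|D' D'D VD'] := cV _ _ _ _ VO; first by move=> a _; exact: open_arc.
pose s := [seq x | x <- finmap.enum_fset D'].
have VS : ~` V `<=` arcs s.
  by move=> x /VD' [a aD ax]; apply/arcsP; exists a => //; rewrite /s map_id.
have Hs : forall a, a \in s -> 0 < a.2 /\ ((c * a.2)%:E <= beta (arc a.1 a.2))%E.
  move=> a; rewrite /s map_id => /D'D; rewrite inE => -[a0 /ltW]; by split.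
have H1 := arc_measure_arcs c0 Hs.
have mU := open_circle_measurable oU; have mV := open_circle_measurable oV.
apply: (@le_trans _ _ (m (arcs s) + m (U `&` V))%E).
  apply: le_trans (measureU2 _ _ _) => //; last 2 first.
  - exact: measurable_arcs.
  - exact: measurableI.
  apply: le_measure; rewrite ?inE//.
    by apply: measurableU; [exact: measurable_arcs|exact: measurableI].
  move=> x Ox; have [Vx|Vx] := pselect (V x); last by left; exact: VS.
  by right; split => //; exact: OU.
apply: leeD; last exact: ltW.
apply: (le_trans H1); rewrite lee_pmul2l ?lte_fin ?divr_gt0//.
by apply: le_measure; rewrite ?inE//; exact: measurable_arcs.
Qed.

Lemma small_cover_negligible (S : set (circle R)) :
  (forall e : R, 0 < e -> exists O, [/\ measurable O, S `<=` O & (m O <= e%:E)%E]) ->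
  m.-negligible S.
Proof.
move=> H.
have {}H i : {O | [/\ measurable O, S `<=` O & (m O <= (i.+1%:R^-1)%:E)%E]}.
  by apply: cid; apply: H; rewrite invr_gt0.
pose O i := sval (H i).
have mO i : measurable (O i) by rewrite /O; case: (H i) => ? [].
have SO i : S `<=` O i by rewrite /O; case: (H i) => ? [].
have Oi i : (m (O i) <= (i.+1%:R^-1)%:E)%E by rewrite /O; case: (H i) => ? [].
have mcap : measurable (\bigcap_i O i) by exact: bigcapT_measurable.
exists (\bigcap_i O i); split => //; last by move=> x Sx i _; exact: SO.
apply/eqP; rewrite eq_le measure_ge0 andbT; apply/lee_addgt0Pr => e e0; rewrite add0e.
have [i ie] : exists i : nat, i.+1%:R^-1 < e.
  exists (Num.truncn e^-1); rewrite invf_plt ?posrE//.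
  by have /andP[] := truncn_itv (ltW (eqbRL (invr_gt0 e) e0)).
apply: (@le_trans _ _ (m (O i))); last by apply: (le_trans (Oi i)); rewrite lee_fin ltW.
by apply: le_measure; rewrite ?inE// => x; exact.
Qed.

(** An arbitrary set function is allowed because at a Lebesgue point the density [|g - g z|] itself
    depends on the centre. *)
Definition vanishing_density (phi : set (circle R) -> \bar R) (z : circle R) :=
  forall eta : R, 0 < eta -> exists2 h0 : R, 0 < h0 &
    forall h, 0 < h <= h0 -> (phi (arc z h) <= (eta * h)%:E)%E.

(** Regularity encloses [G] in an open [V] of small [beta]-measure. Short arcs around a point of [G]
    lie in [V], so the points of [G] whose upper density exceeds a threshold are covered by heavy
    arcs of [beta] restricted to [V], and the weak-type inequality makes these small. *)
Lemma measure0_vanishing_density beta (G : set (circle R)) : measurable G ->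
  beta G = 0%E -> m.-negligible (G `&` ~` [set z | vanishing_density beta z]).
Proof.
move=> mG G0.
pose S (k : nat) := G `&` [set z | forall h0 : R, 0 < h0 ->
  exists2 h, 0 < h <= h0 & ((k.+1%:R^-1 * h)%:E < beta (arc z h))%E].
have Sneg k : m.-negligible (S k).
  apply: small_cover_negligible => e e0.
  have k0 : 0 < k.+1%:R^-1 :> R by rewrite invr_gt0.
  (* With this value the weak-type bound for the threshold [1/(k+1)] is exactly [e]. *)
  have e' : 0 < e / (36 / k.+1%:R^-1) by rewrite !divr_gt0.
  have [U [V [oU oV CU VC UV]]] := measurable_circle_regular beta (measurableC mG) e'.
  have mU := open_circle_measurable oU; have mV := open_circle_measurable oV.
  pose b : {finite_measure set (circle R) -> \bar R} := mrestr beta mV.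
  exists (heavy_arcs b k.+1%:R^-1); split.
  - exact: open_circle_measurable (open_heavy_arcs _ _).
  - move=> z [Gz Hz].
    have Vz : V z by apply: contrapT => /VC; exact.
    have [h0 h00 h0V] := open_arc_sub oV Vz.
    have [h /andP[hp hh0] hb] := Hz _ h00.
    exists (z, h) => /=; last exact: arc_center.
    split => //; rewrite /b/= /mrestr setIidl//.
    by apply: subset_trans h0V; exact: arc_sub.
  - apply: (le_trans (arc_measure_heavy_arcs _ k0)).
    rewrite /b/= /mrestr setTI.
    have : (beta V <= (e / (36 / k.+1%:R^-1))%:E)%E.
      apply: le_trans (ltW UV); rewrite -[leRHS]adde0 -G0.
      apply: le_trans (measureU2 _ _ _) => //; last exact: measurableI.
      apply: le_measure; rewrite ?inE//; first by apply: measurableU => //; exact: measurableI.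
      move=> x Vx; have [Gx|Gx] := pselect (G x); [by right|left; split => //].
      exact: CU.
    move=> H; apply: (@le_trans _ _
        ((36 / k.+1%:R^-1)%:E * (e / (36 / k.+1%:R^-1))%:E)%E).
      by rewrite lee_pmul2l ?lte_fin ?divr_gt0.
    by rewrite -EFinM lee_fin mulrC divfK// gt_eqF// divr_gt0.
apply: (@negligibleS _ _ _ _ (\bigcup_k S k)); last exact: negligible_bigcup.
move=> z [Gz] /=; apply: contra_notP => HS eta eta0.
apply: contrapT => Hh; apply: HS.
have [i ie] : exists i : nat, i.+1%:R^-1 < eta.
  exists (Num.truncn eta^-1); rewrite invf_plt ?posrE//.
  by have /andP[] := truncn_itv (ltW (eqbRL (invr_gt0 eta) eta0)).
exists i => //; split => // h0 h00; apply: contrapT => Hi; apply: Hh.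
exists h0 => // h hh0; rewrite leNgt; apply/negP => hb; apply: Hi; exists h => //.
apply: le_lt_trans hb; rewrite lee_fin ler_wpM2r ?(ltW ie)//.
by case/andP: hh0 => /ltW.
Qed.

End derivative_of_measures.

Section density_measure.
Context d (T : measurableType d) (R : realType).
Variables (mu : {measure set T -> \bar R}) (f : T -> \bar R).
Hypotheses (f0 : forall x, (0 <= f x)%E) (intf : mu.-integrable setT f).

(** The two proofs are arguments so that the measure structure can be inferred from the term
    alone. *)
Definition density_measure of (forall x, (0 <= f x)%E) & mu.-integrable setT f :
    set T -> \bar R :=
  fun A => (\int[mu]_(x in A) f x)%E.

Local Notation fmu := (density_measure f0 intf).

Let fmu0 : fmu set0 = 0%E. Proof. exact: integral_set0. Qed.

Let fmu_ge0 A : (0 <= fmu A)%E. Proof. exact: integral_ge0. Qed.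

Let fmu_sigma_additive : semi_sigma_additive fmu.
Proof. by apply: semi_sigma_additive_nng_induced => //; exact: measurable_int intf. Qed.

HB.instance Definition _ := isMeasure.Build _ _ _ fmu fmu0 fmu_ge0 fmu_sigma_additive.

Let fmu_fin : fin_num_fun fmu.
Proof. by move=> A mA; apply: integrable_fin_num => //; exact: integrableS intf. Qed.

HB.instance Definition _ := @Measure_isFinite.Build _ _ _ fmu fmu_fin.

End density_measure.

(** * Lebesgue points of a density and density of a singular measure *)

Section lebesgue_points.
Variable R : realType.
Local Notation m := (@arc_measure R).

Lemma invr_natS_lt (e : R) : 0 < e -> exists i : nat, i.+1%:R^-1 < e.
Proof.
move=> e0; exists (Num.truncn e^-1); rewrite invf_plt ?posrE//.
by have /andP[] := truncn_itv (ltW (eqbRL (invr_gt0 e) e0)).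
Qed.

(** For rational [q] and [a = 1/(k+1)], the measure of density [max (|g - q| - a, 0)] vanishes on
    [|g - q| <= a], so it has density zero at almost every point of this set. Outside a countable
    union of null sets, choosing [q] within [a] of [g z] gives
    [|g - g z| <= max (|g - q| - a, 0) + 2 a]. *)
Lemma ae_lebesgue_point (g : circle R -> R) : m.-integrable setT (EFin \o g) ->
  {ae m, forall z, vanishing_density
    (fun A => \int[m]_(x in A) `|g x - g z|%:E)%E z}.
Proof.
move=> ig; have mg : measurable_fun setT g by apply/measurable_EFinP; exact: measurable_int ig.
pose f (q a : R) x := Num.max (`|g x - q| - a) 0.
have f0 q a x : (0 <= (f q a x)%:E)%E by rewrite lee_fin le_max lexx orbT.
have mgq q : measurable_fun setT (fun x => `|g x - q|).
  by apply: measurableT_comp => //; apply: measurable_funB.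
have igq q : m.-integrable setT (fun x => `|g x - q|%:E).
  have := integrableB measurableT ig (finite_measure_integrable_cst m q measurableT).
  by move=> /integrable_abse.
have mf q a : measurable_fun setT (f q a).
  by apply: measurable_maxr => //; exact: measurable_funB.
have intf q a : 0 < a -> m.-integrable setT (EFin \o f q a).
  move=> a0; apply: le_integrable (igq q) => //.
    exact/measurable_EFinP.
  move=> x _ /=; rewrite lee_fin normr_id ger0_norm ?le_max ?lexx ?orbT//.
  by rewrite ge_max normr_ge0 gerBl ltW.
have a0 (k : nat) : 0 < k.+1%:R^-1 :> R by rewrite invr_gt0.
pose q (i : nat) : R := ratr (odflt 0 (unpickle i)).
pose beta k i : {finite_measure set (circle R) -> \bar R} :=
  density_measure (f0 (q i) k.+1%:R^-1) (intf (q i) _ (a0 k)).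
pose G k i := [set x | `|g x - q i| <= k.+1%:R^-1].
have mG k i : measurable (G k i).
  rewrite -[X in measurable X]setTI.
  have -> : G k i = (fun x => `|g x - q i|) @^-1` `]-oo, k.+1%:R^-1].
    by apply/seteqP; split => x; rewrite /G /= in_itv.
  exact: mgq.
have bG k i : beta k i (G k i) = 0%E.
  rewrite /beta/= /density_measure; apply: integral0_eq => x.
  by rewrite /G/= /f => gx; congr EFin; apply/max_idPr; rewrite subr_le0.
pose N := \bigcup_k \bigcup_i (G k i `&` ~` [set z | vanishing_density (beta k i) z]).
have Nneg : m.-negligible N.
  by do 2 apply: negligible_bigcup => ?; exact: measure0_vanishing_density.
apply: negligibleS Nneg => z /=; apply: contra_notP => Nz eta eta0.
(* The constant [2 a] integrates to at most [2 a * 12 h] over an arc, which must not exceed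
   [eta / 2 * h]. *)
have [k keta] := invr_natS_lt (divr_gt0 eta0 (ltr0n R 48)).
have [r] : exists r : rat, ratr r \in `](g z - k.+1%:R^-1), (g z + k.+1%:R^-1)[.
  by apply: rat_in_itvoo; rewrite ltrBlDr -addrA ltrDl addr_gt0.
rewrite in_itv/= => /andP[r1 r2].
have [i qi] : exists i, q i = ratr r by exists (pickle r); rewrite /q pickleK.
have Gz : G k i z.
  by rewrite /G/= qi ler_norml; move: r1 r2; move: (k.+1%:R^-1) => a; lra.
have vz : vanishing_density (beta k i) z.
  by apply: contrapT => nv; apply: Nz; exists k => //; exists i.
have [h0 h00 Hh] := vz (eta / 2) (divr_gt0 eta0 (ltr0n R 2)).
exists h0 => // h hh; have h_ge0 : 0 <= h by case/andP: hh => /ltW.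
have mA := measurable_arc z h.
have e1 : (\int[m]_(x in arc z h) `|g x - g z|%:E <=
    \int[m]_(x in arc z h) ((f (q i) k.+1%:R^-1 x)%:E + (2 * k.+1%:R^-1)%:E))%E.
  apply: ge0_le_integral => //.
  - by apply/measurable_EFinP; exact: measurable_funTS.
  - apply: emeasurable_funD => //.
    by apply/measurable_EFinP; apply: measurable_funTS; exact: mf.
  - move=> x _; rewrite -EFinD lee_fin /f.
    have : `|g x - g z| <= `|g x - q i| + `|g z - q i|.
      by rewrite (distrC (g z)) (le_trans _ (ler_normD _ _))// subrKA.
    move: Gz; rewrite /G/= => Gz.
    have : `|g x - q i| - k.+1%:R^-1 <= Num.max (`|g x - q i| - k.+1%:R^-1) 0.
      by rewrite le_max lexx.
    by move: Gz; move: (k.+1%:R^-1) => a; lra.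
apply: (le_trans e1); rewrite ge0_integralD//; last first.
  by apply/measurable_EFinP; apply: measurable_funTS; exact: mf.
rewrite integral_cst// (_ : eta * h = eta / 2 * h + eta / 2 * h); last by field.
rewrite EFinD; apply: leeD; first exact: Hh.
apply: (@le_trans _ _ ((2 * k.+1%:R^-1)%:E * (12 * h)%:E)%E).
  by rewrite lee_pmul2l ?lte_fin ?mulr_gt0//; exact: arc_measure_arc.
rewrite -EFinM lee_fin [leLHS](_ : _ = (24 * k.+1%:R^-1) * h); last by ring.
by rewrite ler_wpM2r//; move: keta; move: (k.+1%:R^-1) => a; lra.
Qed.

(** The restricted measure has no mass on the complement of [N], where the previous criterion
    applies, and [N] itself is negligible. *)
Lemma ae_singular_vanishing (mu : {finite_measure set (circle R) -> \bar R})
    (N : set (circle R)) (mN : measurable N) : m N = 0%E ->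
  {ae m, forall z, vanishing_density (mrestr mu mN) z}.
Proof.
move=> N0; have H : m.-negligible (~` N `&` ~` [set z | vanishing_density (mrestr mu mN) z]).
  apply: measure0_vanishing_density; first exact: measurableC.
  by rewrite /= /mrestr setICl measure0.
have NN : m.-negligible N by exists N; split.
apply: negligibleS (negligibleU NN H) => z /= nz.
by have [Nz|Nz] := pselect (N z); [left|right].
Qed.

End lebesgue_points.

(** * A nonvanishing oscillatory integral *)

Section real_integrals.
Variable R : realType.
Local Notation mu := (@lebesgue_measure R).
Implicit Types (f G : R -> R).

Lemma continuous_integrable_itv f (a b : R) : continuous f ->
  mu.-integrable `[a, b] (EFin \o f).
Proof.
move=> cf; apply: continuous_compact_integrable; first exact: segment_compact.
exact: continuous_subspaceT.
Qed.

Lemma Rintegral_affine G (k c a b : R) : 0 < k -> a <= b -> continuous G ->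
  \int[mu]_(x in `[k * a + c, k * b + c]) G x =
  k * \int[mu]_(x in `[a, b]) G (k * x + c).
Proof.
move=> k0 ab cG; pose F (x : R) := k * x + c.
have dF (x : R) : is_derive x 1 F k.
  by rewrite /F; apply: is_derive_eq; rewrite /GRing.scale/=; ring.
have F'E : derive1 F = cst k by apply/funext => x; rewrite derive1E derive_val.
have cF : continuous F.
  by move=> x; apply: differentiable_continuous; apply/derivable1_diffP; have [] := dF x.
have cGF : continuous (fun x => G (k * x + c)).
  by move=> x; apply: (continuous_comp (cF x)); exact: cG.
rewrite -RintegralZl//; last exact: continuous_integrable_itv.
rewrite /Rintegral (@integration_by_substitution_increasing _ F G a b)//.
- by congr fine; apply: eq_integral => x _; rewrite F'E /F/= fctE mulrC.
- by move=> x y _ _ xy; rewrite /F ltrD2r ltr_pM2l.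
- by rewrite F'E => ? _; exact: cvg_cst.
- by rewrite F'E; exact: is_cvg_cst.
- by rewrite F'E; exact: is_cvg_cst.
- split.
  + by move=> x _; have [] := dF x.
  + by apply: cvg_at_right_filter; exact: cF.
  + by apply: cvg_at_left_filter; exact: cF.
- exact: continuous_subspaceT.
Qed.

Lemma Rintegral_itv_split f (a b c : R) : continuous f -> a <= b <= c ->
  \int[mu]_(x in `[a, c]) f x = \int[mu]_(x in `[a, b]) f x + \int[mu]_(x in `[b, c]) f x.
Proof.
move=> cf /andP[ab bc]; apply/eqP; rewrite addrC -subr_eq; apply/eqP.
rewrite Rintegral_itvB ?bnd_simp//; last exact: continuous_integrable_itv.
rewrite Rintegral_itv_obnd_cbnd//; apply: integrableS (continuous_integrable_itv b c cf) => //.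
by apply: subset_itvr; rewrite bnd_simp.
Qed.

Lemma Rintegral_shift f (c a b : R) : a <= b -> continuous f ->
  \int[mu]_(x in `[a + c, b + c]) f x = \int[mu]_(x in `[a, b]) f (x + c).
Proof.
move=> ab cf; have := Rintegral_affine c (@ltr01 R) ab cf; rewrite !mul1r => ->.
by apply: eq_Rintegral => x _; rewrite mul1r.
Qed.

(** Rotation and reflection reduce integrals over the circle to angles in [[0, pi]], the range in
    which [1 - cos] is comparable to a square. *)
Lemma Rintegral_even_periodic f (s : R) : continuous f ->
  (forall x, f (- x) = f x) -> (forall x, f (x + pi *+ 2) = f x) ->
  0 <= s <= pi *+ 2 ->
  \int[mu]_(x in `[0, pi *+ 2]) f (x - s) = 2 * \int[mu]_(x in `[0, pi]) f x.
Proof.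
rewrite mulr2n => cf ev per /andP[s0 s2]; have pi0 := pi_gt0 R.
have c1 : - s <= 0 <= pi + pi - s by rewrite oppr_le0 s0 subr_ge0 s2.
have c2 : 0 <= pi + pi - s <= pi + pi by rewrite subr_ge0 s2 gerBl s0.
have c3 : 0 <= @pi R <= @pi R + @pi R by rewrite (ltW pi0) lerDl (ltW pi0).
have e1 : \int[mu]_(x in `[0, pi + pi]) f (x - s) =
    \int[mu]_(x in `[- s, pi + pi - s]) f x.
  by have := @Rintegral_shift f (- s) 0 (pi + pi); rewrite add0r => ->//; lra.
have e2 : \int[mu]_(x in `[- s, 0]) f x = \int[mu]_(x in `[pi + pi - s, pi + pi]) f x.
  have := @Rintegral_shift f (pi + pi) (- s) 0; rewrite add0r (addrC (- s)) => ->//; last lra.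
  by apply: eq_Rintegral => x _.
have e3 : \int[mu]_(x in `[- pi, 0]) f x = \int[mu]_(x in `[pi, pi + pi]) f x.
  have := @Rintegral_shift f (pi + pi) (- pi) 0; rewrite add0r addKr => ->//; last lra.
  by apply: eq_Rintegral => x _.
have e4 : \int[mu]_(x in `[- pi, 0]) f x = \int[mu]_(x in `[0, pi]) f x.
  rewrite /Rintegral -[in LHS]oppr0 integration_by_substitution_oppr ?(ltW pi0)//; last first.
    exact: continuous_subspaceT.
  by congr fine; apply: eq_integral => x _ /=; rewrite ev.
rewrite e1 (@Rintegral_itv_split f (- s) 0)//.
rewrite e2 addrC -Rintegral_itv_split//.
rewrite (@Rintegral_itv_split f 0 pi)//.
by rewrite -e3 e4; ring.
Qed.

End real_integrals.

Section circle_integral.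
Variable R : realType.
Local Notation mu := (@lebesgue_measure R).
Local Notation m := (@arc_measure R).

Lemma circle_Rintegral (f : circle R -> R) : continuous f ->
  \int[m]_xi f xi = (2 * pi)^-1 * \int[mu]_(t in `[0, pi *+ 2]) f (cis t).
Proof.
move=> cf; have mf := continuous_circle_measurable cf.
have cfc : continuous (f \o @cis R).
  move=> t; apply: (@continuous_comp _ _ _ (@cis R) f); first exact: cis_continuous.
  exact: cf.
have icf : mu.-integrable `[0, pi *+ 2] (EFin \o (f \o @cis R)).
  exact: continuous_integrable_itv.
have pos (g : circle R -> \bar R) : measurable_fun setT g -> (forall x, 0 <= g x)%E ->
   (\int[m]_xi g xi = ((2 * pi)^-1)%:E * \int[mu]_(t in `[0%R, (pi *+ 2)%R]) g (cis t))%E.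
  move=> mg g0; rewrite /arc_measure ge0_integral_pushforward//=; last first.
    exact: measurable_cis.
  rewrite preimage_setT integral_uniform ?subr0 ?mulr_natl//.
  by apply: measurableT_comp => //; exact: measurable_cis.
have mI : measurable (`[0, pi *+ 2] : set (measurableTypeR R)) by [].
have iA := integrable_fin_num mI (integrable_funepos mI icf).
have iB := integrable_fin_num mI (integrable_funeneg mI icf).
transitivity (fine (((2 * pi)^-1)%:E *
    (\int[mu]_(t in `[0%R, (pi *+ 2)%R]) (EFin \o (f \o @cis R))^\+ t -
     \int[mu]_(t in `[0%R, (pi *+ 2)%R]) (EFin \o (f \o @cis R))^\- t))%E); last first.
  by rewrite -integralE fineM// integralE fin_numB iA iB.
congr fine; rewrite muleBr//; last by rewrite fin_num_adde_defr.
rewrite integralE !pos//; last 2 first.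
- by apply: measurable_funeneg; exact/measurable_EFinP.
- by apply: measurable_funepos; exact/measurable_EFinP.
by congr (_ * _ - _ * _)%E; apply: eq_integral => t _; rewrite ?funeposE ?funenegE.
Qed.

End circle_integral.

Section sine_integral.
Variable R : realType.
Local Notation mu := (@lebesgue_measure R).

Lemma MVT_gt0 (f df : R -> R) (a b : R) :
  (forall x : R, 0 < x -> is_derive x 1 f (df x)) -> 0 < a -> a <= b ->
  exists2 c, a <= c <= b & f b - f a = df c * (b - a).
Proof.
move=> fdf a0 ab.
have [c cab fE] : exists2 c, c \in `[a, b] & f b - f a = df c * (b - a).
  apply: MVT_segment => //.
    by move=> x; rewrite in_itv/= => /andP[ax _]; apply: fdf; exact: lt_trans ax.
  apply: continuous_in_subspaceT => x; rewrite inE/= in_itv/= => /andP[ax _].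
  apply: differentiable_continuous; apply/derivable1_diffP.
  by have [] := fdf x (lt_le_trans a0 ax).
by exists c => //; move: cab; rewrite in_itv.
Qed.

Lemma is_derive_primitive (f : R -> R) (x : R) : continuous f -> 0 < x ->
  is_derive x 1 (fun y => \int[mu]_(t in `[0, y]) f t) (f x).
Proof.
move=> cf x0.
have [d1 d2] := @continuous_FTC1_closed R f 0 x (x + 1) (ltr_pwDr ltr01 (lexx x))
  (continuous_integrable_itv 0 (x + 1) cf) x0 (cf x).
by apply: DeriveDef => //; rewrite -derive1E.
Qed.

Lemma normr_sin_le (y : R) : `|sin y| <= `|y|.
Proof.
have [c _ sE] : exists2 c, c \in `[0, `|y|] & sin `|y| - sin 0 = cos c * (`|y| - 0).
  apply: MVT_segment => //.
  by apply: continuous_subspaceT => x; exact: continuous_sin.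
rewrite sin0 !subr0 in sE.
have -> : `|sin y| = `|sin `|y| |.
  by have [y0|y0] := ler0P y; rewrite // sinN normrN.
by rewrite sE normrM normr_id -[leRHS]mul1r ler_wpM2r// cos_max.
Qed.

Lemma oneBcos_half (y : R) : 1 - cos y = 2 * sin (y / 2) ^+ 2.
Proof.
have {1}-> : y = (y / 2) *+ 2 by rewrite mulr2n; field.
by rewrite cos_mulr2n cos2sin2 mulr2n; ring.
Qed.

Lemma oneBcos_ge0 (y : R) : 0 <= 1 - cos y.
Proof. by rewrite subr_ge0 cos_le1. Qed.

Lemma oneBcos_le (y : R) : 1 - cos y <= y ^+ 2 / 2.
Proof.
rewrite oneBcos_half.
have : sin (y / 2) ^+ 2 <= (y / 2) ^+ 2.
  rewrite -[leLHS]real_normK ?num_real// -[leRHS]real_normK ?num_real//.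
  by rewrite lerXn2r ?nnegrE// normr_sin_le.
by rewrite expr_div_n; lra.
Qed.

(** As [d] tends to 0, [ln (scaled_poisson d u)] tends to [ln 2 - lnsq u]. *)
Definition lnsq (u : R) : R := ln (1 + u ^+ 2).

Lemma sq1_gt0 (u : R) : 0 < 1 + u ^+ 2.
Proof. by rewrite ltr_pwDl// sqr_ge0. Qed.

Lemma lnsq_ge0 u : 0 <= lnsq u.
Proof. by rewrite ln_ge0// lerDl sqr_ge0. Qed.

Lemma lnsq_le u : lnsq u <= u ^+ 2.
Proof. by apply: le_ln1Dx; rewrite (lt_le_trans _ (sqr_ge0 u)). Qed.

Lemma is_derive_lnsq (u : R) : is_derive u 1 lnsq (2 * u / (1 + u ^+ 2)).
Proof.
have h1 : is_derive u 1 (fun u : R => 1 + u ^+ 2) (2 * u).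
  by apply: is_derive_eq; rewrite /GRing.scale/=; ring.
have h2 := is_derive1_ln (sq1_gt0 u).
have := @is_derive1_comp _ (@ln R) (fun u : R => 1 + u ^+ 2) u _ _ h2 h1.
by move=> h; apply: is_derive_eq; rewrite mulrC.
Qed.

Lemma continuous_lnsq : continuous lnsq.
Proof.
move=> u; apply: differentiable_continuous; apply/derivable1_diffP.
by have [] := is_derive_lnsq u.
Qed.

Variables (sigma tau : R).
Hypothesis sigma0 : 0 <= sigma.

(** This is [(1 + u^2)^-(sigma + 1/2)], the rescaled profile of the kernel's modulus. *)
Definition weight (u : R) : R := expR (- (sigma + 2^-1) * lnsq u).

Lemma continuous_weight : continuous weight.
Proof.
move=> u; apply: continuous_comp; last exact: continuous_expR.
by apply: cvgM; [exact: cvg_cst|exact: continuous_lnsq].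
Qed.

Lemma weight_le1 u : weight u <= 1.
Proof.
rewrite /weight -expR0 ler_expR mulNr oppr_le0 mulr_ge0 ?lnsq_ge0//.
by rewrite addr_ge0.
Qed.

(* Since [weight u = E u / (1 + u^2)], integrating [weight * sin (tau lnsq)] by parts leaves
   the integral of the nonnegative function [deriv_gap]. *)
Let E (u : R) : R := expR ((2^-1 - sigma) * lnsq u).
Let phi (u : R) : R := 1 - cos (tau * lnsq u).
Let gap (u : R) : R :=
  tau * (\int[mu]_(t in `[0, u]) (weight t * sin (tau * lnsq t))) - E u * phi u / (2 * u).
Let deriv_gap (u : R) : R :=
  E u * phi u * (1 + 2 * sigma * u ^+ 2) / (2 * u ^+ 2 * (1 + u ^+ 2)).

Let continuous_weight_sin : continuous (fun t => weight t * sin (tau * lnsq t)).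
Proof.
move=> u; apply: cvgM; first exact: continuous_weight.
apply: continuous_comp; last exact: continuous_sin.
by apply: cvgM; [exact: cvg_cst|exact: continuous_lnsq].
Qed.

(** The term [E * phi' / (2 u)] is exactly [tau * weight * sin (tau * lnsq)] and cancels the
    integrand. The derivatives of [E] and of [1 / (2 u)] leave [E * phi] times a factor that is
    positive because [sigma >= 0]. *)
Let is_derive_gap (u : R) : 0 < u -> is_derive u 1 gap (deriv_gap u).
Proof.
move=> u0; have dl := is_derive_lnsq u.
have dI := is_derive_primitive continuous_weight_sin u0.
pose l (v : R) := lnsq v.
have dlin (c : R) : is_derive u 1 (fun v => c * lnsq v) (c * (2 * u / (1 + u ^+ 2))).
  by apply: is_derive_eq; rewrite /GRing.scale/=; ring.
have dE : is_derive u 1 E (E u * ((2^-1 - sigma) * (2 * u / (1 + u ^+ 2)))).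
  exact: (@is_derive1_comp _ expR (fun v => (2^-1 - sigma) * lnsq v) u _ _
    (is_derive_expR _) (dlin _)).
have dcos : is_derive u 1 (fun v => cos (tau * lnsq v))
    (- sin (tau * lnsq u) * (tau * (2 * u / (1 + u ^+ 2)))).
  exact: (@is_derive1_comp _ (@cos R) (fun v => tau * lnsq v) u _ _
    (is_derive_cos _) (dlin _)).
have dinv : is_derive u 1 (fun v : R => (2 * v)^-1) (- (2 * u) ^- 2 * 2).
  have u2 : 2 * u != 0 by rewrite mulf_neq0// gt_eqF.
  have h : is_derive u 1 (fun v : R => 2 * v) 2.
    by apply: is_derive_eq; rewrite /GRing.scale/=; ring.
  by have := @is_deriveV _ (fun v : R => 2 * v) u 2 1 u2 h; rewrite /GRing.scale/=.
have wE : weight u = E u / (1 + u ^+ 2).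
  rewrite /weight /E -[in X in _ / X](@lnK _ (1 + u ^+ 2)) ?posrE ?sq1_gt0//.
  by rewrite -expRN -expRD; congr expR; rewrite -/(lnsq u); field.
rewrite /gap /phi; apply: is_derive_eq; rewrite /GRing.scale/= wE /deriv_gap /phi.
by field; rewrite !gt_eqF ?sq1_gt0.
Qed.

Let E_gt0 u : 0 < E u. Proof. exact: expR_gt0. Qed.

Let deriv_gap_ge0 u : 0 <= deriv_gap u.
Proof.
apply: divr_ge0; apply: mulr_ge0.
- by apply: mulr_ge0; [exact: ltW|exact: oneBcos_ge0].
- by apply: addr_ge0 => //; apply: mulr_ge0; [exact: mulr_ge0|exact: sqr_ge0].
- by apply: mulr_ge0 => //; exact: sqr_ge0.
- exact/ltW/sq1_gt0.
Qed.

Let gap_le u v : 0 < u -> u <= v -> gap u <= gap v.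
Proof.
move=> u0 uv; have [c _ H] := MVT_gt0 is_derive_gap u0 uv.
by rewrite -subr_ge0 H mulr_ge0// subr_ge0.
Qed.

(** The boundary term divides by [u], so instead of a value at 0 there is a lower bound tending to 0
    with [u]; monotonicity then gives [gap >= 0]. *)
Let gap_ge u : 0 < u <= 1 -> - ((`|tau| + expR 1 * tau ^+ 2) * u) <= gap u.
Proof.
move=> /andP[u0 u1].
have h1 : `|tau * (\int[mu]_(t in `[0, u]) (weight t * sin (tau * lnsq t)))| <= `|tau| * u.
  rewrite normrM ler_wpM2l//.
  have ic : mu.-integrable `[0, u] (EFin \o (fun t => weight t * sin (tau * lnsq t))).
    exact: continuous_integrable_itv.
  apply: le_trans (le_normr_Rintegral _ ic) _ => //.
  rewrite [leRHS](_ : u = \int[mu]_(t in `[0, u]) (1 : R)); last first.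
    by rewrite Rintegral_cst//= mul1r lebesgue_measure_itv/= lte_fin u0 sube0.
  apply: le_Rintegral => //.
  - exact: integrable_norm ic.
  - by apply: continuous_integrable_itv => ?; exact: cvg_cst.
  - move=> t _; rewrite normrM -[leRHS]mulr1 ler_pM// ?sin_max//.
    by rewrite ger0_norm ?weight_le1// expR_ge0.
have lu := lnsq_le u; have l0 := lnsq_ge0 u.
have u21 : u ^+ 2 <= u by rewrite expr2 ler_piMr// ltW.
have h2 : E u <= expR 1.
  rewrite ler_expR mulrBl; apply: (@le_trans _ _ (2^-1 * lnsq u)).
    by rewrite gerBl mulr_ge0.
  by rewrite mulrC ler_pdivrMr// ; lra.
have h3 : phi u / (2 * u) <= tau ^+ 2 * u.
  rewrite ler_pdivrMr ?mulr_gt0//; apply: (le_trans (oneBcos_le _)).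
  rewrite exprMn; have : lnsq u ^+ 2 <= (u ^+ 2) ^+ 2 by rewrite lerXn2r ?nnegrE ?sqr_ge0.
  have : (u ^+ 2) ^+ 2 <= u ^+ 2 by rewrite expr2 ler_piMr ?sqr_ge0//; lra.
  move=> H1 H2; have H3 : tau ^+ 2 * lnsq u ^+ 2 <= tau ^+ 2 * u ^+ 2.
    by rewrite ler_wpM2l ?sqr_ge0//; apply: le_trans H1.
  have : 0 <= tau ^+ 2 * u ^+ 2 by rewrite mulr_ge0 ?sqr_ge0.
  rewrite (_ : tau ^+ 2 * u * (2 * u) = 2 * (tau ^+ 2 * u ^+ 2)); last by ring.
  by move: H3; lra.
have h4 : E u * phi u / (2 * u) <= expR 1 * tau ^+ 2 * u.
  rewrite -mulrA -[leRHS]mulrA; apply: ler_pM => //; first exact: ltW.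
  by apply: divr_ge0; [exact: oneBcos_ge0|rewrite mulr_ge0// ltW].
rewrite /gap; move: h1; rewrite ler_norml => /andP[h1 _].
by rewrite (mulrDl `|tau|) opprD lerD// lerN2.
Qed.

Let gap_ge0 u : 0 < u -> 0 <= gap u.
Proof.
move=> u0; set C := `|tau| + expR 1 * tau ^+ 2.
have C0 : 0 <= C by rewrite addr_ge0// mulr_ge0 ?expR_ge0 ?sqr_ge0.
rewrite leNgt; apply/negP => gu.
(* Then [- C e <= gap e <= gap u <= - (C + 1) e], which is absurd. *)
pose e := Num.min (Num.min u 1) (- gap u / (C + 1)).
have e0 : 0 < e by rewrite !lt_min u0 ltr01/= divr_gt0 ?oppr_gt0// ltr_wpDl.
have eu : e <= u by rewrite !ge_min lexx.
have e1 : e <= 1 by rewrite !ge_min lexx orbT.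
have eg : e * (C + 1) <= - gap u.
  by rewrite -ler_pdivlMr ?ltr_wpDl// !ge_min lexx !orbT.
have := gap_le e0 eu; have := @gap_ge e; rewrite e0 e1 => /(_ isT).
by rewrite -/C; move: eg; rewrite mulrDr mulr1 (mulrC e); lra.
Qed.

(** [gap] is nonnegative and nondecreasing, and it rises strictly before [u1]; the boundary term
    that it subtracts has the favourable sign. Uniformity in [M] lets the bound survive the passage
    to the half-line. *)
Lemma sine_integral_gt0 : tau != 0 -> exists c u1 : R, [/\ 0 < c, 0 < u1 &
  forall M, u1 <= M ->
    c <= tau * \int[mu]_(t in `[0, M]) (weight t * sin (tau * lnsq t))].
Proof.
(* For [0 < u <= u1] one has [0 < |tau| * lnsq u <= 1], so [phi u] cannot vanish. *)
move=> tau0; pose u1 : R := (1 + `|tau|)^-1; pose u0 := u1 / 2.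
have t1 : 0 < 1 + `|tau| by rewrite ltr_pwDl.
have u1_gt0 : 0 < u1 by rewrite invr_gt0.
have u0_gt0 : 0 < u0 by rewrite divr_gt0.
have u01 : u0 < u1 by rewrite /u0; lra.
have u11 : u1 <= 1 by rewrite invf_le1// lerDl.
exists (gap u1), u1; split => //; last first.
  move=> M u1M; apply: (le_trans (gap_le u1_gt0 u1M)).
  have M0 : 0 < M by exact: lt_le_trans u1M.
  rewrite /gap gerBl divr_ge0//.
    by rewrite mulr_ge0 ?oneBcos_ge0// ltW.
  by rewrite mulr_ge0// ltW.
have [c /andP[c0 c1] H] := MVT_gt0 is_derive_gap u0_gt0 (ltW u01).
suff : 0 < gap u1 - gap u0.
  by rewrite subr_gt0; apply: le_lt_trans; exact: gap_ge0.
rewrite H mulr_gt0 ?subr_gt0// /deriv_gap.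
have c_gt0 := lt_le_trans u0_gt0 c0.
have c11 : c <= 1 by exact: le_trans u11.
have key : `|tau| * lnsq c <= 1.
  rewrite -(mulVf (lt0r_neq0 t1)) mulrC -/u1; apply: ler_pM => //.
  - exact: lnsq_ge0.
  - apply: (le_trans (lnsq_le _)); rewrite expr2.
    by apply: le_trans c1; rewrite ler_piMr// ltW.
  - by rewrite lerDr.
have c2 : 0 < c ^+ 2 by rewrite exprn_gt0.
suff phi0 : 0 < phi c.
  apply: divr_gt0; apply: mulr_gt0.
  - by apply: mulr_gt0.
  - apply: (lt_le_trans (@ltr01 R)); rewrite lerDl.
    by apply: mulr_ge0; [exact: mulr_ge0|exact: sqr_ge0].
  - exact: mulr_gt0.
  - exact: sq1_gt0.
rewrite /phi oneBcos_half mulr_gt0// exprn_even_gt0//=.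
rewrite -normr_gt0 norm_sin; last first.
  rewrite 2!normrM (@ger0_norm _ 2^-1)// (ger0_norm (lnsq_ge0 _)).
  by have := pi_ge2 R; move: key; lra.
have lc : 0 < lnsq c by rewrite ln_gt0// ltrDl.
have tl : 0 < `|tau * lnsq c / 2|.
  by rewrite normr_gt0 !mulf_neq0// gt_eqF.
apply: sin_gt0_pi; rewrite tl /=.
rewrite 2!normrM (@ger0_norm _ 2^-1)// (ger0_norm (lnsq_ge0 _)).
by have := pi_ge2 R; move: key; lra.
Qed.

Lemma weight_integral_gt0 : exists2 c : R, 0 < c &
  forall M, 1 <= M -> c <= \int[mu]_(t in `[0, M]) weight t.
Proof.
exists (weight 1); first exact: expR_gt0.
move=> M M1; rewrite (@Rintegral_itv_split _ _ 0 1)//; last 2 first.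
- exact: continuous_weight.
- by rewrite ler01.
rewrite -[leLHS]addr0 lerD//; last by apply: Rintegral_ge0 => t _; exact: expR_ge0.
rewrite [leLHS](_ : _ = \int[mu]_(t in `[0, 1]) weight 1); last first.
  by rewrite Rintegral_cst//= lebesgue_measure_itv/= lte_fin ltr01 sube0 mulr1.
apply: le_Rintegral => //.
- by apply: continuous_integrable_itv => ?; exact: cvg_cst.
- by apply: continuous_integrable_itv; exact: continuous_weight.
move=> t; rewrite /= in_itv/= => /andP[t0 t1].
rewrite ler_expR !mulNr lerN2 ler_wpM2l ?addr_ge0//.
by rewrite ler_ln ?posrE ?sq1_gt0// lerD2l expr1n expr_le1.
Qed.

End sine_integral.

(** * Limits of integrals over growing intervals *)

Section expanding_dominated_convergence.
Variable R : realType.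
Local Notation mu := (@lebesgue_measure R).

(** Extending [f_ k] by 0 beyond [a_ k] puts all the integrals on one half-line. The domination is
    only required where the rescaled angle is at most [pi], that is, up to [a_ k = pi / d_ k] in the
    application. *)
Lemma expanding_dominated_convergence (f_ : nat -> R -> R) (f g : R -> R) (a_ : nat -> R) :
  (forall k, continuous (f_ k)) -> continuous f ->
  mu.-integrable `[0, +oo[ (EFin \o g) -> (forall u, 0 <= g u) ->
  (forall k u, 0 <= u <= a_ k -> `|f_ k u| <= g u) ->
  (forall u, 0 <= u -> f_ k u @[k --> \oo] --> f u) ->
  a_ k @[k --> \oo] --> +oo ->
  \int[mu]_(u in `[0, a_ k]) f_ k u @[k --> \oo] --> \int[mu]_(u in `[0, +oo[) f u.
Proof.
move=> cf_ cf ig g0 f_g f_f a_oo.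
pose F_ k : R -> \bar R := (EFin \o f_ k) \_ `[0, a_ k].
have mF_ k : measurable_fun (`[0%R, +oo[ : set R) (F_ k).
  apply: measurable_funTS; apply: (measurable_restrictT _ _).1 => //.
  by apply: measurable_funTS; apply/measurable_EFinP; exact: continuous_measurable_fun.
have H k : (\int[mu]_(u in `[0%R, a_ k]) (f_ k u)%:E =
    \int[mu]_(u in `[0%R, +oo[) F_ k u)%E.
  rewrite -integral_mkcondr; congr integral; apply/seteqP; split => u /=.
    by rewrite !in_itv/= => /andP[-> ->].
  by case.
have [|||if_ _ +] := @dominated_convergence _ (measurableTypeR R) R mu `[0, +oo[
    (measurable_itv _) F_ (EFin \o f) (EFin \o g) mF_ _ _ ig _.
- by apply: measurable_funTS; apply/measurable_EFinP; exact: continuous_measurable_fun.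
- apply: aeW => u; rewrite /= in_itv/= andbT => u0.
  apply: (@cvg_trans _ ((f_ k u)%:E @[k --> \oo])).
    apply: near_eq_cvg; have := a_oo; move/cvgryPge => /(_ u); apply: filterS => k ua.
    by rewrite /F_ patchE mem_set//= in_itv/= u0.
  by apply: cvg_EFin; [exact: nearW|exact: f_f].
- apply: aeW => u k _; rewrite /F_ patchE; case: ifPn => [|_]; last first.
    by rewrite abse0 lee_fin.
  by rewrite inE/= in_itv/= lee_fin => ?; exact: f_g.
rewrite -[X in _ --> X]fineK; last exact: integrable_fin_num.
move=> /fine_cvg; apply: cvg_trans; apply: near_eq_cvg; near=> k.
by rewrite /Rintegral /= -H.
Unshelve. all: by end_near. Qed.

(** Since [(1 + u)^2 <= 2 (1 + u^2)], the weight is at most a constant times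
    [(1 + u)^-(2 sigma + 1)], whose primitive [F] tends to 0 at infinity. *)
Lemma integrable_weight (sigma : R) : 0 < sigma ->
  mu.-integrable `[0, +oo[ (EFin \o weight sigma).
Proof.
move=> s0.
pose h (u : R) := expR (- (2 * sigma + 1) * ln (1 + u)).
pose F (u : R) := - (2 * sigma)^-1 * expR (- (2 * sigma) * ln (1 + u)).
have s2 : 0 < 2 * sigma by rewrite mulr_gt0.
have dln (u : R) : -1 < u -> is_derive u 1 (fun u : R => ln (1 + u)) (1 + u)^-1.
  move=> u1; have u10 : 0 < 1 + u by lra.
  have h1 : is_derive u 1 (fun u : R => 1 + u) 1.
    by apply: is_derive_eq; rewrite /GRing.scale/=; ring.
  have := @is_derive1_comp _ (@ln R) (fun u : R => 1 + u) u _ _ (is_derive1_ln u10) h1.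
  by move=> h2; apply: is_derive_eq; rewrite mulr1.
have dlin (c u : R) : -1 < u -> is_derive u 1 (fun u => c * ln (1 + u)) (c * (1 + u)^-1).
  by move=> u1; have := dln u u1 => ?; apply: is_derive_eq; rewrite /GRing.scale/=; ring.
have dexp (c u : R) : -1 < u -> is_derive u 1 (fun u => expR (c * ln (1 + u)))
    (expR (c * ln (1 + u)) * (c * (1 + u)^-1)).
  move=> u1; exact: (@is_derive1_comp _ expR (fun u => c * ln (1 + u)) u _ _
    (is_derive_expR _) (dlin c u u1)).
have dF (u : R) : -1 < u -> is_derive u 1 F (h u).
  move=> u1; have u10 : 0 < 1 + u by lra.
  have := dexp (- (2 * sigma)) u u1 => ?; apply: is_derive_eq.
  have -> : h u = expR (- (2 * sigma) * ln (1 + u)) * (1 + u)^-1.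
    by rewrite /h -[in RHS](@lnK _ (1 + u)) ?posrE// -expRN -expRD expRK; congr expR; ring.
  rewrite /GRing.scale/=.
  by field; rewrite !gt_eqF.
have cder (f : R -> R) (df u : R) : is_derive u 1 f df -> {for u, continuous f}.
  by move=> [d _]; apply: differentiable_continuous; apply/derivable1_diffP.
have hint : (\int[mu]_(u in `[0%R, +oo[) (h u)%:E < +oo)%E.
  rewrite (@ge0_continuous_FTC2y _ h F 0 0).
  - by rewrite -EFinB ltry.
  - by move=> x _; exact: expR_ge0.
  - apply: continuous_in_subspaceT => x; rewrite inE/= in_itv/= andbT => x0.
    by apply: cder (dexp _ _ _); lra.
  - rewrite /F -[X in _ --> X](mulr0 (- (2 * sigma)^-1)); apply: cvgM; first exact: cvg_cst.
    apply/cvgrPdist_lt => e e0; near=> u.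
    rewrite sub0r normrN ger0_norm ?expR_ge0// -[e in _ < e]lnK ?posrE// ltr_expR.
    have u0 : 0 < u by near: u; exact: nbhs_pinfty_gt.
    have ue : expR ((2 * sigma)^-1 * - ln e) < u by near: u; apply: nbhs_pinfty_gt; exact: num_real.
    rewrite mulNr ltrNl -ltr_pdivrMl// -[ltLHS]expRK ltr_ln ?posrE ?expR_gt0//; last by lra.
    by apply: lt_trans ue _; lra.
  - move=> x x0; have [] := dF x _ => //; lra.
  - by apply: cvg_at_right_filter; apply: cder (dF _ _); lra.
  - move=> x; rewrite in_itv/= andbT => x0; rewrite derive1E.
    have : -1 < x by lra.
    by move=> /dF ?; rewrite derive_val.
have mh : measurable_fun (`[0%R, +oo[ : set R) h.
  apply: subspace_continuous_measurable_fun => //.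
  apply: continuous_in_subspaceT => x; rewrite inE/= in_itv/= andbT => x0.
  by apply: cder (dexp _ _ _); lra.
apply: (@le_integrable _ _ _ mu _ _ _
    (fun u => (expR ((sigma + 2^-1) * ln 2))%:E * (h u)%:E)%E) => //.
- by apply/measurable_EFinP; apply: measurable_funTS; apply: continuous_measurable_fun; exact: continuous_weight.
- move=> u; rewrite /= in_itv/= andbT => u0.
  rewrite !ger0_norm ?mulr_ge0 ?expR_ge0// lee_fin -expRD ler_expR.
  have u10 : 0 < 1 + u by lra.
  have : 2 * ln (1 + u) <= ln 2 + lnsq u.
    rewrite mulr_natl -lnXn// -lnM ?posrE ?sq1_gt0// ler_ln ?posrE ?mulr_gt0 ?sq1_gt0 ?exprn_gt0//.
    rewrite sqrrD expr1n mul1r; have := sqr_ge0 (1 - u); rewrite sqrrB expr1n mul1r.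
    by rewrite !mulr2n; lra.
  move=> /(ler_wpM2l (_ : 0 <= sigma + 2^-1)) H.
  by have := H (addr_ge0 (ltW s0) (ltW _)); lra.
- apply: integrableZl => //; apply/integrableP; split; first exact/measurable_EFinP.
  under eq_integral do rewrite gee0_abs ?lee_fin ?expR_ge0//.
  exact: hint.
Unshelve. all: by end_near. Qed.

End expanding_dominated_convergence.

(** * Lower bounds for the spherical functions *)

Section scaled_poisson.
Variable R : realType.

(* With [d = 1 - |z|], the Poisson kernel at angular distance [d u] from [z / |z|], times [d]. *)
Definition scaled_poisson (d u : R) : R :=
  (2 - d) * d ^+ 2 / (d ^+ 2 + 2 * (1 - d) * (1 - cos (d * u))).

Local Notation q := scaled_poisson.

Lemma scaled_poisson_den_gt0 (d u : R) : 0 < d < 1 ->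
  0 < d ^+ 2 + 2 * (1 - d) * (1 - cos (d * u)).
Proof.
move=> /andP[d0 d1]; rewrite ltr_pwDl ?exprn_gt0// mulr_ge0 ?oneBcos_ge0//.
by rewrite mulr_ge0// subr_ge0 ltW.
Qed.

Lemma scaled_poisson_gt0 (d u : R) : 0 < d < 1 -> 0 < q d u.
Proof.
move=> d01; have /andP[d0 d1] := d01.
apply: divr_gt0; last exact: scaled_poisson_den_gt0.
by apply: mulr_gt0; [lra|exact: exprn_gt0].
Qed.

Lemma continuous_scaled_poisson (d : R) : 0 < d < 1 -> continuous (q d).
Proof.
move=> d01 u; apply: cvgM; first exact: cvg_cst.
apply: cvgV; first by rewrite gt_eqF// scaled_poisson_den_gt0.
apply: cvgD; first exact: cvg_cst.
apply: cvgM; first exact: cvg_cst.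
apply: cvgB; first exact: cvg_cst.
apply: continuous_comp; last exact: continuous_cos.
by apply: cvgM; [exact: cvg_cst|exact: cvg_id].
Qed.

Lemma scaled_poisson_ge (d u : R) : 0 < d <= 2^-1 -> (1 + u ^+ 2)^-1 <= q d u.
Proof.
move=> /andP[d0 d1]; have d01 : 0 < d < 1 by rewrite d0; lra.
rewrite /scaled_poisson ler_pdivlMr ?scaled_poisson_den_gt0// mulrC ler_pdivrMr ?sq1_gt0//.
have h := oneBcos_le (d * u); rewrite exprMn in h; have d2 : 0 <= d ^+ 2 by exact: sqr_ge0.
have h2 : 2 * (1 - d) * (1 - cos (d * u)) <= (1 - d) * (d ^+ 2 * u ^+ 2).
  rewrite -mulrA mulrCA ler_wpM2l//; lra.
have h3 : (1 - d) * (d ^+ 2 * u ^+ 2) <= d ^+ 2 * u ^+ 2.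
  by apply: ler_piMl; [apply: mulr_ge0; exact: sqr_ge0|lra].
apply: (@le_trans _ _ (1 * d ^+ 2 * (1 + u ^+ 2))).
  by lra.
by rewrite ler_wpM2r ?(ltW (sq1_gt0 _))// ler_wpM2r//; lra.
Qed.

(** By [sin_ge_half], [1 - cos (d u) >= d^2 u^2 / 8] for angles up to [pi]. With [1 - d >= 1/2] and
    a numerator at most [2 d^2] this gives [2 / (1 + u^2 / 8)], whence 16. *)
Lemma scaled_poisson_le (d u : R) : 0 < d <= 2^-1 -> 0 <= u -> d * u <= pi ->
  q d u <= 16 / (1 + u ^+ 2).
Proof.
move=> /andP[d0 d1] u0 dupi; have d01 : 0 < d < 1 by rewrite d0; lra.
have du0 : 0 <= d * u by rewrite mulr_ge0// ltW.
rewrite /scaled_poisson ler_pdivlMr ?sq1_gt0// mulrAC ler_pdivrMr ?scaled_poisson_den_gt0//.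
have s4 : (d * u / 2 / 2) <= sin (d * u / 2) by apply: sin_ge_half; lra.
have : (d * u / 2 / 2) ^+ 2 <= sin (d * u / 2) ^+ 2.
  by rewrite lerXn2r ?nnegrE//; lra.
have := oneBcos_half (d * u); move: (sin _ ^+ 2) (cos _) => s c -> H.
rewrite !expr_div_n exprMn in H; have d2 : 0 <= d ^+ 2 by exact: sqr_ge0.
have du2 : 0 <= d ^+ 2 * u ^+ 2 by rewrite mulr_ge0 ?sqr_ge0.
apply: (@le_trans _ _ (2 * (d ^+ 2 + d ^+ 2 * u ^+ 2))).
  by rewrite -mulrA mulrDr mulr1 ler_wpM2r//; lra.
have : (2^-1) * (2 * s) <= (1 - d) * (2 * s) by rewrite ler_wpM2r//; lra.
lra.
Qed.

Lemma cvg_scaled_poisson (d_ : nat -> R) (u : R) : d_ k @[k --> \oo] --> 0 ->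
  (forall k, 0 < d_ k <= 2^-1) -> q (d_ k) u @[k --> \oo] --> 2 / (1 + u ^+ 2).
Proof.
move=> d_0 d01.
pose a k := (1 - cos (d_ k * u)) / d_ k ^+ 2.
have qE k : q (d_ k) u = (2 - d_ k) / (1 + 2 * (1 - d_ k) * a k).
  have /andP[d0 d1] := d01 k; have d01' : 0 < d_ k < 1 by rewrite d0; lra.
  have H := scaled_poisson_den_gt0 u d01'.
  rewrite /scaled_poisson /a -[X in _ = _ / X](_ : (d_ k ^+ 2 + 2 * (1 - d_ k) * (1 - cos (d_ k * u))) /
    d_ k ^+ 2 = _); last by field; rewrite gt_eqF.
  by field; rewrite !gt_eqF.
have a_cvg : a k @[k --> \oo] --> u ^+ 2 / 2.
  apply: (@squeeze_cvgr _ _ _ _ (fun k => u ^+ 2 / 2 * (1 - d_ k * d_ k * u ^+ 2 / 4))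
    (fun=> u ^+ 2 / 2)).
  - apply: nearW => k; have /andP[d0 _] := d01 k; rewrite /a.
    have d2 : 0 < d_ k ^+ 2 by rewrite exprn_gt0.
    rewrite ler_pdivlMr// ler_pdivrMr//; apply/andP; split; last first.
      by have := oneBcos_le (d_ k * u); rewrite exprMn; lra.
    rewrite oneBcos_half; set y := d_ k * u / 2.
    (* For [0 <= y <= 1], square [y cos y <= sin y] and use [cos^2 y = 1 - sin^2 y >= 1 - y^2]; for
       [y > 1] the left-hand side is not positive. *)
    have key : y ^+ 2 * (1 - y ^+ 2) <= sin y ^+ 2.
      wlog y0 : y / 0 <= y.
        move=> H; have [|y0] := leP 0 y; first exact: H.
        by have := H (- y); rewrite sinN !sqrrN; apply; rewrite oppr_ge0 ltW.
      have [y1|y1] := leP y 1; last first.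
        apply: le_trans (sqr_ge0 _); rewrite mulr_ge0_le0 ?sqr_ge0// subr_le0.
        by rewrite exprn_ege1// ltW.
      have pi2 := pi_ge2 R.
      have cy : 0 <= cos y by apply: cos_ge0_pihalf; lra.
      have sy : y * cos y <= sin y by apply: mulcos_le_sin; lra.
      have : (y * cos y) ^+ 2 <= sin y ^+ 2.
        by rewrite lerXn2r ?nnegrE ?mulr_ge0//; apply: le_trans sy; rewrite mulr_ge0.
      apply: le_trans; rewrite exprMn ler_wpM2l ?sqr_ge0// cos2sin2 lerD2l lerN2.
      rewrite -[leLHS]real_normK ?num_real// -[leRHS]real_normK ?num_real//.
      by rewrite lerXn2r ?nnegrE// normr_sin_le.
    have -> : u ^+ 2 / 2 * (1 - d_ k * d_ k * u ^+ 2 / 4) * d_ k ^+ 2 =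
        2 * (y ^+ 2 * (1 - y ^+ 2)) by rewrite /y; field.
    by rewrite ler_pM2l.
  - rewrite -[X in _ --> X]mulr1; apply: cvgM; first exact: cvg_cst.
    rewrite -[X in _ --> X](subr0 1); apply: cvgB; first exact: cvg_cst.
    rewrite -[X in _ --> X](mul0r (4^-1)); apply: cvgM; last exact: cvg_cst.
    rewrite -[X in _ --> X](mul0r (u ^+ 2)); apply: cvgM; last exact: cvg_cst.
    by rewrite -[X in _ --> X](mul0r 0); apply: cvgM.
  - exact: cvg_cst.
rewrite (_ : (fun k => q (d_ k) u) = fun k => (2 - d_ k) / (1 + 2 * (1 - d_ k) * a k)); last first.
  by apply/funext.
rewrite (_ : 2 / (1 + u ^+ 2) = (2 - 0) / (1 + 2 * (1 - 0) * (u ^+ 2 / 2))); last first.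
  by field; rewrite gt_eqF// sq1_gt0.
apply: cvgM; first by apply: cvgB; [exact: cvg_cst|].
apply: cvgV.
  by rewrite subr0 mulr1 mulrC divfK// gt_eqF// sq1_gt0.
apply: cvgD; first exact: cvg_cst.
apply: cvgM; last exact: a_cvg.
by apply: cvgM; [exact: cvg_cst|apply: cvgB; [exact: cvg_cst|]].
Qed.

End scaled_poisson.

Section radial_lower_bound.
Variable R : realType.
Local Notation mu := (@lebesgue_measure R).
Local Notation q := scaled_poisson.

(* At [tau = 0] the weighted integral of the sine vanishes, and the cosine takes over. *)
Definition trig (tau y : R) : R := if tau == 0 then cos y else sin y.

Lemma trig_le1 tau y : `|trig tau y| <= 1.
Proof. by rewrite /trig; case: ifP => _; [exact: cos_max|exact: sin_max]. Qed.

Lemma continuous_trig tau : continuous (trig tau).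
Proof.
rewrite /trig; case: eqP => _; [exact: continuous_cos|exact: continuous_sin].
Qed.

Variables (n : nat) (sigma tau : R).
Hypothesis sigma0 : 0 < sigma.

Lemma weight_trig_integral_neq0 :
  \int[mu]_(u in `[0, +oo[) (weight sigma u * trig tau (tau * lnsq u)) != 0.
Proof.
pose f (u : R) := weight sigma u * trig tau (tau * lnsq u).
have cf : continuous f.
  move=> u; apply: cvgM; first exact: continuous_weight.
  apply: (@continuous_comp _ _ _ (fun v => tau * lnsq v) (trig tau)).
    by apply: cvgM; [exact: cvg_cst|exact: continuous_lnsq].
  exact: continuous_trig.
have H : \int[mu]_(u in `[0, k%:R]) f u @[k --> \oo] --> \int[mu]_(u in `[0, +oo[) f u.
  apply: (@expanding_dominated_convergence _ (fun=> f) f (weight sigma)) => //.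
  - exact: integrable_weight.
  - by move=> u; exact: expR_ge0.
  - move=> _ u _; rewrite normrM -[leRHS]mulr1 ler_pM ?trig_le1//.
    by rewrite ger0_norm// expR_ge0.
  - by move=> u _; exact: cvg_cst.
  - exact: cvgr_idn.
(* The factor [s] is 1 for the cosine and [tau] for the sine, whose integral has the sign of
   [tau]. *)
have [c c0 [s [M HM]]] : exists2 c : R, 0 < c & exists s M : R,
    forall k : nat, M <= k%:R -> c <= s * \int[mu]_(u in `[0, k%:R]) f u.
  rewrite /f /trig; have [t0|t0] := eqVneq tau 0.
    have [c c0 Hc] := weight_integral_gt0 (ltW sigma0); exists c => //; exists 1, 1.
    move=> k /Hc; rewrite mul1r => /le_trans; apply; rewrite le_eqVlt; apply/orP; left.
    by apply/eqP; apply: eq_Rintegral => u _; rewrite t0 mul0r cos0 mulr1.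
  have [c [u1 [c0 _ Hc]]] := sine_integral_gt0 (ltW sigma0) t0.
  by exists c => //; exists tau, u1 => k /Hc.
apply/negP => /eqP J0; rewrite -/f J0 in H.
have : s * \int[mu]_(u in `[0, k%:R]) f u @[k --> \oo] --> s * 0.
  by apply: cvgM => //; exact: cvg_cst.
rewrite mulr0 => {}H; have : c <= 0; last by rewrite leNgt c0.
apply: (cvgr_to_ge H); near=> k; apply: HM.
by near: k; move: M; apply/cvgryPge; exact: cvgr_idn.
Unshelve. all: by end_near. Qed.

(** The kernel at [q d u / d], divided by its growth [(- ln d)^n * expR ((sigma + 1/2) * - ln d)]
    and with its phase turned by [tau * (ln d - ln 2)]. In this form it converges as [d] tends to
    0. *)
Definition radial_integrand (d u : R) : R :=
  (1 + ln (q d u) / - ln d) ^+ n * expR ((sigma + 2^-1) * ln (q d u)) *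
  trig tau (tau * (ln (q d u) - ln 2)).

Lemma continuous_radial_integrand d : 0 < d < 1 -> continuous (radial_integrand d).
Proof.
move=> d01 u.
have clnq : {for u, continuous (fun v => ln (q d v))}.
  apply: (@continuous_comp _ _ _ (q d) (@ln R)); first exact: continuous_scaled_poisson.
  by apply: continuous_ln; exact: scaled_poisson_gt0.
apply: cvgM; first apply: cvgM.
- apply: (@continuous_comp _ _ _ (fun v => 1 + ln (q d v) / - ln d) (fun y => y ^+ n)).
    by apply: cvgD; [exact: cvg_cst|apply: cvgM; [exact: clnq|exact: cvg_cst]].
  exact: exprn_continuous.
- apply: (@continuous_comp _ _ _ (fun v => (sigma + 2^-1) * ln (q d v)) expR).
    by apply: cvgM; [exact: cvg_cst|exact: clnq].
  exact: continuous_expR.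
apply: (@continuous_comp _ _ _ (fun v => tau * (ln (q d v) - ln 2)) (trig tau)).
  by apply: cvgM; [exact: cvg_cst|apply: cvgB; [exact: clnq|exact: cvg_cst]].
exact: continuous_trig.
Qed.

(** For [d u <= pi <= 4] one has [1 + u^2 <= 17 / d^2], so with [L = - ln d] the upper and lower
    bounds of [q d u] give [|ln (q d u)| <= ln 16 + ln 17 + 2 L]; divide by [L >= ln 2] and add
    1. *)
Let bound : R := 3 + (ln 16 + ln 17) / ln 2.

Let radial_integrand_le d u : 0 < d <= 2^-1 -> 0 <= u <= pi / d ->
  `|radial_integrand d u| <=
  bound ^+ n * expR ((sigma + 2^-1) * ln 16) * weight sigma u.
Proof.
move=> d01 /andP[u0 ud]; have /andP[d0 d1] := d01.
have d01' : 0 < d < 1 by rewrite d0; lra.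
have l2 : 0 < ln 2 :> R by rewrite ln_gt0// ltr1n.
have l16 : 0 < ln 16 :> R by rewrite ln_gt0// ltr1n.
have l17 : 0 < ln 17 :> R by rewrite ln_gt0// ltr1n.
have dupi : d * u <= pi by rewrite mulrC -ler_pdivlMr.
have q0 := scaled_poisson_gt0 u d01'; have s0 := sq1_gt0 u; have ls0 := lnsq_ge0 u.
have h1 : - lnsq u <= ln (q d u).
  by rewrite -lnV ?posrE// ler_ln ?posrE ?invr_gt0//; exact: scaled_poisson_ge.
have h2 : ln (q d u) <= ln 16 - lnsq u.
  have p16 : 0 < 16 / (1 + u ^+ 2) by rewrite divr_gt0.
  by rewrite /lnsq -ln_div ?posrE// ler_ln ?posrE//; exact: scaled_poisson_le.
have L2 : ln 2 <= - ln d.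
  by rewrite -lnV ?posrE// ler_ln ?posrE ?invr_gt0// -[leLHS]invrK lef_pV2 ?posrE ?invr_gt0.
have L0 : 0 < - ln d by exact: lt_le_trans L2.
have h3 : lnsq u <= ln 17 + 2 * - ln d.
  have -> : ln 17 + 2 * - ln d = ln (17 / d ^+ 2).
    by rewrite ln_div ?posrE ?exprn_gt0// lnXn// mulr2n; ring.
  rewrite /lnsq ler_ln ?posrE ?divr_gt0 ?exprn_gt0// ler_pdivlMr ?exprn_gt0//.
  have : (d * u) ^+ 2 <= 4 ^+ 2.
    rewrite lerXn2r ?nnegrE ?mulr_ge0 ?(ltW d0)//.
    by apply: (le_trans dupi); have := @pihalf_lt2 R; lra.
  have : d ^+ 2 <= 1 by rewrite expr_le1 ?ltW//; lra.
  by rewrite exprMn; lra.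
have h4 : `|1 + ln (q d u) / - ln d| <= bound.
  apply: (le_trans (ler_normD _ _)); rewrite normr1 normrM (@ger0_norm _ (_^-1)) ?invr_ge0 ?(ltW L0)//.
  have h5 : `|ln (q d u)| <= ln 16 + ln 17 + 2 * - ln d.
    by rewrite ler_norml; apply/andP; split; lra.
  rewrite /bound -(subrKA 1) ; have : `|ln (q d u)| / - ln d <= 2 + (ln 16 + ln 17) / ln 2.
    rewrite ler_pdivrMr// mulrDl.
    have : (ln 16 + ln 17) / ln 2 * ln 2 <= (ln 16 + ln 17) / ln 2 * - ln d.
      by rewrite ler_wpM2l// divr_ge0// ?addr_ge0// ltW.
    by rewrite divfK ?gt_eqF//; lra.
  by lra.
rewrite /radial_integrand normrM -[leRHS]mulr1 ler_pM ?trig_le1//.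
rewrite normrM -mulrA; apply: ler_pM => //.
  by rewrite normrX lerXn2r ?nnegrE// (le_trans _ h4).
rewrite ger0_norm ?expR_ge0// /weight -expRD ler_expR mulNr -mulrBr.
by rewrite ler_wpM2l// addr_ge0// ltW.
Qed.

(** By contradiction: along some [d_ k] tending to 0 the integrals would tend to 0, whereas by
    dominated convergence they tend to a nonzero multiple of the integral of
    [weight_trig_integral_neq0]. The factor carrying the power [n] tends to 1. *)
Lemma radial_integral_lower_bound : exists c d0 : R, [/\ 0 < c, 0 < d0 &
  forall d, 0 < d <= d0 -> d <= 2^-1 /\
    c <= `|\int[mu]_(u in `[0, pi / d]) radial_integrand d u| ].
Proof.
apply: contrapT => Hno.
have {Hno} H k : {d : R | 0 < d <= k.+2%:R^-1 &
    `|\int[mu]_(u in `[0, pi / d]) radial_integrand d u| <= k.+1%:R^-1}.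
  apply: cid2; apply: contrapT => Hk; apply: Hno; exists k.+1%:R^-1, k.+2%:R^-1; split.
  - by rewrite invr_gt0.
  - by rewrite invr_gt0.
  move=> d /andP[d0 dk]; split.
    by apply: (le_trans dk); rewrite lef_pV2 ?posrE// ler_nat.
  rewrite leNgt; apply/negP => /ltW Hd; apply: Hk; exists d => //.
  by rewrite d0 dk.
pose d_ k := s2val (H k).
have d_k k : 0 < d_ k <= k.+2%:R^-1 by exact: (s2valP (H k)).
have Id k : `|\int[mu]_(u in `[0, pi / d_ k]) radial_integrand (d_ k) u| <= k.+1%:R^-1.
  exact: (s2valP' (H k)).
have d_2 k : 0 < d_ k <= 2^-1.
  have /andP[-> /= dk] := d_k k.
  by apply: (le_trans dk); rewrite lef_pV2 ?posrE// ler_nat.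
have d_1 k : 0 < d_ k < 1 by have := d_2 k; lra.
have inv_cvg : (k.+1%:R^-1 : R) @[k --> \oo] --> 0 by exact: cvg_harmonic.
have d_0 : d_ k @[k --> \oo] --> 0.
  apply: (@squeeze_cvgr _ _ _ _ (fun=> 0) (fun k => k.+1%:R^-1)) => //; last exact: cvg_cst.
  apply: nearW => k; have /andP[d0 dk] := d_k k; rewrite (ltW d0) /=.
  by apply: (le_trans dk); rewrite lef_pV2 ?posrE// ler_nat.
have L_cvg : (- ln (d_ k))^-1 @[k --> \oo] --> 0.
  apply/cvgrPdist_lt => e e0; near=> k; have := d_1 k => /andP[dk0 dk1].
  have lnk : 0 < - ln (d_ k) by rewrite oppr_gt0 ln_lt0// dk0.
  rewrite sub0r normrN ger0_norm ?invr_ge0 ?(ltW lnk)// invf_plt ?posrE// ltrNr.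
  rewrite -[ltRHS]expRK ltr_ln ?posrE ?expR_gt0//.
  near: k; apply: cvgr_lt; [exact: d_0|exact: expR_gt0].
have a_oo : pi / d_ k @[k --> \oo] --> +oo.
  apply/cvgryPge => A; have [A0|A0] := leP A 0; near=> k; have /andP[dk0 _] := d_1 k.
    by apply: (le_trans A0); rewrite divr_ge0 ?pi_ge0// ltW.
  rewrite ler_pdivlMr// mulrC -ler_pdivlMr//; near: k.
  by apply: cvgr_le; [exact: d_0|exact: divr_gt0 (pi_gt0 R) A0].
pose f (u : R) := expR ((sigma + 2^-1) * ln 2) *
  (weight sigma u * trig tau (- (tau * lnsq u))).
have cf : continuous f.
  move=> u; apply: cvgM; first exact: cvg_cst.
  apply: cvgM; first exact: continuous_weight.
  apply: (@continuous_comp _ _ _ (fun v => - (tau * lnsq v)) (trig tau)).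
    by apply: cvgN; apply: cvgM; [exact: cvg_cst|exact: continuous_lnsq].
  exact: continuous_trig.
have bound0 : 0 <= bound.
  by rewrite addr_ge0// divr_ge0 ?addr_ge0// ln_ge0// ler1n.
have Hcvg := @expanding_dominated_convergence _ (fun k => radial_integrand (d_ k)) f
  (fun u => bound ^+ n * expR ((sigma + 2^-1) * ln 16) * weight sigma u) (fun k => pi / d_ k)
  (fun k => continuous_radial_integrand (d_1 k)) cf.
have {}Hcvg : \int[mu]_(u in `[0, pi / d_ k]) radial_integrand (d_ k) u @[k --> \oo] -->
    \int[mu]_(u in `[0, +oo[) f u.
  apply: Hcvg => //.
  - have iw := integrable_weight sigma0.
    by apply: (integrableZl _ (bound ^+ n * expR ((sigma + 2^-1) * ln 16)) iw).
  - by move=> u; rewrite mulr_ge0 ?expR_ge0// mulr_ge0 ?expR_ge0// exprn_ge0.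
  - by move=> k u; exact: radial_integrand_le.
  - move=> u u0; have s0 := sq1_gt0 u.
    have cq := @cvg_scaled_poisson _ d_ u d_0 d_2.
    have cl : ln (q (d_ k) u) @[k --> \oo] --> ln (2 / (1 + u ^+ 2)).
      by apply: continuous_cvg => //; apply: continuous_ln; rewrite divr_gt0.
    have lE : ln (2 / (1 + u ^+ 2)) = ln 2 - lnsq u by rewrite ln_div ?posrE.
    rewrite (_ : f u = (1 + ln (2 / (1 + u ^+ 2)) * 0) ^+ n *
        expR ((sigma + 2^-1) * ln (2 / (1 + u ^+ 2))) *
        trig tau (tau * (ln (2 / (1 + u ^+ 2)) - ln 2))); last first.
      rewrite mulr0 addr0 expr1n mul1r lE /f mulrA /weight -expRD; congr (expR _ * trig _ _); ring.
    apply: cvgM; first apply: cvgM.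
    + apply: (cvg_comp (fun k => 1 + ln (q (d_ k) u) / - ln (d_ k)) (fun y : R => y ^+ n)).
        by apply: cvgD; [exact: cvg_cst|apply: cvgM; [exact: cl|exact: L_cvg]].
      exact: exprn_continuous.
    + apply: (cvg_comp (fun k => (sigma + 2^-1) * ln (q (d_ k) u)) expR).
        by apply: cvgM; [exact: cvg_cst|exact: cl].
      exact: continuous_expR.
    + apply: (cvg_comp (fun k => tau * (ln (q (d_ k) u) - ln 2)) (trig tau)).
        by apply: cvgM; [exact: cvg_cst|apply: cvgB; [exact: cl|exact: cvg_cst]].
      exact: continuous_trig.
have I0 : \int[mu]_(u in `[0, +oo[) f u = 0.
  apply: (cvg_unique _ Hcvg) => //.
  apply/cvgr0Pnorm_le => e e0; near=> k; apply: (le_trans (Id k)).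
  by near: k; apply: cvgr_le; [exact: inv_cvg|].
(* The limiting phase is [- tau * lnsq u]; parity of [trig] pulls the sign out. *)
have [s sE] : exists s : R, forall y, trig tau (- y) = s * trig tau y.
  rewrite /trig; case: (tau == 0); first by exists 1 => y; rewrite cosN mul1r.
  by exists (- 1) => y; rewrite sinN mulN1r.
have s_neq0 : s != 0.
  apply/eqP => s0; have := sE 0; rewrite s0 mul0r oppr0.
  have := sE (pi / 2); rewrite s0 !mul0r /trig; case: (tau == 0); rewrite ?cos0.
    by move=> _ /eqP; rewrite oner_eq0.
  by rewrite sinN sin_pihalf => /eqP; rewrite oppr_eq0 oner_eq0.
pose g u := weight sigma u * trig tau (tau * lnsq u).
have ig : mu.-integrable `[0, +oo[ (EFin \o g).
  apply: (le_integrable _ _ _ (integrable_weight sigma0)) => //.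
    apply/measurable_EFinP; apply: measurable_funTS; apply: continuous_measurable_fun => u.
    apply: cvgM; first exact: continuous_weight.
    apply: (@continuous_comp _ _ _ (fun v => tau * lnsq v) (trig tau)).
      by apply: cvgM; [exact: cvg_cst|exact: continuous_lnsq].
    exact: continuous_trig.
  move=> u _; rewrite lee_fin /g normrM -[leRHS]mulr1 ler_pM ?trig_le1//.
have := weight_trig_integral_neq0; apply/negP/negPn/eqP.
apply: (mulfI (_ : expR ((sigma + 2^-1) * ln 2) * s != 0)).
  by rewrite mulf_neq0// gt_eqF// expR_gt0.
rewrite mulr0 -RintegralZl// -[RHS]I0; apply: eq_Rintegral => u _.
by rewrite /f sE; ring.
Unshelve. all: by end_near. Qed.

End radial_lower_bound.

(** * The Poisson kernel in rescaled polar coordinates *)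

Section poisson_kernel.
Variable R : realType.
Implicit Types (z : R[i]) (xi : circle R).
Local Notation mu := (@lebesgue_measure R).
Local Notation m := (@arc_measure R).
Local Notation q := scaled_poisson.

Lemma normcB_ge z xi : 1 - normc z <= normc (circle_val xi - z).
Proof.
have := normc_triangle z (circle_val xi) 0.
by rewrite !subr0 normc_circle; lra.
Qed.

Lemma poisson_gt0 z xi : normc z < 1 -> 0 < poisson z xi.
Proof.
move=> z1; have z0 := normc_ge0 z; have := normcB_ge z xi => zxi.
rewrite /poisson divr_gt0// ?exprn_gt0//; last by lra.
by rewrite subr_gt0 expr_lt1.
Qed.

Lemma poisson_le z xi : normc z < 1 ->
  poisson z xi <= 2 * (1 - normc z) / normc (circle_val xi - z) ^+ 2.
Proof.
move=> z1; have z0 := normc_ge0 z; have zxi := normcB_ge z xi.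
rewrite /poisson ler_wpM2r ?invr_ge0 ?sqr_ge0//.
by rewrite -[1 in X in X <= _](expr1n _ 2) subr_sqr; nra.
Qed.

Lemma poisson_ge z xi : normc z < 1 -> (1 - normc z) / 4 <= poisson z xi.
Proof.
move=> z1; have z0 := normc_ge0 z; have zxi := normcB_ge z xi.
have h2 : normc (circle_val xi - z) <= 2.
  by apply: (le_trans (le_normcD _ _)); rewrite normcN normc_circle; lra.
rewrite /poisson ler_pdivlMr ?exprn_gt0//; last by lra.
have : normc (circle_val xi - z) ^+ 2 <= 2 ^+ 2 by rewrite lerXn2r ?nnegrE ?normc_ge0.
move: (normc (circle_val xi - z) ^+ 2) => s s4.
rewrite -[1 in X in _ <= X](expr1n _ 2) subr_sqr; nra.
Qed.

Lemma continuous_poisson z : normc z < 1 -> continuous (poisson z).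
Proof.
move=> z1 xi; have zxi := normcB_ge z xi.
apply: (@continuous_comp _ _ _ (fun x => normc (circle_val x - z))
  (fun y => (1 - normc z ^+ 2) / y ^+ 2)); first exact: continuous_circle_dist.
apply: cvgM; first exact: cvg_cst.
apply: cvgV; last exact: exprn_continuous.
by rewrite expf_neq0// gt_eqF//; lra.
Qed.

Lemma polar_form z : exists2 s : R, 0 <= s <= pi *+ 2 &
  z = (normc z)%:C * circle_val (cis s).
Proof.
have [z0|z0] := eqVneq (normc z) 0.
  exists 0; first by rewrite lexx mulrn_wge0// pi_ge0.
  by rewrite (eq0_normc z0) normc0 rmorph0 mul0r.
have z1 : normc (z / (normc z)%:C) = 1.
  by rewrite normcM normcV normcR ger0_norm ?normc_ge0// divff.
pose z' : circle R := SigSub (mem_set z1).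
have [s s2 sE] := cis_surj z'.
exists s => //; rewrite sE /circle_val/= mulrC divfK//.
by apply: contra_neq z0 => -[].
Qed.

Lemma poisson_polar (r s t : R) : 0 <= r < 1 ->
  poisson (r%:C * circle_val (cis s)) (cis t) = q (1 - r) ((t - s) / (1 - r)) / (1 - r).
Proof.
move=> /andP[r0 r1]; have d0 : 1 - r != 0 by rewrite gt_eqF// subr_gt0.
have n1 : normc (r%:C * circle_val (cis s)) = r.
  by rewrite normcM normcR normc_circle mulr1 ger0_norm.
have e : (1 - r) * ((t - s) / (1 - r)) = t - s by rewrite mulrCA divff ?mulr1.
rewrite /poisson n1 /scaled_poisson e.
have -> : normc (circle_val (cis t) - r%:C * circle_val (cis s)) ^+ 2 =
    (1 - r) ^+ 2 + 2 * (1 - (1 - r)) * (1 - cos (t - s)).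
  rewrite /circle_val /= !mul0r subr0 addr0 sqr_sqrtr ?addr_ge0 ?sqr_ge0//.
  have := cos2Dsin2 t; have := cos2Dsin2 s; rewrite cosB.
  by move: (cos t) (cos s) (sin t) (sin s) => a b c d; nra.
have den : (1 - r) ^+ 2 + 2 * (1 - (1 - r)) * (1 - cos (t - s)) != 0.
  rewrite gt_eqF// ltr_pwDl ?exprn_gt0 ?subr_gt0// mulr_ge0 ?oneBcos_ge0//; lra.
by move: den; move: ((1 - r) ^+ 2 + _) => D den; field; rewrite den d0.
Qed.

(** Angles are counted from the argument of [z] in units of [d]; the factor [d / pi] is
    [1 / (2 pi)], times 2 for the symmetry, times [d] for the change of variable. *)
Lemma poisson_radial_integral (F : R -> R) z : normc z < 1 ->
  (forall x, 0 < x -> {for x, continuous F}) ->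
  let d := 1 - normc z in
  \int[m]_xi F (poisson z xi) =
  d / pi * \int[mu]_(u in `[0, pi / d]) F (q d u / d).
Proof.
move=> z1 cF /=; set d := 1 - normc z; have z0 := normc_ge0 z.
have d0 : 0 < d by rewrite subr_gt0.
rewrite circle_Rintegral; last first.
  move=> xi; apply: (@continuous_comp _ _ _ (poisson z) F).
    exact: continuous_poisson.
  by apply: cF; exact: poisson_gt0.
have [s s2 zE] := polar_form z.
pose G (x : R) := F (q d (x / d) / d).
have z01 : 0 <= normc z < 1 by rewrite z0 z1.
have GE t : F (poisson z (cis t)) = G (t - s).
  by rewrite {1}zE poisson_polar.
under eq_Rintegral do rewrite GE.
have pz x : q d (x / d) / d = poisson z (cis (x + s)).
  by rewrite [in RHS]zE poisson_polar// addrK.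
have cG : continuous G.
  move=> x; have -> : G = (F \o poisson z) \o (@cis R \o (fun x => x + s)).
    by apply/funext => y; rewrite /G /= pz.
  apply: continuous_comp.
    apply: continuous_comp; last exact: cis_continuous.
    by apply: cvgD; [exact: cvg_id|exact: cvg_cst].
  apply: (@continuous_comp _ _ _ (poisson z) F); first exact: continuous_poisson.
  by apply: cF; exact: poisson_gt0.
have dK x : d * (x / d) = x by rewrite mulrCA divff ?mulr1// gt_eqF.
have GN x : G (- x) = G x.
  by rewrite /G /scaled_poisson !dK cosN.
have Gper x : G (x + pi *+ 2) = G x.
  by rewrite /G /scaled_poisson !dK cosD2pi.
rewrite Rintegral_even_periodic//.
have := @Rintegral_affine R G d 0 0 (pi / d) d0 _ cG.
rewrite mulr0 !addr0 dK => ->; last first.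
  by rewrite divr_ge0 ?pi_ge0// ltW.
rewrite !mulrA; congr (_ * _).
  by move: (lt0r_neq0 (pi_gt0 R)); move: (@pi R) => p p0; field.
apply: eq_Rintegral => u _; rewrite addr0 /G; congr (F (q d _ / d)).
by rewrite mulrAC divff ?mul1r// gt_eqF.
Qed.

End poisson_kernel.

Section circle_integrability.
Variable R : realType.

Lemma continuous_circle_bounded (f : circle R -> R) : continuous f ->
  exists M : R, forall xi, `|f xi| <= M.
Proof.
move=> cf.
have cfT : compact (f @` [set: circle R]).
  apply: continuous_compact; last exact: circle_compact.
  exact/continuous_subspaceT.
have [M [_ HM]] := compact_bounded cfT; exists (M + 1) => xi.
by apply: HM; [rewrite ltrDl|exists xi].
Qed.

Lemma continuous_circle_integrable (mu : {finite_measure set (circle R) -> \bar R})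
    (f : circle R -> R) : continuous f -> mu.-integrable setT (EFin \o f).
Proof.
move=> cf; have [M HM] := continuous_circle_bounded cf.
apply: measurable_bounded_integrable => //.
- exact: finite_measure_lty.
- exact: continuous_circle_measurable.
- exists M; split; first exact: num_real.
  by move=> x Mx y _; apply: le_trans (HM y) (ltW Mx).
Qed.

End circle_integrability.

Section kernel_asymptotics.
Variable R : realType.
Implicit Types (z w lambda : R[i]) (xi : circle R).

Lemma spar_Re_ge0 lambda : 0 <= Re (spar lambda).
Proof. by rewrite /spar /sqrtc; case: (_ + _) => a b /=; exact: sqrtr_ge0. Qed.

(** A purely imaginary root [i b] makes [lambda + 1/4] equal to [- b^2], which puts [lambda] on the
    excluded ray or at its end point. *)
Lemma spar_Re_gt0 lambda :
  ~ (exists2 t : R, t < - 4^-1 & lambda = t%:C) -> lambda != - 4^-1 ->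
  0 < Re (spar lambda).
Proof.
move=> hl l4; rewrite lt_neqAle spar_Re_ge0 andbT eq_sym; apply/eqP => w0.
have := sqr_sqrtc (lambda + 4^-1); rewrite -/(spar lambda).
case: (spar lambda) w0 => a b /= -> /(congr1 (fun x => x - 4^-1)); rewrite addrK => lE.
have {}lE : lambda = (- b ^+ 2 - 4^-1)%:C.
  rewrite -lE rmorphB/= fmorphV/= rmorph_nat; congr (_ - _).
  by rewrite expr2; simpc; rewrite expr2.
have [b0|b0] := eqVneq b 0.
  move: l4; rewrite lE b0 expr0n /= oppr0 sub0r rmorphN/= fmorphV/= rmorph_nat.
  by rewrite eqxx.
apply: hl; exists (- b ^+ 2 - 4^-1) => //.
by rewrite gtrDr oppr_lt0 exprn_even_gt0.
Qed.

(** The left-hand side is the imaginary part of [X + i Y] turned by the angle [- a]. *)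
Lemma normc_ge_rotated (X Y a : R) :
  `|cos a * Y - sin a * X| <= normc (X +i* Y).
Proof.
rewrite /= -sqrtr_sqr ler_wsqrtr//.
have -> : X ^+ 2 + Y ^+ 2 = (cos a * Y - sin a * X) ^+ 2 + (cos a * X + sin a * Y) ^+ 2.
  have := cos2Dsin2 a; move: (cos a) (sin a) => c s e.
  by rewrite -[LHS]mulr1 -e; ring.
by rewrite lerDl sqr_ge0.
Qed.

Lemma normc_ge_Re (X Y : R) : `|X| <= normc (X +i* Y).
Proof. by rewrite /= -sqrtr_sqr ler_wsqrtr// lerDl sqr_ge0. Qed.

Lemma normc_ge_Im (X Y : R) : `|Y| <= normc (X +i* Y).
Proof. by rewrite /= -sqrtr_sqr ler_wsqrtr// lerDr sqr_ge0. Qed.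

Definition kernel_const n lambda : R[i] := ((n`!)%:R * (2 * spar lambda) ^+ n)^-1.

(** Signed, since [ln x] may be negative; [abs_kernel] is its absolute value. *)
Definition kernel_modulus n (sigma x : R) : R := ln x ^+ n * expR ((sigma + 2^-1) * ln x).

Lemma poly_kernelE n lambda z xi : lambda != - 4^-1 ->
  poly_kernel n lambda z xi = kernel_const n lambda *
    (kernel_modulus n (Re (spar lambda)) (poisson z xi) *
       cos (Im (spar lambda) * ln (poisson z xi)) +i*
     (kernel_modulus n (Re (spar lambda)) (poisson z xi) *
       sin (Im (spar lambda) * ln (poisson z xi)))).
Proof.
move=> /negbTE l4; rewrite /poly_kernel l4 -mulrA /kernel_const; congr (_ * _).
rewrite /horo opprK /cpow /cexp /kernel_modulus.
have -> : (spar lambda + 2^-1) * (ln (poisson z xi))%:C =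
   ((Re (spar lambda) + 2^-1) * ln (poisson z xi)) +i* (Im (spar lambda) * ln (poisson z xi)).
  rewrite -[2^-1 in LHS](_ : (2^-1)%:C = _); last by rewrite fmorphV rmorph_nat.
  by case: (spar lambda) => a b /=; simpc.
by rewrite /= mulrA -rmorphM/=; simpc.
Qed.

Lemma kernel_const_neq0 n lambda : spar lambda != 0 -> kernel_const n lambda != 0.
Proof.
move=> w0; rewrite invr_neq0// mulf_neq0 ?pnatr_eq0 -?lt0n ?fact_gt0//.
by rewrite expf_neq0// mulf_neq0.
Qed.

Lemma normc_gt0 z : z != 0 -> 0 < normc z.
Proof.
move=> z0; rewrite lt_neqAle normc_ge0 andbT eq_sym; apply: contra_neq z0.
exact: eq0_normc.
Qed.

Lemma normc_poly_kernel n lambda z xi : lambda != - 4^-1 ->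
  normc (poly_kernel n lambda z xi) = normc (kernel_const n lambda) *
    (`|ln (poisson z xi)| ^+ n * expR ((Re (spar lambda) + 2^-1) * ln (poisson z xi))).
Proof.
move=> l4; rewrite poly_kernelE// normcM; congr (_ * _).
rewrite /kernel_modulus; set A := _ * expR _; set t := _ * ln _.
rewrite -[X in normc X](_ : A%:C * (cos t +i* sin t) = _); last by simpc.
by rewrite normcM normcR normc_cis mulr1 normrM normrX (@ger0_norm _ (expR _))// expR_ge0.
Qed.

End kernel_asymptotics.

Section spherical_lower_bound.
Variable R : realType.
Implicit Types (z w lambda : R[i]) (xi : circle R).
Local Notation m := (@arc_measure R).
Local Notation q := scaled_poisson.

Lemma continuous_kernel_modulus n (sigma x : R) : 0 < x ->
  {for x, continuous (kernel_modulus n sigma)}.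
Proof.
move=> x0; have cl := @continuous_ln R x x0; apply: cvgM.
  exact: (@continuous_comp _ _ _ (@ln R) (fun y => y ^+ n) x cl (@exprn_continuous _ n _)).
apply: (@continuous_comp _ _ _ (fun y => (sigma + 2^-1) * ln y) expR).
  by apply: cvgM; [exact: cvg_cst|exact: cl].
exact: continuous_expR.
Qed.

Lemma continuous_comp_poisson (F : R -> R) z : normc z < 1 ->
  (forall x, 0 < x -> {for x, continuous F}) -> continuous (F \o poisson z).
Proof.
move=> z1 cF xi; apply: (@continuous_comp _ _ _ (poisson z) F).
  exact: continuous_poisson.
by apply: cF; exact: poisson_gt0.
Qed.

Lemma continuous_scaled_ln (G : R -> R) (t x : R) : continuous G -> 0 < x ->
  {for x, continuous (fun x => G (t * ln x))}.
Proof.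
move=> cG x0; apply: (@continuous_comp _ _ _ (fun y => t * ln y) G); last exact: cG.
by apply: cvgM; [exact: cvg_cst|exact: continuous_ln].
Qed.

Variables (n : nat) (lambda : R[i]).
Hypothesis hlambda : ~ exists2 t : R, t < - 4^-1 & lambda = t%:C.

Local Notation sigma := (Re (spar lambda)).
Local Notation tau := (Im (spar lambda)).

Let Pcos (x : R) := kernel_modulus n sigma x * cos (tau * ln x).
Let Psin (x : R) := kernel_modulus n sigma x * sin (tau * ln x).

Let cPcos x : 0 < x -> {for x, continuous Pcos}.
Proof.
move=> x0; apply: cvgM; first exact: continuous_kernel_modulus.
by apply: continuous_scaled_ln => //; exact: continuous_cos.
Qed.

Let cPsin x : 0 < x -> {for x, continuous Psin}.
Proof.
move=> x0; apply: cvgM; first exact: continuous_kernel_modulus.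
by apply: continuous_scaled_ln => //; exact: continuous_sin.
Qed.

Lemma poly_sphericalE z : normc z < 1 -> lambda != - 4^-1 ->
  poly_spherical n lambda z = kernel_const n lambda *
   ((\int[m]_xi Pcos (poisson z xi)) +i* (\int[m]_xi Psin (poisson z xi))).
Proof.
move=> z1 l4; case E : (kernel_const n lambda) => [a b].
have ic : m.-integrable setT (EFin \o (fun xi => Pcos (poisson z xi))).
  by apply: continuous_circle_integrable; exact: continuous_comp_poisson.
have is_ : m.-integrable setT (EFin \o (fun xi => Psin (poisson z xi))).
  by apply: continuous_circle_integrable; exact: continuous_comp_poisson.
have icZ (k : R) : m.-integrable setT (EFin \o (fun xi => k * Pcos (poisson z xi))).
  by have := integrableZl measurableT k ic.
have isZ (k : R) : m.-integrable setT (EFin \o (fun xi => k * Psin (poisson z xi))).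
  by have := integrableZl measurableT k is_.
have kE xi : poly_kernel n lambda z xi =
    (a * Pcos (poisson z xi) - b * Psin (poisson z xi)) +i*
    (a * Psin (poisson z xi) + b * Pcos (poisson z xi)).
  by rewrite poly_kernelE// E; simpc.
rewrite /poly_spherical; simpc; congr (_ +i* _).
  under eq_Rintegral => xi _ do rewrite kE /=.
  by rewrite RintegralB// !RintegralZl.
under eq_Rintegral => xi _ do rewrite kE /=.
by rewrite RintegralD// !RintegralZl.
Qed.

(** The phase of the spherical function turns like [- tau * ln (1 - |z|)]. Projecting on a direction
    that turns with it gives a real integral with a limit; for [tau = 0] the real part will do. *)
Let norm_rotated_integral z : normc z < 1 ->
  `|\int[m]_xi (kernel_modulus n sigma (poisson z xi) *
      trig tau (tau * (ln (poisson z xi) + ln (1 - normc z) - ln 2)))| <=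
  normc ((\int[m]_xi Pcos (poisson z xi)) +i* (\int[m]_xi Psin (poisson z xi))).
Proof.
move=> z1.
have ic : m.-integrable setT (EFin \o (fun xi => Pcos (poisson z xi))).
  by apply: continuous_circle_integrable; exact: continuous_comp_poisson.
have is_ : m.-integrable setT (EFin \o (fun xi => Psin (poisson z xi))).
  by apply: continuous_circle_integrable; exact: continuous_comp_poisson.
have icZ (k : R) : m.-integrable setT (EFin \o (fun xi => k * Pcos (poisson z xi))).
  by have := integrableZl measurableT k ic.
have isZ (k : R) : m.-integrable setT (EFin \o (fun xi => k * Psin (poisson z xi))).
  by have := integrableZl measurableT k is_.
rewrite /trig; case: eqP => [t0|_].
  apply: le_trans (normc_ge_Re _ (\int[m]_xi Psin (poisson z xi))); rewrite le_eqVlt.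
  apply/orP; left; apply/eqP; congr `|_|; apply: eq_Rintegral => xi _.
  by rewrite /Pcos t0 !mul0r cos0.
pose al := tau * (ln 2 - ln (1 - normc z)).
apply: le_trans (normc_ge_rotated _ _ al); rewrite -!RintegralZl// -RintegralB//.
rewrite le_eqVlt; apply/orP; left; apply/eqP; congr `|_|; apply: eq_Rintegral => xi _.
rewrite (_ : tau * (_ + _ - _) = tau * ln (poisson z xi) - al); last by rewrite /al; ring.
by rewrite sinB /Pcos /Psin; ring.
Qed.

Lemma poly_spherical_lower_bound : lambda != - 4^-1 ->
  exists c d0 : R, [/\ 0 < c, 0 < d0 & forall z, normc z < 1 -> 1 - normc z <= d0 ->
    1 - normc z <= 2^-1 /\
    c * ((- ln (1 - normc z)) ^+ n * expR ((sigma - 2^-1) * - ln (1 - normc z))) <=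
      normc (poly_spherical n lambda z)].
Proof.
move=> l4; have s0 := spar_Re_gt0 hlambda l4.
have [c [d0 [c0 d00 H]]] := radial_integral_lower_bound n tau s0.
have w0 : spar lambda != 0 by apply: contraTneq s0 => ->; rewrite ltxx.
have k0 := normc_gt0 (kernel_const_neq0 n w0).
exists (normc (kernel_const n lambda) * (c / pi)), d0.
split => //; first by rewrite mulr_gt0// divr_gt0// pi_gt0.
move=> z z1 zd0; have dp : 0 < 1 - normc z by rewrite subr_gt0.
have [|d2 Hd] := H (1 - normc z); first by rewrite dp.
split => //; rewrite poly_sphericalE// normcM -mulrA ler_wpM2l ?normc_ge0//.
apply: le_trans (norm_rotated_integral z1).
pose F (x : R) := kernel_modulus n sigma x *
  trig tau (tau * (ln x + ln (1 - normc z) - ln 2)).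
have cF x : 0 < x -> {for x, continuous F}.
  move=> x0; apply: cvgM; first exact: continuous_kernel_modulus.
  apply: (@continuous_comp _ _ _ (fun x => tau * (ln x + ln (1 - normc z) - ln 2)) (trig tau)).
    apply: cvgM; first exact: cvg_cst.
    apply: cvgB; last exact: cvg_cst.
    by apply: cvgD; [exact: continuous_ln|exact: cvg_cst].
  exact: continuous_trig.
rewrite (poisson_radial_integral z1 cF).
move: dp d2 Hd {zd0}; set d := 1 - normc z => dp d2 Hd.
have d01 : 0 < d < 1 by rewrite dp; lra.
have L0 : 0 < - ln d by rewrite oppr_gt0 ln_lt0.
have lnd : ln d != 0 by rewrite lt_eqF// -oppr_gt0.
(* The growth of the kernel at [P = q / d], from [ln P = - ln d * (1 + ln q / - ln d)]. *)
pose B := (- ln d) ^+ n * expR ((sigma + 2^-1) * - ln d).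
have FE u : F (q d u / d) = B * radial_integrand n sigma tau d u.
  have q0 := scaled_poisson_gt0 u d01.
  rewrite /F /kernel_modulus ln_div ?posrE// /radial_integrand -/d.
  rewrite (_ : ln (q d u) - ln d = - ln d * (1 + ln (q d u) / - ln d)); last first.
    by field; rewrite ?lnd.
  rewrite exprMn (_ : expR _ = expR ((sigma + 2^-1) * - ln d) * expR ((sigma + 2^-1) * ln (q d u))); last first.
    by rewrite -expRD; congr expR; field; rewrite ?lnd.
  rewrite (_ : tau * _ = tau * (ln (q d u) - ln 2)); last first.
    by field; rewrite ?lnd.
  by rewrite /B; ring.
under eq_Rintegral do rewrite FE.
rewrite RintegralZl//; last first.
  by apply: continuous_integrable_itv; exact: continuous_radial_integrand.
have B0 : 0 <= B by rewrite mulr_ge0 ?expR_ge0// exprn_ge0// ltW.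
rewrite normrM [X in _ <= _ * X]normrM (ger0_norm B0) (@ger0_norm _ (d / pi)); last first.
  by rewrite divr_ge0 ?pi_ge0// ltW.
(* The factor [d] of the change of variable lowers the exponent by 1. *)
have -> : expR ((sigma - 2^-1) * - ln d) = expR ((sigma + 2^-1) * - ln d) * d.
  have dE : expR (ln d) = d by rewrite lnK.
  by rewrite -[X in _ = _ * X]dE -expRD; congr expR; field.
rewrite (_ : c / pi * _ = d / pi * (B * c)); last by rewrite /B; ring.
by rewrite ler_wpM2l ?divr_ge0 ?pi_ge0 ?(ltW dp)// ler_wpM2l.
Qed.

End spherical_lower_bound.

(** * The spherical function in the critical case *)

Section critical_spherical_lower_bound.
Variable R : realType.
Implicit Types (z : R[i]) (xi : circle R).
Local Notation mu := (@lebesgue_measure R).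
Local Notation q := scaled_poisson.
Variable n : nat.

Let F (x : R) : R := ((2 * n)`!)%:R^-1 * kernel_modulus (2 * n) 0 x.

Lemma critical_poly_kernelE z xi : normc z < 1 ->
  poly_kernel n (- 4^-1) z xi = (F (poisson z xi))%:C.
Proof.
move=> z1; have P0 := poisson_gt0 xi z1.
rewrite /poly_kernel eqxx /F /kernel_modulus add0r /horo -mulrA; congr (_ * (_ * _))%:C.
  by rewrite !exprM sqrrN.
by rewrite /powR gt_eqF.
Qed.

Lemma normc_critical_poly_kernel z xi : normc z < 1 ->
  normc (poly_kernel n (- 4^-1) z xi) = ((2 * n)`!)%:R^-1 *
    (`|ln (poisson z xi)| ^+ (2 * n) * expR ((0 + 2^-1) * ln (poisson z xi))).
Proof.
move=> z1; rewrite critical_poly_kernelE// normcR normrM ger0_norm ?invr_ge0//.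
by rewrite /kernel_modulus normrM normrX (@ger0_norm _ (expR _))// expR_ge0.
Qed.

Let F_ge0 x : 0 <= F x.
Proof.
rewrite mulr_ge0 ?invr_ge0// mulr_ge0 ?expR_ge0// exprM exprn_ge0//.
exact: sqr_ge0.
Qed.

Let cF x : 0 < x -> {for x, continuous F}.
Proof. by move=> x0; apply: cvgM; [exact: cvg_cst|exact: continuous_kernel_modulus]. Qed.

(** The integrand is nonnegative, so a range of angles suffices on which [|ln P|] is at least a
    multiple of [L] and [sqrt P] behaves like a multiple of [1 / u]; integrating [1 / u] over a
    range of logarithmic length proportional to [L] gives the extra factor [L]. *)
Lemma critical_poly_spherical_lower_bound :
  exists c d0 : R, [/\ 0 < c, 0 < d0 & forall z, normc z < 1 -> 1 - normc z <= d0 ->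
    1 - normc z <= 2^-1 /\
    c * ((- ln (1 - normc z)) ^+ (2 * n).+1 * expR ((0 - 2^-1) * - ln (1 - normc z))) <=
      normc (poly_spherical n (- 4^-1) z)].
Proof.
pose C : R := ((2 * n)`!)%:R^-1; have C0 : 0 < C by rewrite invr_gt0 ltr0n fact_gt0.
have l2 : 0 < ln 2 :> R by rewrite ln_gt0// ltr1n.
have l16 : 0 < ln 16 :> R by rewrite ln_gt0// ltr1n.
have pi0 := pi_gt0 R.
(* [ln 16 <= L / 4] yields [ln P <= - L / 4] on the chosen range, and the second term absorbs the
   [ln 2] lost in the integral of [g]. *)
pose L0 : R := 4 * ln 16 + 8 * ln 2.
exists (C / pi / 4 ^+ (2 * n) / 8), (expR (- L0)); split.
- by rewrite !divr_gt0// exprn_gt0.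
- exact: expR_gt0.
move=> z z1 zd0; have dp : 0 < 1 - normc z by rewrite subr_gt0.
have d2 : 1 - normc z <= 2^-1.
  apply: (le_trans zd0); rewrite -[leRHS]lnK ?posrE ?invr_gt0// ler_expR lnV ?posrE//.
  by rewrite lerN2 /L0; lra.
split => //; rewrite /poly_spherical.
apply: le_trans (normc_ge_Re _ _); apply: le_trans (ler_norm _).
under eq_Rintegral do rewrite critical_poly_kernelE//=.
rewrite (poisson_radial_integral z1 cF).
move: dp d2 zd0; set d := 1 - normc z => dp d2 dd0.
have d01 : 0 < d < 1 by rewrite dp; lra.
set L := - ln d.
have LL0 : L0 <= L.
  by rewrite /L lerNr -[leRHS]expRK ler_ln ?posrE ?expR_gt0.
have L_gt0 : 0 < L by apply: lt_le_trans LL0; rewrite /L0; lra.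
have dE : d = expR (- L) by rewrite /L opprK lnK.
(* In terms of the angle [d * u] this is the range from [d^(1/4)] to 1. *)
pose A := expR (3 / 4 * L); pose B := expR L.
have AB : A <= B by rewrite ler_expR; lra.
have A0 : 0 < A by exact: expR_gt0.
have Bpi : B <= pi / d.
  by rewrite dE expRN invrK ler_peMl ?expR_ge0//; have := pi_ge2 R; lra.
have cG : continuous (fun u => F (q d u / d)).
  move=> u; apply: (@continuous_comp _ _ _ (fun u => q d u / d) F).
    by apply: cvgM; [exact: continuous_scaled_poisson|exact: cvg_cst].
  by apply: cF; rewrite divr_gt0// scaled_poisson_gt0.
pose K := C * (L / 4) ^+ (2 * n) * expR (L / 2).
have K0 : 0 <= K by rewrite !mulr_ge0 ?expR_ge0 ?exprn_ge0// ?divr_ge0// ltW.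
(* A minorant of [(1 + u^2)^(-1/2)] with the explicit primitive [lnsq / 2]. *)
pose g (u : R) := u / (1 + u ^+ 2).
have cg : continuous g.
  move=> u; apply: cvgM; first exact: cvg_id.
  apply: cvgV; first by rewrite gt_eqF// sq1_gt0.
  by apply: cvgD; [exact: cvg_cst|exact: exprn_continuous].
have step1 : \int[mu]_(u in `[A, B]) (K * g u) <=
    \int[mu]_(u in `[0, pi / d]) F (q d u / d).
  rewrite (@Rintegral_itv_split _ _ 0 A)//; last first.
    by rewrite (ltW A0) (le_trans AB).
  rewrite (@Rintegral_itv_split _ _ A B (pi / d))//; last by rewrite AB.
  apply: (@le_trans _ _ (\int[mu]_(u in `[A, B]) F (q d u / d))); last first.
    rewrite addrCA lerDl addr_ge0//; apply: Rintegral_ge0 => u _; exact: F_ge0.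
  apply: le_Rintegral => //.
  - apply: continuous_integrable_itv => u; apply: cvgM; [exact: cvg_cst|exact: cg].
  - exact: continuous_integrable_itv.
  move=> u; rewrite /= in_itv/= => /andP[Au uB].
  have u0 : 0 < u by exact: lt_le_trans Au.
  have q0 := scaled_poisson_gt0 u d01; have s0 := sq1_gt0 u.
  have lnu : 3 / 4 * L <= ln u by rewrite -[leLHS]expRK ler_ln ?posrE ?expR_gt0.
  have lnsqu : 2 * ln u <= lnsq u.
    rewrite mulr_natl -lnXn// /lnsq ler_ln ?posrE ?exprn_gt0//.
    by rewrite lerDr.
  have h2 : ln (q d u) <= ln 16 - lnsq u.
    have p16 : 0 < 16 / (1 + u ^+ 2) by rewrite divr_gt0.
    rewrite /lnsq -ln_div ?posrE// ler_ln ?posrE//; apply: scaled_poisson_le => //.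
    - by rewrite dp.
    - exact: ltW.
    - by rewrite mulrC -ler_pdivlMr//; apply: le_trans Bpi.
  have h1 : - lnsq u <= ln (q d u).
    by rewrite -lnV ?posrE// ler_ln ?posrE ?invr_gt0//; apply: scaled_poisson_ge; rewrite dp.
  have lnP : ln (q d u / d) = ln (q d u) + L by rewrite ln_div ?posrE.
  have lnP4 : L / 4 <= - ln (q d u / d) by rewrite lnP; move: LL0; rewrite /L0; lra.
  rewrite (_ : K * g u = C * ((L / 4) ^+ (2 * n) * (expR (L / 2) * g u))); last first.
    by rewrite /K; ring.
  rewrite /F /kernel_modulus add0r -/C ler_wpM2l ?(ltW C0)//.
  apply: ler_pM.
  - by rewrite exprn_ge0// divr_ge0// ltW.
  - apply: mulr_ge0; first exact: expR_ge0.
    by apply: divr_ge0; [exact: ltW|exact: ltW].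
  - have -> : ln (q d u / d) ^+ (2 * n) = (- ln (q d u / d)) ^+ (2 * n).
      by rewrite !exprM sqrrN.
    have L4 : 0 <= L / 4 by rewrite divr_ge0// ltW.
    by apply: lerXn2r => //; rewrite nnegrE//; exact: le_trans lnP4.
  have gu : g u <= expR (2^-1 * - lnsq u).
    have -> : g u = expR (ln u - lnsq u).
      by rewrite expRD expRN !lnK ?posrE.
    by rewrite ler_expR; lra.
  apply: (@le_trans _ _ (expR (L / 2) * expR (2^-1 * - lnsq u))).
    by rewrite ler_wpM2l ?expR_ge0.
  by rewrite -expRD ler_expR lnP; lra.
have step2 : L / 8 <= \int[mu]_(u in `[A, B]) g u.
  have -> : \int[mu]_(u in `[A, B]) g u = 2^-1 * lnsq B - 2^-1 * lnsq A.
    have dl (u : R) : is_derive u 1 (fun v : R => 2^-1 * lnsq v) (g u).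
      have := is_derive_lnsq u => ?; apply: is_derive_eq.
      by rewrite /GRing.scale/= /g; field; rewrite gt_eqF// sq1_gt0.
    have AB' : A < B by rewrite ltr_expR; lra.
    rewrite /Rintegral (@continuous_FTC2 R g (fun v : R => 2^-1 * lnsq v) A B)//.
    - exact: continuous_subspaceT.
    - have cl : continuous (fun v : R => 2^-1 * lnsq v).
        by move=> u; apply: cvgM; [exact: cvg_cst|exact: continuous_lnsq].
      split.
      + by move=> u _; have [] := dl u.
      + by apply: cvg_at_right_filter; exact: cl.
      + by apply: cvg_at_left_filter; exact: cl.
    - by move=> u _; rewrite derive1E; have [_ ->] := dl u.
  have hB : 2 * L <= lnsq B.
    have -> : 2 * L = ln (B ^+ 2) by rewrite lnXn ?expR_gt0// expRK mulr_natl.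
    by rewrite ler_ln ?posrE ?exprn_gt0 ?expR_gt0 ?sq1_gt0// lerDr.
  have hA : lnsq A <= ln 2 + 2 * (3 / 4 * L).
    have -> : ln 2 + 2 * (3 / 4 * L) = ln (2 * A ^+ 2).
      by rewrite lnM ?posrE ?exprn_gt0// lnXn// expRK mulr_natl.
    rewrite ler_ln ?posrE ?mulr_gt0 ?exprn_gt0 ?sq1_gt0// mulr_natl mulr2n lerD2r.
    by rewrite exprn_ege1// -expR0 ler_expR mulr_ge0// ltW.
  by move: LL0; rewrite /L0; lra.
apply: (@le_trans _ _ (d / pi * (K * (L / 8)))); last first.
  rewrite ler_wpM2l ?divr_ge0 ?pi_ge0 ?(ltW dp)//; apply: le_trans step1.
  rewrite RintegralZl//; last exact: continuous_integrable_itv.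
  by rewrite ler_wpM2l.
rewrite le_eqVlt; apply/orP; left; apply/eqP.
have eE : expR ((0 - 2^-1) * L) = d * expR (L / 2).
  by rewrite dE -expRD; congr expR; field.
rewrite eE /K exprS expr_div_n; move: (4 ^+ (2 * n)) (lt0r_neq0 (exprn_gt0 (2 * n) (ltr0n R 4)))
  (@pi R) (lt0r_neq0 pi0) => X X0 p p0.
by field; rewrite X0 p0.
Qed.

End critical_spherical_lower_bound.

(** * Approach regions *)

Section regions.
Variable R : realType.
Implicit Types (z w : R[i]) (xi : circle R).

Lemma normc_sqr z : normc z ^+ 2 = Re z ^+ 2 + Im z ^+ 2.
Proof. by case: z => a b /=; rewrite sqr_sqrtr// addr_ge0 ?sqr_ge0. Qed.

Lemma normc_moebius z w : normc (1 - z * conjc w) ^+ 2 - normc (z - w) ^+ 2 =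
  (1 - normc z ^+ 2) * (1 - normc w ^+ 2).
Proof.
by rewrite !normc_sqr; case: z => a b; case: w => c e; simpc => /=; ring.
Qed.

(** From [A + B <= expR b * (A - B)] and [normc_moebius], [A^2 <= 4 expR b * d * (1 - t)]. As also
    [1 - t <= A], both [1 - t] and [A] are at most [4 expR b * d], and the path through [w] has
    length at most [A + (1 - t)]. *)
Lemma rho_lt_close (z : R[i]) (t b : R) xi : normc z < 1 -> 0 <= t < 1 ->
  rho z (t%:C * circle_val xi) < b ->
  normc (z - circle_val xi) <= 8 * expR b * (1 - normc z).
Proof.
move=> z1 /andP[t0 t1]; set w := t%:C * circle_val xi => rhob.
have z0 := normc_ge0 z.
have nw : normc w = t by rewrite normcM normcR normc_circle mulr1 ger0_norm.
have := normc_moebius z w; rewrite nw.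
move: rhob; rewrite /rho; set A := normc (1 - _); set B := normc (z - w) => rhob AB.
have A0 : 0 <= A := normc_ge0 _; have B0 : 0 <= B := normc_ge0 _.
have t2 : 0 < 1 - t ^+ 2 by rewrite subr_gt0 expr_lt1.
have z2 : 0 < 1 - normc z ^+ 2 by rewrite subr_gt0 expr_lt1.
have AB0 : B < A.
  by rewrite -(@ltr_pXn2r _ 2)// ?nnegrE// -subr_gt0 AB mulr_gt0.
have e0 := expR_gt0 b.
have H1 : A + B <= expR b * (A - B).
  rewrite -ler_pdivrMr ?subr_gt0// -[leLHS]lnK ?posrE ?divr_gt0 ?subr_gt0//; last first.
    by rewrite ltr_wpDr//; exact: le_lt_trans AB0.
  by rewrite ler_expR ltW.
set d := 1 - normc z; have d0 : 0 < d by rewrite subr_gt0.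
have H2 : A ^+ 2 <= expR b * (4 * d * (1 - t)).
  have : A ^+ 2 <= expR b * ((1 - normc z ^+ 2) * (1 - t ^+ 2)).
    rewrite -AB; apply: (@le_trans _ _ ((A + B) * (A + B))); first by nra.
    rewrite subr_sqr mulrA; apply: ler_wpM2r => //; exact: addr_ge0.
  move=> /le_trans; apply; rewrite ler_wpM2l ?(ltW e0)//.
  rewrite (_ : 4 * d * _ = (2 * d) * (2 * (1 - t))); last by ring.
  apply: ler_pM; rewrite ?(ltW z2) ?(ltW t2)//; rewrite /d; nra.
have H3 : 1 - t <= A.
  have : normc z * t <= t by rewrite ler_piMl// ltW.
  have := normc_triangle (z * conjc w) 1 0.
  rewrite !subr0 normc1 normcM -/A.
  rewrite (_ : normc (conjc w) = t); last first.
    by rewrite -nw; case: (w) => p q /=; rewrite sqrrN.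
  lra.
have H4 : 1 - t <= 4 * expR b * d.
  have t1' : 0 < 1 - t by rewrite subr_gt0.
  rewrite -(ler_pM2r t1'); apply: le_trans (_ : A ^+ 2 <= _); first by nra.
  by apply: (le_trans H2); rewrite le_eqVlt; apply/orP; left; apply/eqP; ring.
have H5 : A <= 4 * expR b * d.
  have X0 : 0 <= 4 * expR b * d by rewrite !mulr_ge0 ?(ltW e0) ?(ltW d0).
  rewrite -(@ler_pXn2r _ 2)// ?nnegrE//; apply: (le_trans H2).
  rewrite expr2 (_ : expR b * _ = 4 * expR b * d * (1 - t)); last by ring.
  by rewrite ler_wpM2l.
apply: (le_trans (normc_triangle w z (circle_val xi))).
have -> : normc (w - circle_val xi) = 1 - t.
  rewrite -[X in _ - X]mul1r -mulrBl normcM normc_circle mulr1 -rmorphB normcR.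
  by rewrite distrC ger0_norm// subr_ge0 ltW.
by rewrite -/B; lra.
Qed.

Lemma rho_radius_close z (a : R) xi : normc z < 1 -> rho_radius z xi <= a ->
  normc (z - circle_val xi) <= 8 * expR (a + 1) * (1 - normc z).
Proof.
move=> z1 za.
(* A near-minimiser is enough, which costs the 1 in [a + 1]. *)
have [_ [_ [[t t01 <-] wd] <-] rhob] : exists2 y,
    [set rho z w | w in Defs.radius xi `&` @disk R] y & y < a + 1.
  apply: contrapT => H.
  have : a + 1 <= rho_radius z xi.
    apply: lb_le_inf.
      exists (rho z 0), 0 => //; split; last by rewrite /disk /mkset normc0.
      by exists 0; [rewrite /= in_itv/= lexx ler01|rewrite rmorph0 mul0r].
    by move=> y Sy; rewrite leNgt; apply/negP => ya; apply: H; exists y.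
  lra.
move: wd; rewrite /disk/= normcM normcR normc_circle mulr1 => wd.
move: t01 wd; rewrite /= in_itv/= => /andP[t0 _]; rewrite ger0_norm// => t1.
by apply: rho_lt_close rhob => //; rewrite t0.
Qed.

Lemma rho0_le z : normc z < 1 -> rho z 0 <= ln 2 - ln (1 - normc z).
Proof.
move=> z1; have z0 := normc_ge0 z; have d0 : 0 < 1 - normc z by rewrite subr_gt0.
rewrite /rho conjc0 mulr0 !subr0 normc1 -ln_div ?posrE// ler_ln ?posrE ?divr_gt0//; last by lra.
by rewrite ler_wpM2r ?invr_ge0 ?(ltW d0)//; lra.
Qed.

Lemma rho0_gt0 z : normc z < 1 -> z != 0 -> 0 < rho z 0.
Proof.
move=> z1 z0; have nz := normc_gt0 z0.
rewrite /rho conjc0 mulr0 !subr0 normc1 ln_gt0// ltr_pdivlMr ?subr_gt0// mul1r; lra.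
Qed.

Lemma admissible_region_close (a : R) z xi : admissible_region a xi z ->
  normc (z - circle_val xi) <= 8 * expR (a + 1) * (1 - normc z).
Proof. by case; exact: rho_radius_close. Qed.

(** The exponential turns the summand [ln (rho z 0)] into the factor [rho z 0], which is at most
    [ln 2 + L <= 2 L] with [L = - ln (1 - |z|)]. *)
Lemma enlarged_region_close (a : R) z xi : enlarged_region a xi z ->
  1 - normc z <= 2^-1 ->
  normc (z - circle_val xi) <= 16 * expR (a + 1) * (- ln (1 - normc z)) * (1 - normc z).
Proof.
case=> z1 z0 /(rho_radius_close z1) H d2; apply: (le_trans H).
have d0 : 0 < 1 - normc z by rewrite subr_gt0.
have -> : expR (a + ln (rho z 0) + 1) = expR (a + 1) * rho z 0.
  rewrite (addrAC a) (expRD (a + 1)). congr (_ * _); apply: lnK.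
  by rewrite posrE; exact: rho0_gt0.
rewrite ler_wpM2r ?(ltW d0)// mulrA.
rewrite (_ : 16 * _ * _ = 8 * expR (a + 1) * (2 * - ln (1 - normc z))); last by ring.
rewrite ler_wpM2l ?mulr_ge0 ?expR_ge0//; apply: (le_trans (rho0_le z1)).
have : ln 2 <= - ln (1 - normc z).
  by rewrite -lnV ?posrE// ler_ln ?posrE ?invr_gt0// -[leLHS]invrK lef_pV2 ?posrE ?invr_gt0.
lra.
Qed.

End regions.

(** * Integrals of the kernel *)

Section dyadic_estimate.
Variable R : realType.
Implicit Types (z : R[i]) (xi : circle R).
Variables (mu : {measure set (circle R) -> \bar R}) (w : circle R -> \bar R).
Hypotheses (w0 : forall x, (0 <= w x)%E) (mw : measurable_fun setT w).

(** Two instances are needed: arc measure with weight [|g - g zeta|], and the part of a measure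
    carried by a null set, with weight 1. *)
Let I (A : set (circle R)) : \bar R := (\int[mu]_(x in A) w x)%E.

Lemma weighted_integral_le (f : circle R -> R) (A : set (circle R)) (b : R) :
  measurable A -> measurable_fun setT f -> (forall x, 0 <= f x) ->
  0 <= b -> (forall x, A x -> f x <= b) ->
  (\int[mu]_(x in A) ((f x)%:E * w x) <= b%:E * I A)%E.
Proof.
move=> mA mf f0 b0 fb; rewrite -ge0_integralZl//; last exact: measurable_funTS.
apply: ge0_le_integral => //.
- by move=> x _; rewrite mule_ge0// lee_fin.
- apply: emeasurable_funM; last exact: measurable_funTS.
  by apply/measurable_EFinP; exact: measurable_funTS.
- by apply: measurable_funeM; exact: measurable_funTS.
- by move=> x Ax; rewrite lee_wpmul2r// lee_fin; exact: fb.
Qed.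

Lemma weighted_integral_setU (f : circle R -> R) (A B C : set (circle R)) :
  measurable A -> measurable B -> measurable_fun setT f -> (forall x, 0 <= f x) ->
  measurable C -> C `<=` A `|` B ->
  (\int[mu]_(x in C) ((f x)%:E * w x) <=
   \int[mu]_(x in A) ((f x)%:E * w x) + \int[mu]_(x in B) ((f x)%:E * w x))%E.
Proof.
move=> mA mB mf f0 mC CAB.
have mfw : measurable_fun setT (fun x => ((f x)%:E * w x)%E).
  by apply: emeasurable_funM => //; exact/measurable_EFinP.
have fw0 x : (0 <= (f x)%:E * w x)%E by rewrite mule_ge0// lee_fin.
apply: (@le_trans _ _ (\int[mu]_(x in A `|` B `\` A) ((f x)%:E * w x))%E).
  apply: ge0_subset_integral => //.
  - by apply: measurableU => //; exact: measurableD.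
  - exact: measurable_funTS.
  - move=> x /CAB [Ax|Bx]; first by left.
    by have [Ax|Ax] := pselect (A x); [left|right].
rewrite ge0_integral_setU//; last 3 first.
- exact: measurableD.
- exact: measurable_funTS.
- by apply/disj_setPS => x [Ax [_]]; exact.
apply: leeD => //; apply: ge0_subset_integral => //.
- exact: measurableD.
- exact: measurable_funTS.
Qed.

Lemma dyadic_arc_integral_le (f : circle R -> R) (zeta : circle R) (r0 b0 : R)
    (b : nat -> R) (N : nat) :
  measurable_fun setT f -> (forall x, 0 <= f x) -> 0 < r0 -> 0 <= b0 ->
  (forall k, 0 <= b k) ->
  (forall xi, arc zeta r0 xi -> f xi <= b0) ->
  (forall k xi, 2 ^+ k * r0 <= normc (circle_val xi - circle_val zeta) -> f xi <= b k) ->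
  (\int[mu]_(x in arc zeta (2 ^+ N * r0)) ((f x)%:E * w x) <=
    b0%:E * I (arc zeta r0) +
    \sum_(k < N) ((b k)%:E * I (arc zeta (2 ^+ k.+1 * r0))))%E.
Proof.
move=> mf f0 r00 b00 bk0 fb0 fbk; elim: N => [|N IH].
  rewrite big_ord0 adde0 expr0 mul1r; apply: weighted_integral_le => //.
  exact: measurable_arc.
rewrite big_ord_recr/= addeA.
apply: le_trans (@weighted_integral_setU f (arc zeta (2 ^+ N * r0))
  (arc zeta (2 ^+ N.+1 * r0) `\` arc zeta (2 ^+ N * r0)) _ _ _ _ _ _ _) _ => //.
- exact: measurable_arc.
- by apply: measurableD; exact: measurable_arc.
- exact: measurable_arc.
- by move=> x Ax; have [Bx|Bx] := pselect (arc zeta (2 ^+ N * r0) x); [left|right].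
apply: leeD => //.
apply: (@le_trans _ _ ((b N)%:E * I (arc zeta (2 ^+ N.+1 * r0) `\` arc zeta (2 ^+ N * r0)))%E).
  apply: weighted_integral_le => //; first by apply: measurableD; exact: measurable_arc.
  by move=> x [_] /negP; rewrite -leNgt; exact: fbk.
apply: lee_wpmul2l; first by rewrite lee_fin.
apply: ge0_subset_integral => //.
- by apply: measurableD; exact: measurable_arc.
- exact: measurable_arc.
- exact: measurable_funTS.
Qed.

(** The arcs double only up to a fixed size, where the vanishing density stops being informative;
    beyond it only the total mass is available. *)
Lemma dyadic_integral_le (f : circle R -> R) (zeta : circle R) (r0 b0 : R)
    (b : nat -> R) (N : nat) :
  measurable_fun setT f -> (forall x, 0 <= f x) -> 0 < r0 -> 0 <= b0 ->
  (forall k, 0 <= b k) ->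
  (forall xi, arc zeta r0 xi -> f xi <= b0) ->
  (forall k xi, 2 ^+ k * r0 <= normc (circle_val xi - circle_val zeta) -> f xi <= b k) ->
  (\int[mu]_x ((f x)%:E * w x) <=
    b0%:E * I (arc zeta r0) +
    \sum_(k < N) ((b k)%:E * I (arc zeta (2 ^+ k.+1 * r0))) + (b N)%:E * I setT)%E.
Proof.
move=> mf f0 r00 b00 bk0 fb0 fbk.
apply: le_trans (@weighted_integral_setU f (arc zeta (2 ^+ N * r0))
  (~` arc zeta (2 ^+ N * r0)) _ _ _ _ _ _ _) _ => //.
- exact: measurable_arc.
- by apply: measurableC; exact: measurable_arc.
- by move=> x _; have [Bx|Bx] := pselect (arc zeta (2 ^+ N * r0) x); [left|right].
apply: leeD; first exact: dyadic_arc_integral_le.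
apply: (@le_trans _ _ ((b N)%:E * I (~` arc zeta (2 ^+ N * r0)))%E).
  apply: weighted_integral_le => //; first by apply: measurableC; exact: measurable_arc.
  by move=> x /negP; rewrite -leNgt; exact: fbk.
apply: lee_wpmul2l; first by rewrite lee_fin.
apply: ge0_subset_integral => //.
by apply: measurableC; exact: measurable_arc.
Qed.

End dyadic_estimate.

Section kernel_estimate.
Variable R : realType.
Implicit Types (z : R[i]) (xi zeta : circle R).

Definition abs_kernel (p : nat) (sigma x : R) : R :=
  `|ln x| ^+ p * expR ((sigma + 2^-1) * ln x).

Lemma abs_kernel_ge0 p sigma x : 0 <= abs_kernel p sigma x.
Proof. by rewrite mulr_ge0 ?expR_ge0. Qed.

Lemma continuous_abs_kernel p (sigma x : R) : 0 < x ->
  {for x, continuous (abs_kernel p sigma)}.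
Proof.
move=> x0; have cl := @continuous_ln R x x0; apply: cvgM.
  apply: (@continuous_comp _ _ _ (fun x => `|ln x|) (fun y => y ^+ p) x).
    by apply: cvg_norm; exact: cl.
  exact: exprn_continuous.
apply: (@continuous_comp _ _ _ (fun y => (sigma + 2^-1) * ln y) expR).
  by apply: cvgM; [exact: cvg_cst|exact: cl].
exact: continuous_expR.
Qed.

(* The logarithmic factor by which both the mass of the kernel and the approach region exceed
   their generic size in the critical case [sigma = 0]. *)
Definition critical_factor (sigma L : R) : R := if sigma == 0 then L else 1.

Lemma ex_dyadic (x : R) : 1 <= x -> exists N, 2 ^+ N <= x < 2 ^+ N.+1.
Proof.
move=> x1; have x0 : 0 <= x by exact: le_trans x1.
have /andP[tx xt] := truncn_itv x0.
have t1 : (0 < Num.truncn x)%N by rewrite truncn_gt0.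
have /andP[h1 h2] := trunc_log_bounds (ltnSn 1) t1.
exists (trunc_log 2 (Num.truncn x)); apply/andP; split.
  by apply: le_trans tx; rewrite -natrX ler_nat.
by apply: (lt_le_trans xt); rewrite -natrX ler_nat.
Qed.

Lemma ln2_le1 : ln 2 <= 1 :> R.
Proof. by have := @le_ln1Dx R 1; apply; lra. Qed.

Lemma mul_expRN_le (L : R) : 0 < L -> L * expR (- L) <= 4 / L.
Proof.
move=> L0; rewrite ler_pdivlMr// mulrAC expRN ler_pdivrMr ?expR_gt0//.
have -> : expR L = expR (L / 2) ^+ 2.
  by rewrite -expRM_natl -mulr_natl; congr expR; field.
have h : L / 2 <= expR (L / 2) by apply: le_trans (expR_ge1Dx _); lra.
have : (L / 2) ^+ 2 <= expR (L / 2) ^+ 2 by rewrite lerXn2r ?nnegrE ?expR_ge0// divr_ge0// ltW.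
by rewrite expr_div_n; lra.
Qed.

Lemma geometric_le (theta : R) N : 0 < theta < 1 ->
  \sum_(k < N) theta ^+ k <= (1 - theta)^-1.
Proof.
move=> /andP[t0 t1]; have d0 : 0 < 1 - theta by rewrite subr_gt0.
have := subrX1 theta N; move=> e.
have -> : \sum_(k < N) theta ^+ k = (1 - theta ^+ N) / (1 - theta).
  apply: (mulIf (lt0r_neq0 d0)); rewrite divfK ?gt_eqF// -[1 - theta]opprB mulrN mulrC -e.
  by rewrite opprB.
by rewrite ler_pdivrMr// mulVf ?gt_eqF// gerBl exprn_ge0// ltW.
Qed.

Lemma poisson_le_inv z xi : normc z < 1 -> poisson z xi <= 2 / (1 - normc z).
Proof.
move=> z1; have dp : 0 < 1 - normc z by rewrite subr_gt0.
have H3 := normcB_ge z xi; apply: (le_trans (poisson_le xi z1)).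
move: (1 - normc z) dp H3 => d dp H3.
rewrite ler_pdivrMr ?exprn_gt0//; last by exact: lt_le_trans H3.
have : d ^+ 2 <= normc (circle_val xi - z) ^+ 2.
  by rewrite lerXn2r ?nnegrE ?normc_ge0// ltW.
move=> /(ler_wpM2l (ltW (divr_gt0 (ltr0n R 2) dp))); apply: le_trans.
by rewrite le_eqVlt; apply/orP; left; apply/eqP; field; rewrite gt_eqF.
Qed.

Lemma abs_ln_poisson_le z xi : normc z < 1 -> 1 <= - ln (1 - normc z) ->
  `|ln (poisson z xi)| <= 3 * - ln (1 - normc z).
Proof.
move=> z1; have dp : 0 < 1 - normc z by rewrite subr_gt0.
have P0 := poisson_gt0 xi z1.
have := poisson_le_inv xi z1; have := poisson_ge xi z1.
move: (1 - normc z) dp (poisson z xi) P0 => d dp P P0 H2 H1 L1.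
have H3 : ln P <= ln 2 - ln d by rewrite -ln_div ?posrE// ler_ln ?posrE ?divr_gt0.
have H4 : ln d - ln 4 <= ln P by rewrite -ln_div ?posrE// ler_ln ?posrE ?divr_gt0.
have l4 : ln 4 = ln 2 + ln 2 :> R by rewrite -lnM ?posrE//; congr ln; ring.
by have l1 := ln2_le1; rewrite ler_norml; apply/andP; split; lra.
Qed.

Variables (p : nat) (sigma K : R).
Hypotheses (sigma0 : 0 <= sigma) (K1 : 1 <= K).
Local Notation M := (critical_factor sigma).
Let a := sigma + 2^-1.
(** The ratio [2^(-2 sigma)] of consecutive dyadic contributions. For [sigma = 0] they are all
    equal, and their number, at most [L / ln 2], produces the critical factor. *)
Let theta := expR (- (2 * sigma) * ln 2).
Let S : R := if sigma == 0 then (ln 2)^-1 else (1 - theta)^-1.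

Let l2 : 0 < ln 2 :> R. Proof. by rewrite ln_gt0// ltr1n. Qed.

Let S_gt0 : 0 < S.
Proof.
rewrite /S; have [_|s0] := eqVneq sigma 0; first by rewrite invr_gt0.
rewrite invr_gt0 subr_gt0 /theta -[ltRHS]expR0 ltr_expR mulNr oppr_lt0.
by rewrite !mulr_gt0// lt_neqAle eq_sym s0.
Qed.

Let sum_theta_le N L : 1 <= L -> N%:R * ln 2 <= L ->
  \sum_(k < N) theta ^+ k <= S * M L.
Proof.
move=> L1 NL; rewrite /S /critical_factor; have [s0|s0] := eqVneq sigma 0.
  rewrite (eq_bigr (fun=> 1)); last first.
    by move=> k _; rewrite /theta s0 mulr0 oppr0 mul0r expR0 expr1n.
  by rewrite sumr_const card_ord mulrC ler_pdivlMr.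
rewrite mulr1; apply: geometric_le; rewrite expR_gt0/= /theta -[ltRHS]expR0 ltr_expR.
by rewrite mulNr oppr_lt0 !mulr_gt0// lt_neqAle eq_sym s0.
Qed.

Let M_ge1 L : 1 <= L -> 1 <= M L.
Proof. by rewrite /critical_factor; case: ifP. Qed.

Let M_le L : 1 <= L -> M L <= L.
Proof. by rewrite /critical_factor; case: ifP. Qed.

(** The target order exceeds the far term [d^a] by the factor [M L * expR (2 sigma L)], which in
    both cases grows at least like [s' * L]. *)
Let s' : R := if sigma == 0 then 1 else 2 * sigma.

Let s'_gt0 : 0 < s'.
Proof.
by rewrite /s'; have [//|s0] := eqVneq sigma 0; rewrite mulr_gt0// lt_neqAle eq_sym s0.
Qed.

Let M_exp_ge L : 1 <= L -> s' * L <= M L * expR (2 * sigma * L).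
Proof.
move=> L1; rewrite /s' /critical_factor; have [s0|s0] := eqVneq sigma 0.
  by rewrite s0 mulr0 mul0r expR0 mul1r mulr1.
by rewrite mul1r; apply: le_trans (expR_ge1Dx _); rewrite lerDr.
Qed.

Variables (mu : {measure set (circle R) -> \bar R}) (w : circle R -> \bar R).
Hypotheses (w0 : forall x, (0 <= w x)%E) (mw : measurable_fun setT w).
Variables (zeta : circle R) (W : R).
Hypothesis Iw : (\int[mu]_x w x <= W%:E)%E.
Hypothesis vw : vanishing_density (fun A => \int[mu]_(x in A) w x)%E zeta.

(** Near [zeta] the maximum of the kernel meets a mass of at most [eta * r0]; on the shells up to
    the fixed radius [h0] the kernel decays while the masses stay below [eta] times the radius;
    beyond, the total mass [W] is multiplied by a term of order [d^a], smaller than the target. In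
    all three the power of [|ln P|] is replaced by [(3 L)^p]. *)
Lemma kernel_weighted_integral_le (e : R) : 0 < e -> exists2 d1 : R, 0 < d1 &
  forall z, normc z < 1 -> 1 - normc z <= d1 ->
    normc (z - circle_val zeta) <= K * M (- ln (1 - normc z)) * (1 - normc z) ->
    (\int[mu]_xi ((abs_kernel p sigma (poisson z xi))%:E * w xi) <=
     (e * ((- ln (1 - normc z)) ^+ p * M (- ln (1 - normc z)) *
           expR ((sigma - 2^-1) * - ln (1 - normc z))))%:E)%E.
Proof.
move=> e0.
have W0 : 0 <= W by rewrite -lee_fin; apply: le_trans Iw; exact: integral_ge0.
pose C1 := 2 * K * expR (a * ln 2) + 2 * expR (a * ln 8) * S.
have K0 : 0 < K by exact: lt_le_trans K1.
have C10 : 0 < C1 by rewrite addr_gt0// !mulr_gt0 ?expR_gt0.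
(* [3^p] comes from [|ln P| <= 3 L], and 2 from adding the part within [h0], bounded through
   [eta * C1], to the far part. *)
pose e' := e / (2 * 3 ^+ p); pose eta := e' / C1.
have p3 : 0 < 3 ^+ p :> R by rewrite exprn_gt0.
have e'0 : 0 < e' by rewrite divr_gt0// mulr_gt0.
have eta0 : 0 < eta by rewrite divr_gt0.
have [h1 h10 Hh1] := vw eta0.
pose h0 := Num.min h1 1.
have h00 : 0 < h0 by rewrite lt_min h10 ltr01.
have h0h1 : h0 <= h1 by rewrite ge_min lexx.
have h01 : h0 <= 1 by rewrite ge_min lexx orbT.
(* The last dyadic radius exceeds [h0 / 2], so the far Poisson kernel is at most [32 d / h0^2]. *)
pose D := W * expR (a * ln (32 / h0 ^+ 2)).
have D0 : 0 <= D by rewrite mulr_ge0 ?expR_ge0.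
(* The summands ensure, in turn, [L >= 1], [r0 <= h0], and that the far term is absorbed. *)
pose L1 := 1 + 8 * K / h0 + D / (e' * s').
have L1_ge : [/\ 1 <= L1, 8 * K / h0 <= L1 & D / (e' * s') <= L1].
  have H1 : 0 <= 8 * K / h0 by rewrite divr_ge0 ?mulr_ge0// ltW.
  have H2 : 0 <= D / (e' * s') by rewrite divr_ge0// ltW// mulr_gt0.
  by rewrite /L1; split; lra.
exists (expR (- L1)); first exact: expR_gt0.
move=> z z1; have dp : 0 < 1 - normc z by rewrite subr_gt0.
move dE : (1 - normc z) dp => d dp dd1; move LE : (- ln d) => L zz.
have ddE : d = expR (- L) by rewrite -LE opprK lnK.
have LL1 : L1 <= L by rewrite -LE lerNr -[leRHS]expRK ler_ln ?posrE ?expR_gt0.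
have [L1_1 L1_2 L1_3] := L1_ge.
have L_ge1 : 1 <= L by exact: le_trans LL1.
have L_gt0 : 0 < L by exact: lt_le_trans L_ge1.
have M1 := M_ge1 L_ge1; have ML := M_le L_ge1.
have M0 : 0 < M L by exact: lt_le_trans M1.
pose r0 := 2 * K * M L * d.
have r00 : 0 < r0 by rewrite !mulr_gt0.
have dr0 : d <= r0.
  rewrite -[leLHS]mul1r ler_wpM2r ?(ltW dp)//.
  by rewrite mulr_ege1//; move: K1; lra.
have r0h0 : r0 <= h0.
  apply: (@le_trans _ _ (2 * K * (4 / L))).
    rewrite /r0 -mulrA ler_wpM2l//; first by rewrite mulr_ge0// ltW.
    apply: le_trans (mul_expRN_le L_gt0); rewrite -ddE ler_wpM2r//; exact: ltW.
  rewrite (_ : 2 * K * (4 / L) = 8 * K / L); last by field; rewrite gt_eqF.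
  rewrite ler_pdivrMr// -ler_pdivrMl// mulrC; exact: le_trans LL1.
have [N /andP[N1 N2]] : exists N, 2 ^+ N <= h0 / r0 < 2 ^+ N.+1.
  by apply: ex_dyadic; rewrite ler_pdivlMr// mul1r.
rewrite ler_pdivlMr// in N1; rewrite ltr_pdivrMr// in N2.
have z0 := normc_ge0 z.
have Pbound xi : `|ln (poisson z xi)| <= 3 * L.
  by rewrite -LE -dE; apply: abs_ln_poisson_le => //; rewrite dE LE.
pose Q (x : R) := (3 * L) ^+ p * expR (a * ln x).
have Q0 x : 0 <= Q x by rewrite mulr_ge0 ?expR_ge0// exprn_ge0// mulr_ge0// ltW.
have fQ xi : abs_kernel p sigma (poisson z xi) <= Q (poisson z xi).
  rewrite ler_wpM2r ?expR_ge0// lerXn2r ?nnegrE//.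
  by rewrite mulr_ge0// ltW.
have a0 : 0 <= a by rewrite addr_ge0.
have Qle x y : 0 < x -> x <= y -> Q x <= Q y.
  move=> x0 xy; rewrite /Q ler_wpM2l ?exprn_ge0 ?mulr_ge0 ?(ltW L_gt0)//.
  by rewrite ler_expR ler_wpM2l// ler_ln ?posrE//; exact: lt_le_trans xy.
(* From [P <= 2 d / |xi - z|^2] and [|xi - z| >= 2^k r0 / 2]. *)
pose b (k : nat) := Q (8 * d / (2 ^+ k * r0) ^+ 2).
have p2 (k : nat) : 0 < 2 ^+ k :> R by rewrite exprn_gt0.
have b_bound (k : nat) xi : 2 ^+ k * r0 <= normc (circle_val xi - circle_val zeta) ->
    abs_kernel p sigma (poisson z xi) <= b k.
  move=> kxi; apply: (le_trans (fQ xi)); apply: Qle; first exact: poisson_gt0.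
  apply: (le_trans (poisson_le xi z1)); rewrite dE.
  have X0 : 0 < 2 ^+ k * r0 by rewrite mulr_gt0.
  have r0k : r0 <= 2 ^+ k * r0 by rewrite ler_peMl ?(ltW r00)// exprn_ege1// ler1n.
  have zeta2 : 2 * normc (z - circle_val zeta) <= r0.
    by move: zz; rewrite /r0; lra.
  have H := normc_triangle z (circle_val xi) (circle_val zeta).
  have H2 : 2 ^+ k * r0 / 2 <= normc (circle_val xi - z) by lra.
  have H3 : (2 ^+ k * r0 / 2) ^+ 2 <= normc (circle_val xi - z) ^+ 2.
    by rewrite lerXn2r ?nnegrE ?normc_ge0// divr_ge0// ltW.
  have Y0 : 0 < normc (circle_val xi - z) ^+ 2.
    by apply: lt_le_trans H3; rewrite exprn_gt0// divr_gt0.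
  rewrite ler_pdivrMr// mulrAC ler_pdivlMr ?exprn_gt0//.
  rewrite expr_div_n in H3; rewrite -!mulrA.
  have : 8 * d * ((2 ^+ k * r0) ^+ 2 / 2 ^+ 2) <= 8 * d * normc (circle_val xi - z) ^+ 2.
    by rewrite ler_wpM2l// mulr_ge0// ltW.
  by lra.
have b0_bound xi : abs_kernel p sigma (poisson z xi) <= Q (2 / d).
  apply: (le_trans (fQ xi)); apply: Qle; first exact: poisson_gt0.
  by rewrite -dE; exact: poisson_le_inv.
have mf : measurable_fun setT (fun xi => abs_kernel p sigma (poisson z xi)).
  apply: continuous_circle_measurable.
  by apply: (@continuous_comp_poisson _ (abs_kernel p sigma)) => // x; exact: continuous_abs_kernel.
have := @dyadic_integral_le R mu w w0 mw (fun xi => abs_kernel p sigma (poisson z xi))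
  zeta r0 (Q (2 / d)) b N mf (fun=> abs_kernel_ge0 _ _ _) r00 (Q0 _) (fun=> Q0 _)
  (fun xi _ => b0_bound xi) b_bound.
move=> /le_trans; apply.
have Iarc (h : R) : 0 < h -> h <= h0 -> (\int[mu]_(x in arc zeta h) w x <= (eta * h)%:E)%E.
  by move=> hp hh0; apply: Hh1; rewrite hp (le_trans hh0).
apply: (@le_trans _ _ ((Q (2 / d) * (eta * r0) +
    \sum_(k < N) b k * (eta * (2 ^+ k.+1 * r0)) + b N * W)%:E)).
  rewrite !EFinD; apply: leeD; first apply: leeD.
  - by rewrite [leRHS]EFinM; apply: lee_wpmul2l; [rewrite lee_fin|exact: Iarc].
  - rewrite -sumEFin; apply: lee_sum => k _.
    rewrite [leRHS]EFinM; apply: lee_wpmul2l; first by rewrite lee_fin; exact: Q0.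
    apply: Iarc; first by rewrite mulr_gt0.
    apply: le_trans N1; rewrite ler_wpM2r ?(ltW r00)//.
    by rewrite ler_weXn2l ?ler1n.
  - by rewrite [leRHS]EFinM; apply: lee_wpmul2l => //; rewrite lee_fin; exact: Q0.
rewrite lee_fin.
have T0 : 0 < expR ((sigma - 2^-1) * L) by exact: expR_gt0.
have t1 : expR (a * ln (2 / d)) * r0 = 2 * K * expR (a * ln 2) * (M L * expR ((sigma - 2^-1) * L)).
  rewrite ln_div ?posrE// (_ : ln d = - L); last by rewrite -LE opprK.
  rewrite opprK mulrDr expRD /r0 {1}ddE.
  rewrite (_ : (sigma - 2^-1) * L = a * L + - L); last by rewrite /a; field.
  by rewrite expRD; ring.
(* The power of [2^k r0] is [1 - 2 a = - 2 sigma], and [r0 >= d] bounds [r0^(- 2 sigma)] by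
   [d^(- 2 sigma)]. *)
have t2 (k : nat) : expR (a * ln (8 * d / (2 ^+ k * r0) ^+ 2)) * (2 ^+ k.+1 * r0) <=
    2 * expR (a * ln 8) * expR ((sigma - 2^-1) * L) * theta ^+ k.
  have X0 : 0 < 2 ^+ k * r0 by rewrite mulr_gt0.
  have lr : - L <= ln r0.
    by rewrite -LE opprK ler_ln ?posrE.
  have e1 : ln (2 ^+ k * r0) = k%:R * ln 2 + ln r0.
    by rewrite lnM ?posrE// lnXn// mulr_natl.
  have e2 : ln (8 * d / (2 ^+ k * r0) ^+ 2) = ln 8 - L - 2 * (k%:R * ln 2 + ln r0).
    rewrite ln_div ?posrE ?mulr_gt0 ?exprn_gt0// lnM ?posrE// lnXn// e1.
    by rewrite -LE mulr2n; ring.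
  have -> : 2 ^+ k.+1 * r0 = 2 * expR (k%:R * ln 2 + ln r0).
    by rewrite -e1 lnK ?posrE// exprS mulrA.
  have -> : theta ^+ k = expR (k%:R * (- (2 * sigma) * ln 2)) by rewrite expRM_natl.
  rewrite e2 mulrCA -expRD -2![leRHS]mulrA ler_wpM2l// -2!expRD ler_expR /a.
  have := ler_wpM2l sigma0 lr; move: (ln 8) (ln r0) (k%:R) (ln 2) => x1 x2 x3 x4 H.
  rewrite -subr_ge0 [leRHS](_ : _ = 2 * (sigma * x2 - sigma * - L)); last by field.
  by rewrite mulr_ge0// subr_ge0.
have t3 : expR (a * ln (8 * d / (2 ^+ N * r0) ^+ 2)) * W <=
    e' * (M L * expR ((sigma - 2^-1) * L)).
  have X0 : 0 < 2 ^+ N * r0 by rewrite mulr_gt0.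
  apply: (@le_trans _ _ (D * expR (- a * L))).
    rewrite /D -[leRHS]mulrA [leLHS]mulrC ler_wpM2l// -expRD ler_expR.
    rewrite mulNr -mulrBr ler_wpM2l//.
    have : ln (8 * d / (2 ^+ N * r0) ^+ 2) <= ln (32 / h0 ^+ 2 * d).
      rewrite ler_ln ?posrE ?divr_gt0 ?mulr_gt0 ?exprn_gt0// ?invr_gt0 ?exprn_gt0//.
      rewrite ler_pdivrMr ?exprn_gt0//.
      have h2 : h0 ^+ 2 <= 4 * (2 ^+ N * r0) ^+ 2.
        have -> : 4 * (2 ^+ N * r0) ^+ 2 = (2 ^+ N.+1 * r0) ^+ 2.
          by rewrite (exprS 2 N) -mulrA; move: (2 ^+ N * r0) => X; ring.
        by rewrite lerXn2r ?nnegrE ?(ltW h00) ?(ltW N2)// mulr_ge0// ltW.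
      rewrite (_ : 32 / h0 ^+ 2 * d * _ = 8 * d * (4 * (2 ^+ N * r0) ^+ 2 / h0 ^+ 2)); last first.
        by move: (2 ^+ N * r0) => X; field; rewrite gt_eqF.
      by rewrite ler_pMr ?mulr_gt0// ler_pdivlMr ?exprn_gt0// mul1r.
    have -> : ln (32 / h0 ^+ 2 * d) = ln (32 / h0 ^+ 2) - L.
      by rewrite lnM ?posrE ?divr_gt0 ?exprn_gt0// -LE opprK.
    by [].
  rewrite (_ : - a * L = (sigma - 2^-1) * L + - (2 * sigma * L)); last by rewrite /a; field.
  rewrite expRD expRN mulrCA [leRHS]mulrA [leRHS]mulrC ler_wpM2l ?(ltW T0)//.
  rewrite ler_pdivrMr ?expR_gt0//; apply: (@le_trans _ _ (e' * (s' * L))).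
    rewrite mulrA -ler_pdivrMl ?mulr_gt0// mulrC; exact: le_trans LL1.
  by rewrite -[leRHS]mulrA ler_wpM2l ?(ltW e'0)// M_exp_ge.
have NL : N%:R * ln 2 <= L.
  rewrite mulr_natl -lnXn// -[leRHS]expRK ler_ln ?posrE ?expR_gt0//.
  rewrite -[expR L]invrK -expRN -ddE -(ler_pM2r dp) mulVf ?gt_eqF//.
  by apply: le_trans h01; apply: le_trans N1; rewrite ler_wpM2l// ltW.
have Ssum := sum_theta_le L_ge1 NL.
have L3p : 0 <= (3 * L) ^+ p by rewrite exprn_ge0// mulr_ge0// ltW.
have t2sum : \sum_(k < N) b k * (eta * (2 ^+ k.+1 * r0)) <=
    (3 * L) ^+ p * (eta * (2 * expR (a * ln 8) * S * (M L * expR ((sigma - 2^-1) * L)))).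
  apply: (@le_trans _ _ (\sum_(k < N) (3 * L) ^+ p * eta *
      (2 * expR (a * ln 8) * expR ((sigma - 2^-1) * L)) * theta ^+ k)).
    apply: ler_sum => k _; rewrite /b /Q.
    rewrite [leLHS](_ : _ = (3 * L) ^+ p * eta *
      (expR (a * ln (8 * d / (2 ^+ k * r0) ^+ 2)) * (2 ^+ k.+1 * r0))); last first.
      by rewrite mulrACA.
    rewrite -[leRHS]mulrA ler_wpM2l//.
    exact: mulr_ge0 L3p (ltW eta0).
  rewrite -mulr_sumr.
  rewrite (_ : (3 * L) ^+ p * (eta * _) = (3 * L) ^+ p * eta *
      (2 * expR (a * ln 8) * expR ((sigma - 2^-1) * L)) * (S * M L)); last by ring.
  apply: ler_wpM2l => //; apply: mulr_ge0; first exact: mulr_ge0 L3p (ltW eta0).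
  by apply: mulr_ge0; [rewrite mulr_ge0 ?expR_ge0|exact: expR_ge0].
have tb : Q (2 / d) * (eta * r0) + b N * W <= (3 * L) ^+ p *
    (eta * (2 * K * expR (a * ln 2) * (M L * expR ((sigma - 2^-1) * L))) +
     e' * (M L * expR ((sigma - 2^-1) * L))).
  rewrite mulrDr; apply: lerD.
    by rewrite -t1 /Q le_eqVlt; apply/orP; left; apply/eqP; ring.
  by rewrite /b /Q -[leLHS]mulrA ler_wpM2l.
set Y := M L * expR _ in t2sum tb t1 t3 *.
rewrite -addrA addrCA; apply: (le_trans (lerD t2sum tb)).
have -> : L ^+ p * M L * expR ((sigma - 2^-1) * L) = L ^+ p * Y by rewrite /Y mulrA.
rewrite exprMn le_eqVlt; apply/orP; left; apply/eqP.
have etaE : eta * C1 = e' by rewrite /eta divfK// gt_eqF.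
have e'E : e = e' * (2 * 3 ^+ p) by rewrite /e' divfK// gt_eqF// mulr_gt0.
rewrite e'E (_ : _ + _ = 3 ^+ p * L ^+ p * Y * (eta * C1 + e')); last by rewrite /C1; ring.
by rewrite etaE; ring.
Qed.

End kernel_estimate.

(** * Comparison of a positive measure with its density at a point *)

Section measure_limit.
Variable R : realType.
Implicit Types (z lambda : R[i]) (xi zeta : circle R).
Local Notation m := (@arc_measure R).

(** Unites the two definitions of the kernel: [p = n] and [sigma > 0] away from [-1/4], [p = 2 n]
    and [sigma = 0] there, where the additional logarithm of the spherical function is the critical
    factor. *)
Lemma poly_kernel_asymptotics n lambda :
  ~ (exists2 t : R, t < - 4^-1 & lambda = t%:C) ->
  exists p sigma C c d0, [/\ 0 <= sigma, (lambda = - 4^-1 -> sigma = 0), 0 < C,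
    0 < c & 0 < d0] /\
    (forall z xi, normc z < 1 ->
       normc (poly_kernel n lambda z xi) = C * abs_kernel p sigma (poisson z xi)) /\
    (forall z, normc z < 1 -> 1 - normc z <= d0 -> 1 - normc z <= 2^-1 /\
       c * ((- ln (1 - normc z)) ^+ p * critical_factor sigma (- ln (1 - normc z)) *
         expR ((sigma - 2^-1) * - ln (1 - normc z))) <= normc (poly_spherical n lambda z)).
Proof.
move=> hl; have [->|l4] := eqVneq lambda (- 4^-1).
  have [c [d0 [c0 d00 H]]] := critical_poly_spherical_lower_bound R n.
  exists (2 * n)%N, 0, ((2 * n)`!)%:R^-1, c, d0; split.
    by split => //; rewrite invr_gt0 ltr0n fact_gt0.
  split; first by move=> z xi z1; rewrite normc_critical_poly_kernel.
  by move=> z z1 zd; rewrite /critical_factor eqxx -exprSr; exact: H.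
have s0 := spar_Re_gt0 hl l4.
have [c [d0 [c0 d00 H]]] := poly_spherical_lower_bound n hl l4.
have w0 : spar lambda != 0 by apply: contraTneq s0 => ->; rewrite ltxx.
exists n, (Re (spar lambda)), (normc (kernel_const n lambda)), c, d0; split.
  split => //; first exact: ltW.
  - by move=> lE; rewrite lE eqxx in l4.
  - by apply: normc_gt0; exact: kernel_const_neq0.
split; first by move=> z xi z1; rewrite normc_poly_kernel.
by move=> z z1 zd; rewrite /critical_factor gt_eqF// mulr1; exact: H.
Qed.

Lemma normr_Rintegral_le (nu : {measure set (circle R) -> \bar R}) (psi : circle R -> R)
    (B : R) : nu.-integrable setT (EFin \o psi) ->
  (\int[nu]_xi `|psi xi|%:E <= B%:E)%E -> `|\int[nu]_xi psi xi| <= B.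
Proof.
move=> ip HB; apply: (le_trans (le_normr_Rintegral measurableT ip)).
rewrite -lee_fin /Rintegral fineK//; apply: integrable_fin_num => //.
exact: integrable_norm ip.
Qed.

Lemma Rintegral_mrestr_split (mu : {finite_measure set (circle R) -> \bar R})
    (N : set (circle R)) (mN : measurable N) (phi : circle R -> R) : continuous phi ->
  \int[mu]_xi phi xi =
  \int[mrestr mu mN]_xi phi xi + \int[mrestr mu (measurableC mN)]_xi phi xi.
Proof.
move=> cphi; have iN := continuous_circle_integrable (mrestr mu mN) cphi.
have iNC := continuous_circle_integrable (mrestr mu (measurableC mN)) cphi.
rewrite /Rintegral -fineD; last 2 first.
- exact: integrable_fin_num iN.
- exact: integrable_fin_num iNC.
congr fine; rewrite -integral_measure_add//.
apply: eq_measure_integral => A mA _.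
transitivity (mu (A `&` N) + mu (A `&` ~` N))%E; last exact/esym/measure_addE.
rewrite -measureU.
- by rewrite -setIUr setUv setIT.
- exact: measurableI.
- by apply: measurableI => //; exact: measurableC.
- by rewrite setIACA setICr setI0.
Qed.

Variables (k : R[i] -> circle R -> R[i]) (Phi : R[i] -> R[i]) (p : nat) (sigma C c d0 : R).
Hypotheses (sigma0 : 0 <= sigma) (C0 : 0 < C) (c0 : 0 < c) (d00 : 0 < d0).
Hypothesis kE : forall z xi, normc z < 1 ->
  normc (k z xi) = C * abs_kernel p sigma (poisson z xi).
Hypothesis PhiE : forall z, normc z < 1 -> 1 - normc z <= d0 -> 1 - normc z <= 2^-1 /\
  c * ((- ln (1 - normc z)) ^+ p * critical_factor sigma (- ln (1 - normc z)) *
    expR ((sigma - 2^-1) * - ln (1 - normc z))) <= normc (Phi z).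

(** A common enlargement of the approach regions close to the circle: within [K d] for [sigma != 0],
    within [K L d] for [sigma = 0]. *)
Definition approach (K : R) zeta z : Prop :=
  normc (z - circle_val zeta) <=
  K * critical_factor sigma (- ln (1 - normc z)) * (1 - normc z).

(** Uniformity in [phi] covers the real and the imaginary part of the kernel at once; taking a
    functional [I] instead of a measure allows differences, hence charges. *)
Definition small_discrepancy (I : (circle R -> R) -> R) (l : R) zeta :=
  forall K e : R, 1 <= K -> 0 < e -> exists2 d1 : R, 0 < d1 &
    forall z, normc z < 1 -> 1 - normc z <= d1 -> approach K zeta z ->
    forall phi : circle R -> R, continuous phi -> (forall xi, `|phi xi| <= normc (k z xi)) ->
      `|I phi - l * \int[m]_xi phi xi| <= e * normc (Phi z).

(** With [g] the density off [N], the discrepancy is the integral of [phi] over [N] against [mu]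
    plus that of [phi * (g - g zeta)] against [m]. Both fall under [kernel_weighted_integral_le], at
    almost every [zeta]. *)
Lemma ae_small_discrepancy (mu : {finite_measure set (circle R) -> \bar R})
    (N : set (circle R)) (mN : measurable N)
    (muNC : {finite_measure set (circle R) -> \bar R}) :
  m N = 0%E -> muNC = mrestr mu (measurableC mN) :> (set _ -> \bar R) -> muNC `<< m ->
  {ae m, forall zeta, small_discrepancy (fun phi => \int[mu]_xi phi xi)
     (fine (Radon_Nikodym (charge_of_finite_measure muNC) m zeta)) zeta}.
Proof.
move=> N0 muNCE dom.
pose gE := Radon_Nikodym (charge_of_finite_measure muNC) m.
have domc : charge_of_finite_measure muNC `<< m by [].
pose g x := fine (gE x).
have gEE x : gE x = (g x)%:E by rewrite fineK//; exact: Radon_Nikodym_fin_num.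
have igE : m.-integrable setT gE by exact: Radon_Nikodym_integrable.
have ig : m.-integrable setT (EFin \o g) by apply: eq_integrable igE => // x _; rewrite /= -gEE.
have mg : measurable_fun setT g by apply/measurable_EFinP; exact: measurable_int ig.
have H1 := ae_lebesgue_point ig; have H2 := @ae_singular_vanishing R mu N mN N0.
apply: filterS2 H1 H2 => zeta v1 v2 K e K1 e0.
pose w1 x : \bar R := `|g x - g zeta|%:E.
have igz : m.-integrable setT (EFin \o (fun x => g x - g zeta)).
  have := integrableB measurableT ig (finite_measure_integrable_cst m (g zeta) measurableT).
  by apply: eq_integrable.
have iw1 : m.-integrable setT w1 by have := integrable_norm igz.
have w10 x : (0 <= w1 x)%E by rewrite lee_fin.
have mw1 : measurable_fun setT w1 by exact: measurable_int iw1.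
pose muN : {finite_measure set (circle R) -> \bar R} := mrestr mu mN.
(* [C] passes from the kernel to [abs_kernel], [c] from the target order to [Phi], and 2 counts the
   two parts. *)
pose e1 := e * c / (2 * C).
have e10 : 0 < e1 by rewrite divr_gt0 ?mulr_gt0.
have v2' : vanishing_density (fun A => \int[muN]_(x in A) (cst 1%E) x)%E zeta.
  move=> eta /v2 [h0 h00 Hh]; exists h0 => // h /Hh.
  by rewrite integral_cst ?mul1e//; exact: measurable_arc.
have [W1 HW1] : exists W1 : R, (\int[m]_x w1 x <= W1%:E)%E.
  by exists (fine (\int[m]_x w1 x)%E); rewrite fineK// integrable_fin_num.
have [W2 HW2] : exists W2 : R, (\int[muN]_x cst 1%E x <= W2%:E)%E.
  exists (fine (muN setT)); rewrite integral_cst// mul1e fineK// fin_num_measure//.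
have [d1 d10 Hd1] := kernel_weighted_integral_le p sigma0 K1 w10 mw1 HW1 v1 e10.
have l01 (x : circle R) : (0 <= cst 1%E x :> \bar R)%E by exact: lee01.
have m1 : measurable_fun [set: circle R] (cst (1%E : \bar R)) by exact: measurable_cst.
have [d2 d20 Hd2] := kernel_weighted_integral_le p sigma0 K1 l01 m1 HW2 v2' e10.
exists (Num.min d0 (Num.min d1 d2)); first by rewrite !lt_min d00 d10.
move=> z z1; rewrite !le_min => /andP[zd0 /andP[zd1 zd2]] za phi cphi phik.
have {Hd1} Hd1 := Hd1 z z1 zd1 za; have {Hd2} Hd2 := Hd2 z z1 zd2 za.
have [_ Hc] := PhiE z1 zd0.
move: Hd1 Hd2 Hc; set Y := _ * expR _ => Hd1 Hd2 Hc.
pose ak xi := abs_kernel p sigma (poisson z xi).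
have phiak xi : `|phi xi| <= C * ak xi by rewrite (le_trans (phik xi))// kE.
have mak : measurable_fun setT ak.
  apply: continuous_circle_measurable.
  by apply: (@continuous_comp_poisson _ (abs_kernel p sigma)) => // x; exact: continuous_abs_kernel.
have [Mphi HM] := continuous_circle_bounded cphi.
have mphi := continuous_circle_measurable cphi.
have iphim := continuous_circle_integrable m cphi.
have iphig : m.-integrable setT (EFin \o (fun x => phi x * (g x - g zeta))).
  apply: (le_integrable _ _ _ (integrableZl measurableT Mphi iw1)) => //.
    apply/measurable_EFinP; apply: measurable_funM => //.
    exact: measurable_funB.
  move=> x _; rewrite lee_fin normrM normrM normr_id ler_wpM2r//.
  by apply: (le_trans (HM x)); exact: ler_norm.
have iphigE : m.-integrable setT (EFin \o (fun x => phi x * g x)).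
  apply: (le_integrable _ _ _ (integrableZl measurableT Mphi (integrable_norm ig))) => //.
    by apply/measurable_EFinP; exact: measurable_funM.
  move=> x _; rewrite lee_fin !normrM normr_id ler_wpM2r//.
  by apply: (le_trans (HM x)); exact: ler_norm.
have B1 : `|\int[m]_xi (phi xi * (g xi - g zeta))| <= C * (e1 * Y).
  apply: normr_Rintegral_le => //.
  apply: (@le_trans _ _ (\int[m]_xi (C%:E * ((ak xi)%:E * w1 xi)))%E).
    apply: ge0_le_integral => //.
    - apply/measurable_EFinP; apply: measurableT_comp => //.
      by apply: measurable_funM => //; exact: measurable_funB.
    - apply: measurable_funeM; apply: emeasurable_funM => //; exact/measurable_EFinP.
    - by move=> x _; rewrite /w1 -!EFinM lee_fin normrM mulrA ler_wpM2r.
  rewrite ge0_integralZl//; last 3 first.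
  - by apply: emeasurable_funM => //; exact/measurable_EFinP.
  - by move=> x _; rewrite mule_ge0// lee_fin abs_kernel_ge0.
  - by rewrite lee_fin ltW.
  by rewrite [leRHS]EFinM; apply: lee_wpmul2l => //; rewrite lee_fin ltW.
have B2 : `|\int[muN]_xi phi xi| <= C * (e1 * Y).
  apply: normr_Rintegral_le; first exact: continuous_circle_integrable.
  apply: (@le_trans _ _ (\int[muN]_xi (C%:E * ((ak xi)%:E * cst 1%E xi)))%E).
    apply: ge0_le_integral => //.
    - by apply/measurable_EFinP; apply: measurableT_comp.
    - by apply: measurable_funeM; apply: emeasurable_funM => //; exact/measurable_EFinP.
    - by move=> x _; rewrite mule1 -EFinM lee_fin.
  rewrite ge0_integralZl//; last 3 first.
  - by apply: emeasurable_funM => //; exact/measurable_EFinP.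
  - by move=> x _; rewrite mule_ge0// lee_fin abs_kernel_ge0.
  - by rewrite lee_fin ltW.
  by rewrite [leRHS]EFinM; apply: lee_wpmul2l => //; rewrite lee_fin ltW.
have E1 : \int[mrestr mu (measurableC mN)]_xi phi xi = \int[m]_xi (phi xi * g xi).
  have iphi : muNC.-integrable setT (EFin \o phi) by exact: continuous_circle_integrable.
  have := Radon_Nikodym_change_of_variables dom measurableT iphi.
  move=> /(congr1 fine); rewrite -/gE => E.
  transitivity (fine (\int[muNC]_x (EFin \o phi) x)%E).
    by congr fine; apply: eq_measure_integral => A mA _; exact: (esym (congr1 (@^~ A) muNCE)).
  rewrite -E; congr fine; apply: eq_integral => x _.
  by rewrite gEE.
rewrite (Rintegral_mrestr_split mu mN cphi) E1.
have E2 : \int[m]_xi (phi xi * (g xi - g zeta)) =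
    \int[m]_xi (phi xi * g xi) - g zeta * \int[m]_xi phi xi.
  rewrite -RintegralZl// -RintegralB//; last first.
    by have := integrableZl measurableT (g zeta) iphim.
  by apply: eq_Rintegral => x _; ring.
rewrite -/(g zeta) -addrA -E2; apply: (le_trans (ler_normD _ _)).
apply: (le_trans (lerD B2 B1)).
rewrite (_ : _ + _ = e * (c * Y)); last by rewrite /e1; field; rewrite gt_eqF.
by rewrite ler_wpM2l// ltW.
Qed.

End measure_limit.

(** * The limit *)

Section absolutely_continuous_part.
Context d (T : measurableType d) (R : realType).
Implicit Types (m : {measure set T -> \bar R}) (nu : {charge set T -> \bar R}).

(** Exhaustion: a union of [m]-null sets whose masses approach the supremum attains it, and a null
    set charged outside this union would exceed it. Off [N] the measure is dominated by [m], which
    yields the Lebesgue decomposition. *)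
Lemma finite_measure_null_carrier m (mu : {finite_measure set T -> \bar R}) :
  exists N, [/\ measurable N, m N = 0%E &
    forall A, measurable A -> m A = 0%E -> mu (A `&` ~` N) = 0%E].
Proof.
pose S := [set mu A | A in [set A | measurable A /\ m A = 0%E]].
have S0 : S (mu set0) by exists set0 => //; split => //; exact: measure0.
have ubS : ubound S (mu setT).
  by move=> _ [A [mA _] <-]; apply: le_measure; rewrite ?inE.
have sfin : ereal_sup S \is a fin_num.
  rewrite ge0_fin_numE; last by apply: ereal_sup_ubound; rewrite -(measure0 mu).
  apply: (le_lt_trans (ge_ereal_sup ubS)).
  by rewrite -ge0_fin_numE// fin_num_measure.
have /choice[F HF] : forall n, exists A, [/\ measurable A, m A = 0%E &
    (ereal_sup S - n.+1%:R^-1%:E < mu A)%E].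
  move=> n; have n0 : (0 < n.+1%:R^-1 :> R) by rewrite invr_gt0 ltr0n.
  have [_ [A [mA A0] <-] lt] := ub_ereal_sup_adherent n0 sfin.
  by exists A.
have mF n : measurable (F n) by have [] := HF n.
have mN : measurable (\bigcup_n F n) by exact: bigcup_measurable.
have N0 : m (\bigcup_n F n) = 0%E.
  apply/eqP; rewrite eq_le measure_ge0 andbT.
  have := measure_sigma_subadditive m mF mN (@subset_refl _ _).
  move/le_trans; apply.
  by rewrite eseries0// => n _ _; have [] := HF n.
exists (\bigcup_n F n); split => // A mA A0.
have mAN : measurable (A `&` ~` (\bigcup_n F n)) by apply: measurableI => //; exact: measurableC.
have muNfin : mu (\bigcup_n F n) \is a fin_num by rewrite fin_num_measure.
have leS : (mu (A `&` ~` (\bigcup_n F n)) + mu (\bigcup_n F n) <= ereal_sup S)%E.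
  rewrite -measureU//; last by rewrite -setIA setICl setI0.
  apply: ereal_sup_ubound; exists (A `&` ~` (\bigcup_n F n) `|` (\bigcup_n F n)) => //.
  split; first exact: measurableU.
  apply/eqP; rewrite eq_le measure_ge0 andbT.
  have := @measureU2 _ _ _ m _ _ mAN mN; move/le_trans; apply.
  by rewrite [X in (_ + X)%E]N0 adde0 -A0; apply: le_measure; rewrite ?inE.
have geS : (ereal_sup S <= mu (\bigcup_n F n))%E.
  apply/lee_addgt0Pr => e e0.
  have [n ne] := @invr_natS_lt R e e0.
  have [_ _ lt] := HF n.
  rewrite -leeBlDr//; apply: (@le_trans _ _ (ereal_sup S - n.+1%:R^-1%:E)%E).
    by rewrite leeB// lee_fin ltW.
  apply: (le_trans (ltW lt)); apply: le_measure; rewrite ?inE//.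
  exact: bigcup_sup.
apply/eqP; rewrite eq_le measure_ge0 andbT.
by rewrite -(leeD2rE _ _ muNfin) add0e; exact: le_trans leS geS.
Qed.

Lemma crestr0E nu D (mD : measurable D) A : measurable A -> crestr0 nu mD A = nu (A `&` D).
Proof. by move=> mA; rewrite /crestr0 mem_set. Qed.

Lemma crestr0_split nu N (mN : measurable N) A : measurable A ->
  nu A = (crestr0 nu (measurableC mN) A + crestr0 nu mN A)%E.
Proof.
move=> mA; rewrite !crestr0E// -chargeU.
- by rewrite -setIUr setUC setUv setIT.
- by apply: measurableI => //; exact: measurableC.
- exact: measurableI.
- by rewrite setIACA setICl setI0.
Qed.

Lemma crestr0_null_set nu N (mN : measurable N) : (crestr0 nu mN).-null_set (~` N).
Proof.
move=> A mA AN /=; rewrite crestr0E//.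
rewrite (_ : A `&` N = set0) ?charge0//.
by apply/seteqP; split => x // -[/AN].
Qed.

Variables (nu : {charge set T -> \bar R}) (m : {sigma_finite_measure set T -> \bar R}).
Variables (P M : set T) (nuPM : hahn_decomposition nu P M) (N : set T) (mN : measurable N).
Local Notation NC := (measurableC mN).
Let p := jordan_pos nuPM.
Let q := jordan_neg nuPM.
Let pac : {finite_measure set T -> \bar R} := mrestr p NC.
Let qac : {finite_measure set T -> \bar R} := mrestr q NC.
Hypotheses (pm : pac `<< m) (qm : qac `<< m).

Lemma crestr0_jordan A : measurable A -> crestr0 nu NC A = (pac A - qac A)%E.
Proof.
move=> mA; rewrite crestr0E// (jordan_decomp nuPM); last by apply: measurableI => //; exact: NC.
by congr (_ + _)%E; exact: (congr1 (@^~ (A `&` ~` N)) (cscaleN1 (jordan_neg nuPM))).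
Qed.

Lemma crestr0_dominates : crestr0 nu NC `<< m.
Proof.
apply/null_content_dominatesP => A mA A0; rewrite [LHS]crestr0_jordan//.
move/null_content_dominatesP : pm => /(_ A mA A0) ->.
by move/null_content_dominatesP : qm => /(_ A mA A0) ->; rewrite sube0.
Qed.

(** Both sides have the same integral over every measurable set, which determines an integrable
    function almost everywhere. *)
Lemma Radon_Nikodym_crestr0 : {ae m, forall x,
  fine (Radon_Nikodym (crestr0 nu NC) m x) =
  fine (Radon_Nikodym (charge_of_finite_measure pac) m x) -
  fine (Radon_Nikodym (charge_of_finite_measure qac) m x)}.
Proof.
have ipq : m.-integrable setT (fun x => (Radon_Nikodym (charge_of_finite_measure pac) m x -
    Radon_Nikodym (charge_of_finite_measure qac) m x)%E).
  by apply: integrableB => //; exact: Radon_Nikodym_integrable.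
have : ae_eq m setT (Radon_Nikodym (crestr0 nu NC) m)
   (fun x => (Radon_Nikodym (charge_of_finite_measure pac) m x -
    Radon_Nikodym (charge_of_finite_measure qac) m x)%E).
  apply: integral_ae_eq => //.
  - by apply: Radon_Nikodym_integrable; exact: crestr0_dominates.
  - exact: measurable_int ipq.
  - move=> A _ mA; rewrite integralB//; last 2 first.
    + by apply: (integrableS measurableT) => //; exact: Radon_Nikodym_integrable.
    + by apply: (integrableS measurableT) => //; exact: Radon_Nikodym_integrable.
    rewrite -!Radon_Nikodym_integral//; last exact: crestr0_dominates.
    exact: crestr0_jordan.
apply: filterS => x /(_ Logic.I) ->; rewrite fineB//; exact: Radon_Nikodym_fin_num.
Qed.

End absolutely_continuous_part.

Local Notation pos_part nu := (jordan_pos (svalP (hahn nu))).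
Local Notation neg_part nu := (jordan_neg (svalP (hahn nu))).
Local Notation off_null mu mN :=
  (mrestr mu (measurableC mN) : {finite_measure set _ -> \bar _}).

(** * From discrepancies to convergence of the quotient *)

Section convergence.
Variable R : realType.
Implicit Types (z lambda l : R[i]) (xi zeta : circle R).
Local Notation m := (@arc_measure R).

Lemma normc_le_add (a b : R) : normc (a +i* b) <= `|a| + `|b|.
Proof.
have -> : a +i* b = a%:C + (0 +i* b) by simpc.
by rewrite (le_trans (le_normcD _ _))// normcR lerD2l /= expr0n/= add0r sqrtr_sqr.
Qed.

Lemma converges_in_approach (region : R -> circle R -> set R[i]) (D : set R[i])
    (f : R[i] -> R[i]) zeta l (sigma : R) :
  (forall z, D z -> normc z < 1) ->
  (forall a, 0 <= a -> exists2 K : R, 1 <= K & exists2 d : R, 0 < d & forall z,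
    normc z < 1 -> region a zeta z -> 1 - normc z <= d -> approach sigma K zeta z) ->
  (forall K e : R, 1 <= K -> 0 < e -> exists2 d : R, 0 < d & forall z,
    normc z < 1 -> 1 - normc z <= d -> approach sigma K zeta z -> normc (f z - l) < e) ->
  converges_in region D f zeta l.
Proof.
move=> D1 reg lim a a0; have [K K1 [d2 d20 H2]] := reg a a0.
apply/cvgrPdist_lt => -[e e'] /=.
rewrite ltcE /= => /andP[/eqP -> e0].
have [d1 d10 H1] := lim K e K1 e0.
rewrite near_withinE.
have d0 : 0 < Num.min d1 d2 by rewrite lt_min d10.
have : \forall z \near nbhs (circle_val zeta), normc (circle_val zeta - z) < Num.min d1 d2.
  rewrite -nbhs_ballE; exists (Num.min d1 d2)%:C => /=; first by rewrite ltcR.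
  by move=> z; rewrite /ball /= normrcE ltcR.
apply: filterS => z; rewrite lt_min => /andP[zd1 zd2] [rz Dz].
have z1 := D1 z Dz; have B := normcB_ge z zeta.
rewrite normrcE ltcR normcBC; apply: H1 => //; first exact: le_trans B (ltW zd1).
by apply: H2 => //; exact: le_trans B (ltW zd2).
Qed.

Lemma critical_factor_ge1 (sigma d : R) : 0 < d -> d <= expR (- 1) ->
  1 <= critical_factor sigma (- ln d).
Proof.
move=> d0 d1; rewrite /critical_factor; case: eqP => // _.
by rewrite lerNr -[leRHS]expRK ler_ln ?posrE ?expR_gt0.
Qed.

Lemma admissible_approach (sigma a : R) zeta : 0 <= a ->
  exists2 K : R, 1 <= K & exists2 d : R, 0 < d & forall z,
    normc z < 1 -> admissible_region a zeta z -> 1 - normc z <= d -> approach sigma K zeta z.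
Proof.
move=> a0; have E1 : 1 <= expR (a + 1) by rewrite -expR0 ler_expR addr_ge0.
exists (8 * expR (a + 1)); first by apply: (le_trans E1); rewrite ler_peMl ?expR_ge0// ler1n.
exists (expR (- 1)); first exact: expR_gt0.
move=> z z1 az zd; have d0 : 0 < 1 - normc z by rewrite subr_gt0.
apply: (le_trans (admissible_region_close az)).
rewrite ler_wpM2r ?(ltW d0)// ler_peMr ?mulr_ge0 ?expR_ge0//.
exact: critical_factor_ge1.
Qed.

Lemma enlarged_approach (a : R) zeta : 0 <= a ->
  exists2 K : R, 1 <= K & exists2 d : R, 0 < d & forall z,
    normc z < 1 -> enlarged_region a zeta z -> 1 - normc z <= d -> approach 0 K zeta z.
Proof.
move=> a0; have E1 : 1 <= expR (a + 1) by rewrite -expR0 ler_expR addr_ge0.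
exists (16 * expR (a + 1)); first by apply: (le_trans E1); rewrite ler_peMl ?expR_ge0// ler1n.
exists 2^-1; first by rewrite invr_gt0.
move=> z z1 az zd; rewrite /approach /critical_factor eqxx.
exact: enlarged_region_close.
Qed.

Lemma continuous_poly_kernel n lambda z : normc z < 1 ->
  continuous (fun xi => Re (poly_kernel n lambda z xi)) /\
  continuous (fun xi => Im (poly_kernel n lambda z xi)).
Proof.
move=> z1; have [->|l4] := eqVneq lambda (- 4^-1).
  split.
    rewrite (_ : (fun _ => _) = (fun x => ((2 * n)`!)%:R^-1 * kernel_modulus (2 * n) 0 x) \o
       poisson z); last by apply/funext => xi; rewrite critical_poly_kernelE.
    apply: continuous_comp_poisson => // x x0.
    by apply: cvgM; [exact: cvg_cst|exact: continuous_kernel_modulus].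
  rewrite (_ : (fun _ => _) = cst 0); first exact: cst_continuous.
  by apply/funext => xi; rewrite critical_poly_kernelE.
case E : (kernel_const n lambda) => [a b].
pose M := kernel_modulus n (Re (spar lambda)).
pose t := Im (spar lambda).
have cM (G : R -> R) (s x : R) : continuous G -> 0 < x ->
    {for x, continuous (fun y => s * (M y * G (t * ln y)))}.
  move=> cG x0; apply: cvgM; first exact: cvg_cst.
  by apply: cvgM; [exact: continuous_kernel_modulus|exact: continuous_scaled_ln].
split.
  rewrite (_ : (fun _ => _) = (fun x => a * (M x * cos (t * ln x)) - b * (M x * sin (t * ln x)))
     \o poisson z); last by apply/funext => xi; rewrite poly_kernelE// E.
  apply: continuous_comp_poisson => // x x0; apply: cvgB.
    by apply: cM => //; exact: continuous_cos.
  by apply: cM => //; exact: continuous_sin.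
rewrite (_ : (fun _ => _) = (fun x => a * (M x * sin (t * ln x)) + b * (M x * cos (t * ln x)))
   \o poisson z); last by apply/funext => xi; rewrite poly_kernelE// E.
apply: continuous_comp_poisson => // x x0; apply: cvgD.
  by apply: cM => //; exact: continuous_sin.
by apply: cM => //; exact: continuous_cos.
Qed.

Section discrepancy.
Variables (k : R[i] -> circle R -> R[i]) (Phi : R[i] -> R[i]) (sigma : R).

Lemma small_discrepancyB I1 I2 (l1 l2 : R) zeta :
  small_discrepancy k Phi sigma I1 l1 zeta -> small_discrepancy k Phi sigma I2 l2 zeta ->
  small_discrepancy k Phi sigma (fun phi => I1 phi - I2 phi) (l1 - l2) zeta.
Proof.
move=> H1 H2 K e K1 e0; have e2 : 0 < e / 2 by rewrite divr_gt0.
have [d1 d10 {}H1] := H1 K _ K1 e2; have [d2 d20 {}H2] := H2 K _ K1 e2.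
exists (Num.min d1 d2); first by rewrite lt_min d10.
move=> z z1; rewrite le_min => /andP[zd1 zd2] za phi cphi phik.
rewrite [X in `|X|](_ : _ = (I1 phi - l1 * \int[m]_xi phi xi) -
  (I2 phi - l2 * \int[m]_xi phi xi)); last by ring.
apply: (le_trans (ler_normB _ _)); rewrite [e in leRHS](splitr e) mulrDl.
by apply: lerD; [exact: H1|exact: H2].
Qed.

Lemma ae_charge_discrepancy (nu : {charge set (circle R) -> \bar R}) (N : set (circle R))
    (mN : measurable N) : m N = 0%E ->
  off_null (pos_part nu) mN `<< m ->
  off_null (neg_part nu) mN `<< m ->
  (forall (mu muNC : {finite_measure set (circle R) -> \bar R}),
    muNC = mrestr mu (measurableC mN) :> (set _ -> \bar R) -> muNC `<< m ->
    {ae m, forall zeta, small_discrepancy k Phi sigma (fun phi => \int[mu]_xi phi xi)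
     (fine (Radon_Nikodym (charge_of_finite_measure muNC) m zeta)) zeta}) ->
  {ae m, forall zeta, small_discrepancy k Phi sigma (charge_integral nu)
     (fine (Radon_Nikodym (crestr0 nu (measurableC mN)) m zeta)) zeta}.
Proof.
move=> N0 dp dn H.
have Hp := H _ _ (erefl _) dp; have Hn := H _ _ (erefl _) dn.
have HR := Radon_Nikodym_crestr0 dp dn.
apply: filterS3 HR Hp Hn => zeta -> Hp Hn.
exact: small_discrepancyB Hp Hn.
Qed.

(** Subtracting [(l1 + i l2) * Phi] from the numerator leaves in each of the real and imaginary
    parts a combination of two real discrepancies, each small compared with [|Phi|]. *)
Lemma quotient_close I1 I2 (l1 l2 : R) zeta :
  (forall z, normc z < 1 -> continuous (fun xi => Re (k z xi)) /\
    continuous (fun xi => Im (k z xi))) ->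
  Phi = (fun z => (\int[m]_xi Re (k z xi)) +i* (\int[m]_xi Im (k z xi))) ->
  small_discrepancy k Phi sigma I1 l1 zeta -> small_discrepancy k Phi sigma I2 l2 zeta ->
  forall K e : R, 1 <= K -> 0 < e -> exists2 d : R, 0 < d & forall z,
    normc z < 1 -> 1 - normc z <= d -> approach sigma K zeta z -> Phi z != 0 ->
    normc (((I1 (fun x => Re (k z x)) - I2 (fun x => Im (k z x))) +i*
      (I1 (fun x => Im (k z x)) + I2 (fun x => Re (k z x)))) / Phi z - (l1 +i* l2)) < e.
Proof.
(* Four discrepancies occur; fifths make the final inequality strict. *)
move=> ck PhiE H1 H2 K e K1 e0; have e5 : 0 < e / 5 by rewrite divr_gt0.
have [d1 d10 {}H1] := H1 K _ K1 e5; have [d2 d20 {}H2] := H2 K _ K1 e5.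
exists (Num.min d1 d2); first by rewrite lt_min d10.
move=> z z1; rewrite le_min => /andP[zd1 zd2] za Phi0.
have [cr ci] := ck z z1.
have kr xi : `|Re (k z xi)| <= normc (k z xi) by case: (k z xi) => x y; exact: normc_ge_Re.
have ki xi : `|Im (k z xi)| <= normc (k z xi) by case: (k z xi) => x y; exact: normc_ge_Im.
have A1 := H1 z z1 zd1 za _ cr kr; have A2 := H1 z z1 zd1 za _ ci ki.
have A3 := H2 z z1 zd2 za _ cr kr; have A4 := H2 z z1 zd2 za _ ci ki.
have P0 := normc_gt0 Phi0.
set T := _ +i* _; have -> : T / Phi z - (l1 +i* l2) = (T - (l1 +i* l2) * Phi z) / Phi z.
  by rewrite mulrBl mulfK.
rewrite normcM normcV ltr_pdivrMr//.
apply: (@le_lt_trans _ _ (4 * (e / 5 * normc (Phi z)))); last first.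
  rewrite mulrA ltr_pM2r//; move: e0; lra.
move: A1 A2 A3 A4; move: (e / 5 * _) => B.
have -> : Phi z = (\int[m]_xi Re (k z xi)) +i* (\int[m]_xi Im (k z xi)) by rewrite PhiE.
rewrite /T; move: (\int[m]_xi Re (k z xi)) (\int[m]_xi Im (k z xi)).
move: (I1 _) (I2 _) (I1 _) (I2 _) => x3 x2 x1 x4 X Y A1 A2 A3 A4.
rewrite (_ : _ - _ = ((x1 - l1 * X) - (x2 - l2 * Y)) +i* ((x3 - l1 * Y) + (x4 - l2 * X))); last first.
  by simpc; congr (_ +i* _); ring.
apply: (le_trans (normc_le_add _ _)).
have := ler_normB (x1 - l1 * X) (x2 - l2 * Y).
have := ler_normD (x3 - l1 * Y) (x4 - l2 * X).
move: A1 A2 A3 A4; lra.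
Qed.

End discrepancy.

End convergence.

Lemma null_carrier_dominates d (T : measurableType d) (R : realType)
    (m : {measure set T -> \bar R}) (mu : {finite_measure set T -> \bar R})
    (N N' : set T) (mN : measurable N) :
  measurable N' -> N' `<=` N ->
  (forall A, measurable A -> m A = 0%E -> mu (A `&` ~` N') = 0%E) ->
  off_null mu mN `<< m.
Proof.
move=> mN' N'N H; apply/null_content_dominatesP => A mA A0.
apply/eqP; rewrite eq_le measure_ge0 andbT -(H A mA A0).
have mC X : measurable X -> measurable (A `&` ~` X).
  by move=> mX; apply: measurableI => //; exact: measurableC.
by apply: le_measure; rewrite ?inE; [exact: mC..|apply: setIS; exact: subsetC].
Qed.

Section limit.
Variables (R : realType) (n : nat) (lambda : R[i]).
Hypothesis hlambda : ~ exists2 t : R, t < - 4^-1 & lambda = t%:C.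
Variable nu : complex_measure (circle R) R.
Local Notation m := (@arc_measure R).

(** One null set for all four Jordan parts makes the absolutely continuous part of [nu] its plain
    restriction to the complement. *)
Lemma common_null_carrier : exists N (mN : measurable N), [/\ m N = 0%E,
  off_null (pos_part (cm_re nu)) mN `<< m /\
  off_null (neg_part (cm_re nu)) mN `<< m,
  off_null (pos_part (cm_im nu)) mN `<< m &
  off_null (neg_part (cm_im nu)) mN `<< m].
Proof.
have [N1 [mN1 N10 H1]] := finite_measure_null_carrier m (pos_part (cm_re nu)).
have [N2 [mN2 N20 H2]] := finite_measure_null_carrier m (neg_part (cm_re nu)).
have [N3 [mN3 N30 H3]] := finite_measure_null_carrier m (pos_part (cm_im nu)).
have [N4 [mN4 N40 H4]] := finite_measure_null_carrier m (neg_part (cm_im nu)).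
have mN12 := measurableU _ _ mN1 mN2; have mN34 := measurableU _ _ mN3 mN4.
exists ((N1 `|` N2) `|` (N3 `|` N4)), (measurableU _ _ mN12 mN34); split.
- by do ! apply: null_set_setU => //.
- split.
    by apply: (null_carrier_dominates _ mN1 _ H1) => x; left; left.
  by apply: (null_carrier_dominates _ mN2 _ H2) => x; left; right.
- by apply: (null_carrier_dominates _ mN3 _ H3) => x; right; left.
- by apply: (null_carrier_dominates _ mN4 _ H4) => x; right; right.
Qed.

Lemma lebesgue_decomposition_crestr0 N (mN : measurable N) : m N = 0%E ->
  crestr0 (cm_re nu) (measurableC mN) `<< m -> crestr0 (cm_im nu) (measurableC mN) `<< m ->
  lebesgue_decomposition m nu
    (ComplexMeasure (crestr0 (cm_re nu) (measurableC mN)) (crestr0 (cm_im nu) (measurableC mN)))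
    (ComplexMeasure (crestr0 (cm_re nu) mN) (crestr0 (cm_im nu) mN)).
Proof.
move=> N0 dr di; split => //.
- by move=> A mA; split; exact: crestr0_split.
- by exists N; split => //; exact: crestr0_null_set.
Qed.

Lemma ae_normalised_transform_close N (mN : measurable N) : m N = 0%E ->
  off_null (pos_part (cm_re nu)) mN `<< m ->
  off_null (neg_part (cm_re nu)) mN `<< m ->
  off_null (pos_part (cm_im nu)) mN `<< m ->
  off_null (neg_part (cm_im nu)) mN `<< m ->
  exists2 sigma : R, lambda = - 4^-1 -> sigma = 0 &
  {ae m, forall zeta, forall K e : R, 1 <= K -> 0 < e -> exists2 d : R, 0 < d & forall z,
    normc z < 1 -> 1 - normc z <= d -> approach sigma K zeta z ->
    normc (normalised_transform n lambda nu z - complex_Radon_Nikodym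
      (ComplexMeasure (crestr0 (cm_re nu) (measurableC mN)) (crestr0 (cm_im nu) (measurableC mN)))
      m zeta) < e}.
Proof.
move=> N0 rp rn ip i_n.
have [p [sigma [C [c [d0 [[s0 sl C0 c0 d00] [kE PhiE]]]]]]] :=
  poly_kernel_asymptotics n hlambda.
exists sigma => //.
have H (mu muNC : {finite_measure set (circle R) -> \bar R}) :=
  @ae_small_discrepancy _ _ _ _ _ _ _ _ s0 C0 c0 d00 kE PhiE mu N mN muNC N0.
have Hre := ae_charge_discrepancy N0 rp rn H.
have Him := ae_charge_discrepancy N0 ip i_n H.
apply: filterS2 Hre Him => zeta Hr Hi K e K1 e0.
have [d d_gt0 Hd] := quotient_close (@continuous_poly_kernel R n lambda) erefl Hr Hi K1 e0.
exists (Num.min d (Num.min d0 (expR (- 1)))); first by rewrite !lt_min d_gt0 d00 expR_gt0.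
move=> z z1; rewrite !le_min => /andP[zd /andP[zd0 ze]] za.
apply: Hd => //.
(* The lower bound is positive once [- ln (1 - |z|) >= 1], so the denominator does not vanish near
   the circle. *)
have [_] := PhiE z z1 zd0; apply: contraTneq => E.
rewrite [poly_spherical n lambda z]E normc0 -ltNge.
have dp : 0 < 1 - normc z by rewrite subr_gt0.
have L1 : 1 <= - ln (1 - normc z) by rewrite lerNr -[leRHS]expRK ler_ln ?posrE ?expR_gt0.
rewrite !mulr_gt0 ?expR_gt0 ?exprn_gt0 ?(lt_le_trans _ L1)//.
exact: lt_le_trans (critical_factor_ge1 _ dp ze).
Qed.

End limit.

Theorem theorem6p5 (R : realType) (n : nat) (lambda : R[i])
  (hlambda : ~ exists2 t : R, t < - 4^-1 & lambda = t%:C)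
  (nu : complex_measure (circle R) R)
  (r : R) (hr : normalising_radius n lambda r) :
  let f := normalised_transform n lambda nu in
  let D := [set z : R[i] | normc z < 1 /\ r <= normc z] in
  exists nu_ac nu_s : complex_measure (circle R) R,
    [/\ lebesgue_decomposition (@arc_measure R) nu nu_ac nu_s,
        {ae @arc_measure R, forall xi : circle R,
          converges_admissibly D f xi
            (complex_Radon_Nikodym nu_ac (@arc_measure R) xi)} &
        lambda = - 4^-1 ->
        {ae @arc_measure R, forall xi : circle R,
          converges_enlarged_admissibly D f xi
            (complex_Radon_Nikodym nu_ac (@arc_measure R) xi)}].
Proof.
move=> f D.
have [N [mN [N0 [rp rn] ip i_n]]] := common_null_carrier nu.
exists (ComplexMeasure (crestr0 (cm_re nu) (measurableC mN)) (crestr0 (cm_im nu) (measurableC mN))).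
exists (ComplexMeasure (crestr0 (cm_re nu) mN) (crestr0 (cm_im nu) mN)).
have [sigma sl H] := ae_normalised_transform_close n hlambda N0 rp rn ip i_n.
split.
- by apply: lebesgue_decomposition_crestr0 => //; [exact: crestr0_dominates rp rn|exact: crestr0_dominates ip i_n].
- apply: filterS H => zeta H; apply: converges_in_approach H => [z []//|a a0].
  exact: admissible_approach.
(* For [sigma = 0] the same estimate already admits the additional factor [L] of the enlarged
   regions. *)
- move=> /sl s0; apply: filterS H => zeta H; apply: converges_in_approach H => [z []//|a a0].
  by rewrite s0; exact: enlarged_approach.
Qed.
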